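(* Let $u_0\in H^1(0,1)$, $\varepsilon\in(0,1)$, and let $u_0^\varepsilon\in H^1(0,1)$ satisfy $\|u_0^\varepsilon-u_0\|_{H^1(0,1)}\le\varepsilon$ and $u_0^\varepsilon(0)=u_0^\varepsilon(1)=0$. Let $\beta=\beta(\varepsilon)\in(0,1)$, let $\mathbf{Q}_\varepsilon^\beta$ be a perturbing operator with associated space $\mathbb{W}\subset L^2(0,1)$ and constant $C_0$, and assume that $\mathbf{P}_\varepsilon^\beta=\mathbf{Q}_\varepsilon^\beta+2\,\partial^2/\partial y^2$ is a stabilized operator with constant $C_1$. Let $u\in C([0,1];\mathbb{W})$ be the unique (strong, i.e. $H^2((0,1)\times(0,1))$) solution of $$u_{xx}+u_{yy}=0\ \text{in }(0,1)\times(0,1),\quad u(x,0)=u(x,1)=0\ (x\in[0,1]),\quad u(0,y)=u_0(y),\ u_x(0,y)=0\ (y\in[0,1]).$$ Let $u_\beta^\varepsilon$ be the unique weak solution of $$\partial_x^2u_\beta^\varepsilon-\partial_y^2u_\beta^\varepsilon+\mathbf{P}_\varepsilon^\beta u_\beta^\varepsilon=0\ \text{in }(0,1)\times(0,1),\quad u_\beta^\varepsilon(x,0)=u_\beta^\varepsilon(x,1)=0,\quad u_\beta^\varepsilon(0,y)=u_0^\varepsilon(y),\ \partial_xu_\beta^\varepsilon(0,y)=0.$$ If $\gamma(\beta)\ge1$ is such that $\tfrac{2}{3}C_1\log(\gamma(\beta))>1$, then for every $x\in[0,1]$ $$\|\partial_xu_\beta^\varepsilon(x,\cdot)-\partial_xu(x,\cdot)\|^2+\|u_\beta^\varepsilon(x,\cdot)-u(x,\cdot)\|_{H^1(0,1)}^2$$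 $$\le\frac43C_1^2\left[4\varepsilon^2+\frac{27}{8}C_0^2C_1^{-3}\gamma^{-2}(\beta)\log^{-3}(\gamma(\beta))\,x\,\|u\|_{C([0,1];\mathbb{W})}^2\right]\log^2(\gamma(\beta))\,\gamma^{7C_1x/3}(\beta).$$
   Context: All functions are real-valued. $\|\cdot\|$ is the norm of $L^2(0,1)$ (in the variable $y$), and $\langle\cdot,\cdot\rangle$ is the $L^2(0,1)$ inner product or the duality pairing between $H^{-1}(0,1)$ and $H_0^1(0,1)$. Functions of $(x,y)$ are viewed as functions of $x\in[0,1]$ with values in function spaces in $y\in(0,1)$; the operators $\mathbf{Q}_\varepsilon^\beta,\mathbf{P}_\varepsilon^\beta$ act in the variable $y$. Auxiliary function: $\gamma:(0,1)\to\mathbb{R}$ with $\gamma(\beta)\ge1$ for all $\beta\in(0,1)$ and $\lim_{\beta\to0}\gamma(\beta)=\infty$; powers are $\gamma^a(\beta)=(\gamma(\beta))^a$ and $\log^a(\cdot)=(\log(\cdot))^a$. The regularization parameter $\beta=\beta(\varepsilon)\in(0,1)$ satisfies $\beta\to0$ as $\varepsilon\to0$. Perturbing operator: a linear map $\mathbf{Q}_\varepsilon^\beta:L^2(0,1)\to L^2(0,1)$ for which there are a (normed) function space $\mathbb{W}\subset L^2(0,1)$ and a constant $C_0>0$ independent of $\varepsilon$ with $\|\mathbf{Q}_\varepsilon^\beta u\|\le C_0\|u\|_{\mathbb{W}}/\gamma(\beta)$ for all $u\in\mathbb{W}$. Stabilized operator: a linear map $\mathbf{P}_\varepsilon^\beta:H^1(0,1)\to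 L^2(0,1)$ for which there is a constant $C_1>0$ independent of $\varepsilon$ with $\|\mathbf{P}_\varepsilon^\beta u\|\le C_1\log(\gamma(\beta))\|u\|_{H^1(0,1)}$ for all $u\in H^1(0,1)$. The relation $\mathbf{P}_\varepsilon^\beta=\mathbf{Q}_\varepsilon^\beta+2\,\partial^2/\partial y^2$ means $\mathbf{P}_\varepsilon^\beta v=\mathbf{Q}_\varepsilon^\beta v+2v_{yy}$ for $v\in H^2(0,1)\cap H_0^1(0,1)$. Weak solution of the regularized problem: a function $u_\beta^\varepsilon:[0,1]\to H_0^1(0,1)$ such that (i) $u_\beta^\varepsilon\in C([0,1];H_0^1(0,1))$, $\partial_xu_\beta^\varepsilon\in C([0,1];L^2(0,1))$, $\partial_x^2u_\beta^\varepsilon\in L^2(0,1;H^{-1}(0,1))$; (ii) for every $\psi\in H_0^1(0,1)$, $\langle\partial_x^2u_\beta^\varepsilon,\psi\rangle+\langle\partial_yu_\beta^\varepsilon,\partial_y\psi\rangle+\langle\mathbf{P}_\varepsilon^\beta u_\beta^\varepsilon,\psi\rangle=0$ for a.e. $x\in(0,1)$; (iii) $u_\beta^\varepsilon(0)=u_0^\varepsilon$ and $\partial_xu_\beta^\varepsilon(0)=0$. Such a weak solution exists and is unique. *)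

(* Defs.v *)
From HB Require Import structures.
From mathcomp Require Import all_boot all_order all_algebra.
From mathcomp Require Import all_classical all_reals all_analysis.

Set Implicit Arguments.
Unset Strict Implicit.
Unset Printing Implicit Defensive.
Import Order.TTheory GRing.Theory Num.Theory.
Import numFieldNormedType.Exports.
Local Open Scope classical_set_scope.
Local Open Scope ring_scope.

(* Functions on (0,1) are represented by total functions R -> R, of which only
   the restriction to ]0,1[ matters: every measure-theoretic notion refers to
   Lebesgue measure restricted to ]0,1[.  Elements of L^2(0,1) are
   representatives, and equality in L^2(0,1) is [f = g %[ae mu01 R]]. *)

Section Measure.
Variable R : realType.

Lemma lebesgue_measure01_lty :
  (@lebesgue_measure R `]0%R, 1%R[%classic < +oo)%E.
Proof. by rewrite lebesgue_measure_itv/= lte_fin ltr01 oppr0 adde0 ltry. Qed.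

Definition mu01 : {finite_measure set (measurableTypeR R) -> \bar R} :=
  @mfrestr _ (measurableTypeR R) R _ lebesgue_measure
    (measurable_itv `]0%R, 1%R[) lebesgue_measure01_lty.

Definition mu01sq :
    {measure set (measurableTypeR R * measurableTypeR R) -> \bar R} :=
  (mu01 \x mu01)%E.

End Measure.

(* A (semi)normed space of functions of y; [fnorm] is meaningful on the
   underlying set only. *)
Record fspace (R : realType) := FSpace {
  fcarrier : (R -> R) -> Prop ;
  fnorm : (R -> R) -> R }.
Coercion fcarrier : fspace >-> Funclass.

Section OneVariable.
Variable R : realType.
Implicit Types f g phi psi : R -> R.

Definition L2norm f : R := fine ('N[mu01 R]_(2%:E)[EFin \o f])%E.

Definition L2 : fspace R := FSpace (fun f => f \in Lfun (mu01 R) 2%:E) L2norm.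

Definition L2ip f g : R := \int[mu01 R]_y (f y * g y).

(* C_c^oo(0,1) *)
Definition test_fun phi : Prop :=
  (forall n x, derivable (derive1n n phi) x 1) /\
  exists a b : R, [/\ 0 < a, b < 1 & forall x, x \notin `[a, b] -> phi x = 0].

Definition weak_deriv f g : Prop := forall phi, test_fun phi ->
  \int[mu01 R]_y (f y * derive1 phi y) = - \int[mu01 R]_y (g y * phi y).

(* the weak derivative in L^2(0,1); unique up to a.e. equality if it exists *)
Definition wd f : R -> R := xget (cst 0) [set g | L2 g /\ weak_deriv f g].

Definition H1norm f : R := Num.sqrt (L2norm f ^+ 2 + L2norm (wd f) ^+ 2).

Definition H1 : fspace R :=
  FSpace (fun f => L2 f /\ exists g, L2 g /\ weak_deriv f g) H1norm.

(* the closure of C_c^oo(0,1) in H^1(0,1) *)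
Definition H10 : fspace R :=
  FSpace (fun f => H1 f /\ forall e : R, 0 < e ->
    exists2 phi, test_fun phi & H1norm (f - phi) < e) H1norm.

Definition H2 : set (R -> R) := [set f | H1 f /\ H1 (wd f)].

(* pointwise value at a point a of [0,1], i.e., the value of the continuous
   representative *)
Definition value_at f (a c : R) : Prop := exists g,
  [/\ {within `[0, 1], continuous g}, f = g %[ae mu01 R] & g a = c].

(* (normed) function space W included in L^2(0,1) *)
Record normed_L2_subspace (W : fspace R) : Prop := NormedL2Subspace {
  W_sub_L2 : forall f, W f -> L2 f ;
  W_zero : W 0 ;
  W_linear : forall (a : R) f g, W f -> W g -> W (a *: f + g) ;
  W_ae : forall f g, W f -> L2 g -> f = g %[ae mu01 R] ->
    W g /\ fnorm W f = fnorm W g ;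
  W_norm_ge0 : forall f, W f -> 0 <= fnorm W f ;
  W_norm_definite : forall f, W f -> fnorm W f = 0 -> f = 0 %[ae mu01 R] ;
  W_normZ : forall (a : R) f, W f -> fnorm W (a *: f) = `|a| * fnorm W f ;
  W_normD : forall f g, W f -> W g ->
    fnorm W (f + g) <= fnorm W f + fnorm W g }.

(* linear maps from a space D of classes of functions to L^2(0,1) *)
Record linear_map (D : (R -> R) -> Prop) (T : (R -> R) -> (R -> R)) : Prop :=
  LinearMap {
  linear_map_L2 : forall f, D f -> L2 (T f) ;
  linear_map_ae : forall f g, D f -> D g ->
    f = g %[ae mu01 R] -> T f = T g %[ae mu01 R] ;
  linear_map_lin : forall (a : R) f g, D f -> D g ->
    T (a *: f + g) = a *: T f + T g %[ae mu01 R] }.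

End OneVariable.

(* The families of operators are indexed by eps, with parameter beta eps. *)
Section Operators.
Variable R : realType.
Variables (gamma beta : R -> R).

Definition perturbing_operator (W : fspace R) (C0 : R)
    (Q : R -> (R -> R) -> (R -> R)) : Prop :=
  0 < C0 /\ forall eps, 0 < eps < 1 ->
    linear_map (fcarrier (L2 R)) (Q eps) /\
    forall f, W f -> L2norm (Q eps f) <= C0 * fnorm W f / gamma (beta eps).

Definition stabilized_operator (C1 : R)
    (P : R -> (R -> R) -> (R -> R)) : Prop :=
  0 < C1 /\ forall eps, 0 < eps < 1 ->
    linear_map (fcarrier (H1 R)) (P eps) /\
    forall f, H1 R f -> L2norm (P eps f) <= C1 * ln (gamma (beta eps)) * H1norm f.

(* P = Q + 2 d^2/dy^2 *)
Definition stabilization_of (P Q : R -> (R -> R) -> (R -> R)) : Prop :=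
  forall eps, 0 < eps < 1 -> forall v, H2 v -> H10 R v ->
    P eps v = Q eps v + 2 *: wd (wd v) %[ae mu01 R].

End Operators.

Section VectorValued.
Variable R : realType.
Implicit Types (u : R -> (R -> R)).

(* C([0,1];V) and its norm *)
Definition C01 (V : fspace R) u : Prop :=
  (forall x, x \in `[0, 1] -> V (u x)) /\
  forall x, x \in `[0, 1] ->
    fnorm V (u t - u x) @[t --> within `[0, 1] (nbhs x)] --> (0 : R).

Definition C01norm (V : fspace R) u : R :=
  sup [set fnorm V (u x) | x in `[0, 1]].

(* [v] is the derivative at [x] of [u : [0,1] -> L^2(0,1)] (one-sided at the
   end points) *)
Definition is_dx_at u (x : R) (v : R -> R) : Prop := L2 R v /\
  L2norm ((t - x)^-1 *: (u t - u x) - v) @[t --> within `[0, 1] x^'] --> (0 : R).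

Definition dx u : R -> (R -> R) := fun x => xget (cst 0) [set v | is_dx_at u x v].

(* C^1([0,1];L^2(0,1)) *)
Definition C1_L2 u : Prop :=
  [/\ C01 (L2 R) u,
      forall x, x \in `[0, 1] -> exists v, is_dx_at u x v &
      C01 (L2 R) (dx u)].

(* H^{-1}(0,1), the dual of H^1_0(0,1) *)
Definition Hm1 : set ((R -> R) -> R) := [set F |
  (forall (a : R) f g, H10 R f -> H10 R g -> F (a *: f + g) = a * F f + F g) /\
  exists C : R, forall f, H10 R f -> `|F f| <= C * H1norm f].

Definition Hm1norm (F : (R -> R) -> R) : R :=
  sup [set `|F f| | f in [set f | H10 R f /\ H1norm f <= 1]].

Definition Hm1_simple (s : R -> (R -> R) -> R) : Prop :=
  exists (n : nat) (A : 'I_n -> set (measurableTypeR R))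
         (G : 'I_n -> (R -> R) -> R),
  [/\ forall k, measurable (A k), forall k, Hm1 (G k) &
      forall x f, s x f = \sum_(k < n) \1_(A k) x * G k f].

(* Bochner measurability *)
Definition Hm1_measurable (F : R -> (R -> R) -> R) : Prop :=
  exists s : nat -> R -> (R -> R) -> R,
  (forall n, Hm1_simple (s n)) /\
  \forall x \ae mu01 R, Hm1norm (s n x - F x) @[n --> \oo] --> (0 : R).

(* L^2(0,1;H^{-1}(0,1)) *)
Definition L2_Hm1 (F : R -> (R -> R) -> R) : Prop :=
  [/\ \forall x \ae mu01 R, Hm1 (F x),
      Hm1_measurable F &
      (\int[mu01 R]_x ((Hm1norm (F x)) ^+ 2)%:E < +oo)%E].

(* [F] is the distributional derivative in H^{-1}(0,1) of the L^2(0,1)-valued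
   [v], where L^2 is embedded in H^{-1} by the L^2 inner product; the identity
   of Bochner integrals in H^{-1} is written on each element of H^1_0 *)
Definition distr_dx_Hm1 (v : R -> (R -> R)) (F : R -> (R -> R) -> R) : Prop :=
  forall phi psi, test_fun phi -> H10 R psi ->
  \int[mu01 R]_x (L2ip (v x) psi * derive1 phi x) =
    - \int[mu01 R]_x (F x psi * phi x).

(* u_xx - u_yy + P u = 0, u(x,0) = u(x,1) = 0, u(0,y) = u0, u_x(0,y) = 0 *)
Definition weak_solution (P : (R -> R) -> (R -> R)) (u0 : R -> R) u : Prop :=
  [/\ C01 (H10 R) u, C1_L2 u,
      exists F, [/\ L2_Hm1 F, distr_dx_Hm1 (dx u) F &
        forall psi, H10 R psi -> \forall x \ae mu01 R,
          F x psi + L2ip (wd (u x)) (wd psi) + L2ip (P (u x)) psi = 0],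
      u 0 = u0 %[ae mu01 R] & dx u 0 = 0 %[ae mu01 R]].

End VectorValued.

Section TwoVariables.
Variable R : realType.
Implicit Types U G phi : R * R -> R.

Definition partial (b : bool) phi : R * R -> R := fun z =>
  if b then derive1 (fun s => phi (s, z.2)) z.1
  else derive1 (fun s => phi (z.1, s)) z.2.

Definition smooth2 phi : Prop := forall s : seq bool,
  let f := foldr partial phi s in
  [/\ forall x y, derivable (fun s => f (s, y)) x 1,
      forall x y, derivable (fun s => f (x, s)) y 1 & continuous f].

(* C_c^oo((0,1) x (0,1)) *)
Definition test_fun2 phi : Prop := smooth2 phi /\
  exists a b : R, [/\ 0 < a, b < 1 &
    forall x y, (x \notin `[a, b]) || (y \notin `[a, b]) -> phi (x, y) = 0].

Definition L2sq : set (R * R -> R) := [set U | U \in Lfun (mu01sq R) 2%:E].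

(* weak partial derivatives, in x for [true] and in y for [false] *)
Definition weak_partial (b : bool) U G : Prop := forall phi, test_fun2 phi ->
  \int[mu01sq R]_z (U z * partial b phi z) = - \int[mu01sq R]_z (G z * phi z).

Definition wpd (b : bool) U : R * R -> R :=
  xget (cst 0) [set G | L2sq G /\ weak_partial b U G].

Definition H1sq : set (R * R -> R) := [set U | L2sq U /\
  forall b, exists G, L2sq G /\ weak_partial b U G].

Definition H2sq : set (R * R -> R) := [set U | H1sq U /\
  forall b, H1sq (wpd b U)].

(* Strong solution of the Cauchy problem for the Laplace equation.  A function
   of H^2((0,1) x (0,1)) is a class, and it has a representative
   in C^1([0,1];L^2(0,1)), unique as such: [C1_L2] says that u is this
   representative, so that u(x,.) and u_x(x,.) make sense for every x. *)
Definition strong_solution (u0 : R -> R) (u : R -> (R -> R)) : Prop :=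
  let U := fun z : R * R => u z.1 z.2 in
  [/\ H2sq U /\ C1_L2 u,
      wpd true (wpd true U) + wpd false (wpd false U) = 0 %[ae mu01sq R],
      forall x, x \in `[0, 1] -> value_at (u x) 0 0 /\ value_at (u x) 1 0,
      u 0 = u0 %[ae mu01 R] & dx u 0 = 0 %[ae mu01 R]].

End TwoVariables.

(* Main.v *)
(** With w = u_beta - u, L = C_1 log(gamma(beta)) and f = P w + Q u, the error solves
w_xx - w_yy + f = 0, since P u = Q u + 2 u_yy turns the elliptic equation for u into
u_xx - u_yy + P u = Q u.  For E = |w_x|^2 + |w|_{H^1}^2 the energy identity reads
E' = 2 <w, w_x> - 2 <f, w_x>, and the bounds on P and Q together with L > 3/2 give
E' <= (7/3) L E + (3/(2L)) (C_0 |u|_W / gamma)^2; Gronwall's inequality concludes.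

The solutions have too little regularity to differentiate the energy directly.  All
derivatives are taken on scalar functions <w_x(s), w(t)> of two variables, for which weak
and classical derivatives in each variable are available, and the energy identity follows
on the diagonal.  For the strong solution, the weak derivatives on the square are turned
into statements at every x by representing u_y as an L^2-valued continuous function of x,
built from integrals of u_y and u_yx over horizontal slices. *)

Require Import Defs.
From mathcomp Require Import all_boot all_order all_algebra.
From mathcomp Require Import all_classical all_reals all_analysis.
From mathcomp Require Import measurable_realfun.
From mathcomp Require Import ring lra.
Import Order.TTheory GRing.Theory Num.Theory.
Import numFieldNormedType.Exports.
Local Open Scope classical_set_scope.
Local Open Scope ring_scope.
Set Implicit Arguments.
Unset Strict Implicit.
Unset Printing Implicit Defensive.

(** * Almost everywhere equality and integrals *)

(** The natural multiplier in the energy identity is w_x, but w_x(x) is only known to lie in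
    L^2(0,1), not in H^1_0(0,1), so it is not an admissible test function in the weak equation. The
    values w(t) are admissible for every t; this is why the variable x is doubled and why only
    pairings are ever differentiated. An equation in x that holds in the distributional sense, or
    for almost every x, becomes a statement at every x once both sides are continuous: a continuous
    function with a continuous weak derivative is classically differentiable, and continuous
    functions equal almost everywhere agree up to the end points. Elements of L^2 are
    representatives and weak derivatives are selected by choice, so nothing is known a priori about
    measurability in x of such selections. Hence the dependence on x is studied through inner
    products, and replacing an integrand almost everywhere is proved for arbitrary functions. *)

Section AeIntegral.
Context d (T : measurableType d) (R : realType).
Variable mu : {measure set T -> \bar R}.
Import HBNNSimple.

Lemma ae_mono (P Q : T -> Prop) : (forall x, P x -> Q x) ->
  (\forall x \ae mu, P x) -> \forall x \ae mu, Q x.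
Proof.
move=> PQ [N [mN N0 sN]]; exists N; split => // x /= nQ; apply: sN => /= Px.
exact/nQ/PQ.
Qed.

Lemma ae_mono2 (P Q S : T -> Prop) : (forall x, P x -> Q x -> S x) ->
  (\forall x \ae mu, P x) -> (\forall x \ae mu, Q x) -> \forall x \ae mu, S x.
Proof.
move=> PQS [N [mN N0 sN]] [M [mM M0 sM]]; exists (N `|` M); split.
- exact: measurableU.
- by rewrite null_set_setU.
- move=> x /= nS; apply: contrapT => /not_orP[nN nM]; apply: nS; apply: PQS.
    by apply: contrapT => nP; apply: nN; exact: sN.
  by apply: contrapT => nQ; apply: nM; exact: sM.
Qed.

(* No measurability is assumed, unlike in [ge0_ae_eq_integral]: a simple
   function below f is cut off on the exceptional set. *)
Lemma ge0_ae_le_integral_nm (f g : T -> \bar R) :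
  (forall x, 0 <= f x)%E -> (forall x, 0 <= g x)%E -> f = g %[ae mu] ->
  (\int[mu]_x f x <= \int[mu]_x g x)%E.
Proof.
move=> f0 g0 [N [mN N0 fgN]].
rewrite !ge0_integralTE//.
apply: ge_ereal_sup => _ /= [h hf <-].
rewrite -integralT_nnsfun -ge0_integralTE//.
have mh : measurable_fun setT (EFin \o (h : T -> R)) by exact/measurable_EFinP.
rewrite (@ge0_negligible_integral _ _ _ mu setT N) //; last first.
  by move=> x _; rewrite lee_fin.
rewrite setTD.
have -> : (\int[mu]_(x in ~` N) (h x)%:E = \int[mu]_x (((h : T -> R) \_ (~` N)) x)%:E)%E.
  by rewrite integral_mkcond; apply: eq_integral => x _; rewrite restrict_EFin.
rewrite ge0_integralTE; last first.
  by move=> x; rewrite patchE; case: ifPn => // _; rewrite lee_fin.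
rewrite ge0_integralTE//.
apply: le_ereal_sup => _ /= [k kh <-]; exists k => // x.
apply: (le_trans (kh x)); rewrite patchE; case: ifPn => [|_]; last exact: g0.
rewrite inE => Nx; suff <- : f x = g x by exact: hf.
apply: contrapT => fgx; apply: Nx; apply: fgN => /= h'; exact/fgx/h'.
Qed.

Lemma ae_eq_integral_nm (f g : T -> \bar R) : f = g %[ae mu] ->
  (\int[mu]_x f x = \int[mu]_x g x)%E.
Proof.
move=> fg; rewrite integralE [RHS]integralE.
have h (p q : T -> \bar R) : (forall x, 0 <= p x)%E -> (forall x, 0 <= q x)%E ->
    p = q %[ae mu] -> (\int[mu]_x p x = \int[mu]_x q x)%E.
  move=> p0 q0 pq; apply/eqP; rewrite eq_le !ge0_ae_le_integral_nm//.
  exact: ae_eq_sym.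
have /ae_eq_funeposneg[fgp fgn] := fg.
by congr (_ - _)%E; apply: h.
Qed.

Lemma ae_eq_Rintegral (f g : T -> R) : f = g %[ae mu] ->
  \int[mu]_x f x = \int[mu]_x g x.
Proof.
move=> fg; rewrite /Rintegral; congr fine; apply: ae_eq_integral_nm.
by apply: filterS fg => x /= h _; rewrite h.
Qed.

End AeIntegral.

(** * The space L^2 of a measure *)

Section SquareIntegrable.
Context d (T : measurableType d) (R : realType).
Variable mu : {measure set T -> \bar R}.
Implicit Types f g h : T -> R.

Local Notation Lt f := (f \in Lfun mu 2%:E).
Definition l2dot f g := \int[mu]_y (f y * g y).
Definition l2nrm f := fine ('N[mu]_(2%:E)[EFin \o f])%E.
Local Notation ip := l2dot.
Local Notation nrm := l2nrm.

Lemma Lt_measurable f : Lt f -> measurable_fun setT f.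
Proof. by rewrite inE => /andP[/[!inE]]. Qed.

Lemma Lt_mul_integrable f g : Lt f -> Lt g ->
  mu.-integrable setT (EFin \o (fun x => f x * g x)).
Proof. by move=> f2 g2; apply/Lfun1_integrable; exact: Lfun2_mul_Lfun1. Qed.

Lemma Lt_intro f : measurable_fun setT f ->
  mu.-integrable setT (EFin \o (fun x => f x ^+ 2)) -> Lt f.
Proof.
move=> mf /integrableP[_ h]; rewrite inE; apply/andP; split; rewrite inE//=.
rewrite /finite_norm unlock /Lnorm poweR_lty//; apply: le_lt_trans h.
rewrite le_eqVlt; apply/orP; left; apply/eqP; apply: eq_integral => x _ /=.
by rewrite powR_mulrn// normrX.
Qed.

Lemma Lt_le f g : measurable_fun setT f -> (forall x, `|f x| <= `|g x|) ->
  Lt g -> Lt f.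
Proof.
move=> mf fg g2; apply: Lt_intro => //.
apply: (@le_integrable _ _ _ mu _ measurableT _ (EFin \o (fun x => g x ^+ 2))).
- by apply/measurable_EFinP; exact: measurable_funX.
- by move=> x _ /=; rewrite lee_fin !normrX lerXn2r// ?nnegrE.
- exact: Lfun2_integrable_sqr.
Qed.

Lemma LtD f g : Lt f -> Lt g -> Lt (f + g).
Proof. by move=> f2 g2; apply: rpredD (f2) (g2); rewrite lee1n. Qed.

Lemma LtZ a f : Lt f -> Lt (a *: f).
Proof. by move=> f2; apply: rpredZ f2; rewrite lee1n. Qed.

Lemma LtN f : Lt f -> Lt (- f).
Proof. by move=> f2; rewrite -scaleN1r; exact: LtZ. Qed.

Lemma LtB f g : Lt f -> Lt g -> Lt (f - g).
Proof. by move=> f2 g2; apply: LtD => //; apply: LtN. Qed.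

Lemma Lt0 : Lt (0 : T -> R).
Proof.
apply: Lt_intro; first exact: measurable_cst.
apply: eq_integrable (integrable0 mu setT) => // x _ /=.
by rewrite expr0n.
Qed.

Lemma ipC f g : ip f g = ip g f.
Proof. by apply: eq_Rintegral => x _; rewrite mulrC. Qed.

Lemma ipDl f g h : Lt f -> Lt g -> Lt h -> ip (f + g) h = ip f h + ip g h.
Proof.
move=> f2 g2 h2; rewrite /l2dot -RintegralD//; try exact: Lt_mul_integrable.
by apply: eq_Rintegral => x _; rewrite -mulrDl.
Qed.

Lemma ipZl a f h : Lt f -> Lt h -> ip (a *: f) h = a * ip f h.
Proof.
move=> f2 h2; rewrite /l2dot -RintegralZl//; last exact: Lt_mul_integrable.
by apply: eq_Rintegral => x _; rewrite mulrA.
Qed.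

Lemma ipNl f h : Lt f -> Lt h -> ip (- f) h = - ip f h.
Proof. by move=> f2 h2; rewrite -scaleN1r ipZl// mulN1r. Qed.

Lemma ipBl f g h : Lt f -> Lt g -> Lt h -> ip (f - g) h = ip f h - ip g h.
Proof. by move=> f2 g2 h2; rewrite ipDl ?ipNl//; exact: LtN. Qed.

Lemma ipDr f g h : Lt f -> Lt g -> Lt h -> ip h (f + g) = ip h f + ip h g.
Proof. by move=> *; rewrite ipC ipDl// !(ipC h). Qed.

Lemma ipZr a f h : Lt f -> Lt h -> ip h (a *: f) = a * ip h f.
Proof. by move=> *; rewrite ipC ipZl// !(ipC h). Qed.

Lemma ipBr f g h : Lt f -> Lt g -> Lt h -> ip h (f - g) = ip h f - ip h g.
Proof. by move=> *; rewrite ipC ipBl// !(ipC h). Qed.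

Lemma ip_ge0 f : 0 <= ip f f.
Proof. by apply: Rintegral_ge0 => x _; rewrite -expr2 sqr_ge0. Qed.

Lemma ip0l f : ip 0 f = 0.
Proof.
rewrite /l2dot (@eq_Rintegral _ _ _ mu setT (cst 0)) ?Rintegral_cst// ?mul0r//.
by move=> x _; rewrite mul0r.
Qed.

Lemma ae_eq_ipl f g h : f = g %[ae mu] -> ip f h = ip g h.
Proof.
move=> fg; apply: ae_eq_Rintegral.
by apply: filterS fg => x /= fg _; rewrite fg.
Qed.

Lemma ae_eq_ipr f g h : f = g %[ae mu] -> ip h f = ip h g.
Proof. by move=> fg; rewrite !(ipC h); exact: ae_eq_ipl. Qed.

Lemma nrm_ge0 f : 0 <= nrm f.
Proof. by rewrite fine_ge0// Lnorm_ge0. Qed.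

Lemma nrm_sqr f : Lt f -> nrm f ^+ 2 = ip f f.
Proof.
move=> f2; have : ('N[mu]_(2%:E)[EFin \o f] < +oo)%E.
  by move: (f2); rewrite inE => /andP[_]; rewrite inE.
rewrite -ge0_fin_numE ?Lnorm_ge0// => Nfin.
have two0 : (2 : R) != 0 by rewrite pnatr_eq0.
have := powR_Lnorm mu (EFin \o f) two0.
rewrite -(fineK Nfin) -/(nrm f) poweR_EFin powR_mulrn ?nrm_ge0// => h.
rewrite /l2dot /Rintegral -[LHS]/(fine (nrm f ^+ 2)%:E) h; congr fine.
apply: eq_integral => x _ /=.
by rewrite powR_mulrn// -expr2 real_normK// num_real.
Qed.

Lemma nrmE f : Lt f -> nrm f = Num.sqrt (ip f f).
Proof. by move=> f2; rewrite -nrm_sqr// sqrtr_sqr ger0_norm// nrm_ge0. Qed.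

(** The quadratic |t f + g|^2 in t is nonnegative. A representative of norm 0 need not be the zero
    function, so the case of a vanishing leading coefficient is argued separately. *)
Lemma cauchy_schwarz f g : Lt f -> Lt g -> `|ip f g| <= nrm f * nrm g.
Proof.
move=> f2 g2.
have q t : 0 <= nrm f ^+ 2 * t ^+ 2 + 2 * t * ip f g + nrm g ^+ 2.
  have := ip_ge0 (t *: f + g).
  have tf2 := LtZ t f2; have tfg := LtD tf2 g2.
  rewrite ipDl// !ipDr// !ipZl// !ipZr// (ipC g f) -!nrm_sqr//.
  by congr (0 <= _); ring.
have nf := nrm_ge0 f; have ng := nrm_ge0 g.
rewrite -(@ler_pXn2r _ 2)// ?nnegrE ?mulr_ge0//.
rewrite real_normK ?num_real// exprMn.
have [f0|f0] := eqVneq (nrm f) 0.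
  rewrite f0 expr0n/= mul0r.
  have [->|i0] := eqVneq (ip f g) 0; first by rewrite expr0n.
  (* With zero leading coefficient the quadratic is affine; at this t it would equal -1. *)
  have := q (- (nrm g ^+ 2 + 1) / (2 * ip f g)).
  rewrite f0 expr0n/= mul0r add0r.
  have -> : 2 * (- (nrm g ^+ 2 + 1) / (2 * ip f g)) * ip f g = - (nrm g ^+ 2 + 1) by field.
  lra.
(* The minimiser of the quadratic. *)
have := q (- ip f g / nrm f ^+ 2).
have -> : nrm f ^+ 2 * (- ip f g / nrm f ^+ 2) ^+ 2 + 2 * (- ip f g / nrm f ^+ 2) * ip f g + nrm g ^+ 2
  = (nrm f ^+ 2 * nrm g ^+ 2 - ip f g ^+ 2) / nrm f ^+ 2 by field.
by rewrite pmulr_lge0 ?subr_ge0// invr_gt0 exprn_even_gt0.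
Qed.

Lemma le_ip f g : Lt f -> Lt g -> ip f g <= nrm f * nrm g.
Proof. by move=> f2 g2; apply: le_trans (cauchy_schwarz f2 g2); exact: ler_norm. Qed.

Lemma nrmD_sqr f g : Lt f -> Lt g ->
  nrm (f + g) ^+ 2 = nrm f ^+ 2 + 2 * ip f g + nrm g ^+ 2.
Proof.
move=> f2 g2; have fg := LtD f2 g2.
by rewrite !nrm_sqr// ipDl// !ipDr// (ipC g f); ring.
Qed.

Lemma nrmD f g : Lt f -> Lt g -> nrm (f + g) <= nrm f + nrm g.
Proof.
move=> f2 g2; rewrite -(@ler_pXn2r _ 2)// ?nnegrE ?addr_ge0 ?nrm_ge0//.
by rewrite nrmD_sqr//; have := le_ip f2 g2; lra.
Qed.

Lemma nrmZ a f : Lt f -> nrm (a *: f) = `|a| * nrm f.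
Proof.
move=> f2; rewrite !nrmE//; last exact: LtZ.
rewrite ipZl ?ipZr//; last exact: LtZ.
by rewrite mulrA -expr2 sqrtrM ?sqr_ge0// sqrtr_sqr.
Qed.

Lemma nrmN f : Lt f -> nrm (- f) = nrm f.
Proof. by move=> f2; rewrite -scaleN1r nrmZ// normrN1 mul1r. Qed.

Lemma nrmBC f g : Lt f -> Lt g -> nrm (f - g) = nrm (g - f).
Proof. by move=> f2 g2; rewrite -opprB nrmN//; exact: LtB. Qed.

Lemma nrm_dist f g : Lt f -> Lt g -> `|nrm f - nrm g| <= nrm (f - g).
Proof.
move=> f2 g2; have fg := LtB f2 g2; have gf := LtB g2 f2.
have := nrmD fg g2; have := nrmD gf f2; rewrite !subrK (nrmBC g2 f2) => h1 h2.
by rewrite ler_norml; apply/andP; split; lra.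
Qed.

Lemma nrm0 : nrm (0 : T -> R) = 0.
Proof. by rewrite nrmE ?ip0l ?sqrtr0//; exact: Lt0. Qed.

Lemma nrm_eq0 f : Lt f -> nrm f = 0 -> f = 0 %[ae mu].
Proof.
move=> f2 f0; have : ('N[mu]_(2%:E)[EFin \o f] < +oo)%E.
  by move: (f2); rewrite inE => /andP[_]; rewrite inE.
rewrite -ge0_fin_numE ?Lnorm_ge0// => Nfin.
have : ('N[mu]_(2%:E)[EFin \o f] = 0)%E by rewrite -(fineK Nfin) -/(nrm f) f0.
move=> /Lnorm_eq0_eq0 h; have := h _ (lte0n 2 : (0 < 2%:E)%E).
move=> /(_ _)[|N [mN N0 hN]]; first exact/measurable_EFinP/Lt_measurable.
exists N; split => // x /= hx; apply: hN => /= h'; apply: hx => _.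
by have [] := h' I.
Qed.

Lemma ae_eq_nrm f g : f = g %[ae mu] -> nrm f = nrm g.
Proof.
move=> fg; rewrite /l2nrm unlock /Lnorm; congr (fine (_ `^ _)%E).
apply: ae_eq_integral_nm.
by apply: filterS fg => x /= fg _; rewrite fg.
Qed.

End SquareIntegrable.

(** * Real derivatives *)

Section RealDerivative.
Variable R : realType.
Implicit Types f g : R -> R.

(** The entry point for derivatives that come from explicit estimates, as in [dir_derive] and
    [energy_identity]. *)
Lemma is_derive_eps f (x l : R) :
  (forall e, 0 < e -> exists2 r, 0 < r & forall h, h != 0 -> `|h| < r ->
     `|h^-1 * (f (x + h) - f x) - l| <= e) -> is_derive x 1 f l.
Proof.
move=> H.
have cv : (fun h => h^-1 *: ((f \o shift x) (h *: 1) - f x)) @ 0^' --> l.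
  apply/cvgrPdist_le => e e0; have [r r0 hr] := H e e0.
  near=> h; rewrite distrC /= -[h *: 1]/(h * 1) mulr1 addrC.
  rewrite [X in `|_ + X|](_ : _ = h^-1 * (f (x + h) - f x)); last by rewrite [h + x]addrC.
  rewrite addrC; apply: hr; first by near: h; exact: nbhs_dnbhs_neq.
  near: h; apply: nbhs_dnbhs; exists r => //= z /=.
  by rewrite /ball_ /= sub0r normrN.
apply: DeriveDef; first by apply/cvg_ex; exists l.
exact: cvg_lim cv.
Unshelve. all: by end_near. Qed.

Lemma is_derive_epsP f (x l : R) : is_derive x 1 f l ->
  forall e, 0 < e -> exists2 r, 0 < r & forall h, h != 0 -> `|h| < r ->
     `|h^-1 * (f (x + h) - f x) - l| <= e.
Proof.
move=> [df dl] e e0.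
have cv : (fun h => h^-1 *: ((f \o shift x) (h *: 1) - f x)) @ 0^' --> l.
  by rewrite -dl; exact: df.
move/cvgrPdist_le : cv => /(_ e e0)[r /= r0 hr]; exists r => // h h0 hltr.
have := hr h; rewrite /ball_ /= sub0r normrN => /(_ hltr h0).
by rewrite distrC -[h *: 1]/(h * 1) mulr1 [h + x]addrC.
Qed.

Lemma is_derive_congr f (x l l' : R) : l = l' -> is_derive x 1 f l -> is_derive x 1 f l'.
Proof. by move=> ->. Qed.

Lemma derive1_is_derive f (x l : R) : is_derive x 1 f l -> derive1 f x = l.
Proof. by move=> [_ <-]; rewrite derive1E. Qed.

Lemma is_derive_derive1 f (x : R) : derivable f x 1 -> is_derive x 1 f (derive1 f x).
Proof. by move=> df; apply: DeriveDef => //; rewrite derive1E. Qed.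

Lemma is_derive_mul f g (x a b : R) : is_derive x 1 f a -> is_derive x 1 g b ->
  is_derive x 1 (fun t => f t * g t) (a * g x + f x * b).
Proof.
move=> fa gb; apply: (is_derive_congr _ (is_deriveM fa gb)).
by rewrite /GRing.scale /= addrC [g x * a]mulrC.
Qed.

Lemma is_derive_add f g (x a b : R) : is_derive x 1 f a -> is_derive x 1 g b ->
  is_derive x 1 (fun t => f t + g t) (a + b).
Proof. by move=> fa gb; exact: is_deriveD. Qed.

Lemma is_derive_scale f (x a c : R) : is_derive x 1 f a ->
  is_derive x 1 (fun t => c * f t) (c * a).
Proof. by move=> fa; exact: is_deriveZ. Qed.

Lemma is_derive_chain f g (x a b : R) : is_derive (g x) 1 f a -> is_derive x 1 g b ->
  is_derive x 1 (fun t => f (g t)) (a * b).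
Proof.
move=> fa gb; apply: is_derive_congr (@is_derive1_comp _ f g x a b fa gb).
by [].
Qed.

Lemma is_derive_pow f (x a : R) n : is_derive x 1 f a ->
  is_derive x 1 (fun t => f t ^+ n) (n%:R * f x ^+ n.-1 * a).
Proof.
move=> fa; elim: n => [|n ih]; first by rewrite !mul0r; exact: is_derive_cst.
have := is_derive_mul fa ih.
rewrite (_ : (fun t => f t * f t ^+ n) = (fun t => f t ^+ n.+1)); last first.
  by apply/funext => t; rewrite exprS.
apply: is_derive_congr; case: n {ih} => [|n]; first by rewrite expr0; ring.
by rewrite /= exprS -[in RHS]natr1; ring.
Qed.

Lemma is_derive_affine (a b x : R) : is_derive x 1 (fun t : R => a * t + b) a.
Proof.
have h : is_derive x 1 (fun t : R => a * t) (a * 1) by exact: is_derive_scale.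
by apply: is_derive_congr (is_derive_add h (is_derive_cst b x 1)); rewrite mulr1 addr0.
Qed.

End RealDerivative.

(** * Smooth bump functions *)

Section Smooth.
Variable R : realType.
Implicit Types f g : R -> R.

(** Peeling off the innermost derivative, unlike [derive1n], lets product and chain rules be proved
    by induction with f arbitrary. The index is shifted: [Ck n] asks for n + 1 derivatives. *)
Fixpoint Ck n f : Prop :=
  (forall x, derivable f x 1) /\ (if n is k.+1 then Ck k (derive1 f) else True).

Definition smooth f := forall n, Ck n f.

Lemma derive1nSr n f : derive1n n.+1 f = derive1n n (derive1 f).
Proof. by rewrite /derive1n iterSr. Qed.

Lemma smoothP f : smooth f <-> forall n x, derivable (derive1n n f) x 1.
Proof.
split=> [sf n|sf n].
  have {sf} := sf n; elim: n f => [|n ih] f; first by case.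
  by move=> [_ /ih]; rewrite derive1nSr.
elim: n f sf => [|n ih] f sf; first by split => // x; exact: (sf 0%N).
split; first by move=> x; exact: (sf 0%N).
by apply: ih => k x; rewrite -derive1nSr; exact: sf.
Qed.

Lemma smooth_derivable f x : smooth f -> derivable f x 1.
Proof. by move=> /(_ 0%N)[]. Qed.

Lemma smooth_derive1 f : smooth f -> smooth (derive1 f).
Proof. by move=> sf n; have [_] := sf n.+1. Qed.

Lemma smooth_continuous f : smooth f -> continuous f.
Proof.
move=> sf x; apply: differentiable_continuous; apply/derivable1_diffP.
exact: smooth_derivable.
Qed.

Lemma Ck_deriv n f (f' : R -> R) : (forall x : R, is_derive x 1 f (f' x)) ->
  Ck n f' -> Ck n.+1 f.
Proof.
move=> ff' cf'; split; first by move=> x; have [] := ff' x.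
by rewrite (_ : derive1 f = f')//; apply/funext => x; exact: derive1_is_derive.
Qed.

Lemma smooth_deriv f (f' : R -> R) : (forall x : R, is_derive x 1 f (f' x)) ->
  smooth f' -> smooth f.
Proof.
move=> ff' sf' [|n]; first by split => // x; have [] := ff' x.
exact: Ck_deriv ff' (sf' n).
Qed.

Lemma CkS n f : Ck n.+1 f -> Ck n f.
Proof.
elim: n f => [|n ih] f; first by case.
by move=> [df cf]; split => //; exact: ih.
Qed.

Lemma Ck_derivable n f x : Ck n f -> derivable f x 1.
Proof. by case: n => [|n] []. Qed.

Lemma CkD n f g : Ck n f -> Ck n g -> Ck n (fun x => f x + g x).
Proof.
elim: n f g => [|n ih] f g.
  by move=> [df _] [dg _]; split => // x; apply: derivableD.
move=> cf cg; apply: (@Ck_deriv _ _ (fun x => derive1 f x + derive1 g x)).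
  by move=> x; apply: is_derive_add; apply: is_derive_derive1;
    [exact: Ck_derivable cf|exact: Ck_derivable cg].
by case: cf => _ cf; case: cg => _ cg; exact: ih.
Qed.

Lemma CkM n f g : Ck n f -> Ck n g -> Ck n (fun x => f x * g x).
Proof.
elim: n f g => [|n ih] f g.
  by move=> [df _] [dg _]; split => // x; apply: derivableM.
move=> cf cg; apply: (@Ck_deriv _ _ (fun x => derive1 f x * g x + f x * derive1 g x)).
  by move=> x; apply: is_derive_mul; apply: is_derive_derive1;
    [exact: Ck_derivable cf|exact: Ck_derivable cg].
by apply: CkD; apply: ih; do ?[exact: CkS]; [case: cf|case: cg].
Qed.

Lemma Ck_cst n (c : R) : Ck n (fun=> c).
Proof.
elim: n c => [|n ih] c; first by split => // x; exact: derivable_cst.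
by apply: (@Ck_deriv _ _ (fun=> 0)); exact: ih.
Qed.

Lemma CkZ n c f : Ck n f -> Ck n (fun x => c * f x).
Proof. by move=> cf; apply: CkM cf; exact: Ck_cst. Qed.

Lemma Ck_affine n (a b : R) f : Ck n f -> Ck n (fun x => f (a * x + b)).
Proof.
elim: n f => [|n ih] f cf.
  split => // x; case: cf => df _.
  have h := @is_derive_chain R f (fun x => a * x + b) x _ _
    (is_derive_derive1 (df (a * x + b))) (is_derive_affine a b x).
  by case: h.
apply: (@Ck_deriv _ _ (fun x => a * derive1 f (a * x + b))).
  move=> x; rewrite mulrC.
  apply: (@is_derive_chain R f (fun x => a * x + b)) (is_derive_affine a b x).
  by apply: is_derive_derive1; exact: Ck_derivable cf.
by apply: CkZ; apply: ih; case: cf.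
Qed.

(* t^-k exp(-1/t), extended by 0; this family is closed under derivation up
   to linear combinations *)
Definition flat k (t : R) : R := if 0 < t then t^-1 ^+ k * expR (- t^-1) else 0.

(** A single term of the exponential series at 1/t, the one of degree k + n + 1, bounds exp(1/t)
    from below. *)
Lemma flat_bound k n (t : R) : 0 < t ->
  t^-1 ^+ k * expR (- t^-1) <= (k + n).+1`!%:R * t ^+ n.+1.
Proof.
move=> t0; have ti : 0 < t^-1 by rewrite invr_gt0.
rewrite expRN ler_pdivrMr ?expR_gt0//.
have := expR_ge1Dxn (k + n) (ltW ti).
set F := _`!%:R => h.
have F0 : 0 < F by rewrite ltr0n fact_gt0.
have h' : t^-1 ^+ (k + n).+1 / F <= expR t^-1 by apply: le_trans h; rewrite lerDr.
have -> : t^-1 ^+ k = F * t ^+ n.+1 * (t^-1 ^+ (k + n).+1 / F).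
  rewrite -addnS exprD !exprVn; field.
  by rewrite !expf_neq0 ?gt_eqF.
by rewrite ler_wpM2l// mulr_ge0 ?exprn_ge0 ?ltW.
Qed.

Lemma is_derive_flat k (t : R) : is_derive t 1 (flat k) (flat k.+2 t - k%:R * flat k.+1 t).
Proof.
have [t0|t0|->] := ltgtP t 0.
- rewrite /flat ltNge ltW//= mulr0 subr0.
  have h := is_derive_cst (0 : R) t 1; apply: near_eq_is_derive h.
  by apply: filterS (lt_nbhsl t0) => s s0; rewrite ltNge ltW.
- have tn0 : t != 0 by rewrite gt_eqF.
  have nf : \near t, t^-1 ^+ k * expR (- t^-1) = flat k t.
    by apply: filterS (lt_nbhsr t0) => s s0; rewrite /flat s0.
  apply: near_eq_is_derive nf _.
  have di : is_derive t 1 (fun s : R => s^-1) (- t^-1 ^+ 2).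
    have h := @is_deriveV R id t 1 1 tn0 (is_derive_id t 1).
    apply: (is_derive_congr _ h).
    by rewrite /GRing.scale/= mulr1 exprVn.
  have de : is_derive t 1 (fun s : R => expR (- s^-1)) (expR (- t^-1) * t^-1 ^+ 2).
    apply: is_derive_chain.
    apply: (is_derive_congr (_ : -1 * - t^-1 ^+ 2 = _)); first by ring.
  have dp : is_derive t 1 (fun s : R => s^-1 ^+ k) (- k%:R * t^-1 ^+ k.+1).
    apply: (is_derive_congr _ (is_derive_pow k di)).
    by case: k {de} => [|k]; rewrite ?mul0r ?oppr0 ?mul0r//= !exprS; ring.
  apply: is_derive_congr (is_derive_mul dp de).
  by rewrite /flat t0 !exprS; ring.
(* At 0 the right difference quotient of [flat k] is [flat k.+1], which is O(h). *)
- rewrite /flat ltxx mulr0 subr0.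
  apply: is_derive_eps => e e0; set F : R := (k.+1 + 1).+1`!%:R.
  have F0 : 0 < F by rewrite ltr0n fact_gt0.
  exists (e / F) => [|h h0 he]; first by rewrite divr_gt0.
  rewrite add0r ltxx !subr0; case: ifPn => [hp|_]; last by rewrite mulr0 normr0 ltW.
  rewrite mulrA -exprS ger0_norm ?mulr_ge0 ?expR_ge0 ?exprn_ge0 ?invr_ge0 ?(ltW hp)//.
  apply: (le_trans (flat_bound k.+1 0 hp)); rewrite expr1 addn0.
  move: he; rewrite ltr_pdivlMr// (gtr0_norm hp) => he.
  apply: le_trans (ltW he); rewrite mulrC ler_pM2l//.
  by rewrite ler_nat leq_fact// addn1.
Qed.

Lemma smooth_flat k : smooth (flat k).
Proof.
move=> n; elim: n k => [|n ih] k; first by split => // x; have [] := is_derive_flat k x.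
apply: (Ck_deriv (is_derive_flat k)).
have -> : (fun x => flat k.+2 x - k%:R * flat k.+1 x) =
   (fun x => flat k.+2 x + (- k%:R) * flat k.+1 x) by apply/funext => x; rewrite mulNr.
by apply: CkD => //; apply: CkZ.
Qed.

(* tends to the indicator function of ]0, q[ as k grows *)
Definition bumpf (k : nat) (q t : R) : R :=
  flat 0 (k.+1%:R * t - k.+1%:R / k.+2%:R) * flat 0 (k.+1%:R * (q - t)).

Lemma smooth_bump k q : smooth (bumpf k q).
Proof.
move=> n; apply: CkM.
  exact: (@Ck_affine n k.+1%:R (- (k.+1%:R / k.+2%:R)) (flat 0) (smooth_flat 0 n)).
have := @Ck_affine n (- k.+1%:R) (k.+1%:R * q) (flat 0) (smooth_flat 0 n).
congr Ck; apply/funext => x; congr flat; ring.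
Qed.

Lemma flat0_ge0 t : 0 <= flat 0 t.
Proof. by rewrite /flat; case: ifPn => // _; rewrite mulr_ge0 ?expR_ge0. Qed.

Lemma flat0_le1 t : flat 0 t <= 1.
Proof.
rewrite /flat; case: ifPn => // t0.
by rewrite expr0 mul1r -expR0 ler_expR oppr_le0 invr_ge0 ltW.
Qed.

Lemma bump_ge0 k q t : 0 <= bumpf k q t.
Proof. by rewrite mulr_ge0// flat0_ge0. Qed.

Lemma bump_le1 k q t : bumpf k q t <= 1.
Proof. by rewrite mulr_ile1// ?flat0_ge0 ?flat0_le1. Qed.

(** The shift (k+1)/(k+2) puts the left end of the support at 1/(k+2), strictly inside (0,1); being
    below 1, it is negligible against (k+1) t as k grows. *)
Lemma bump_supp k q t : t \notin `[k.+2%:R^-1, q] -> bumpf k q t = 0.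
Proof.
rewrite in_itv/= negb_and -!ltNge => /orP[h|h]; rewrite /bumpf /flat.
  by rewrite subr_gt0 ltr_pM2l ?ltr0n// ltNge ltW//= mul0r.
by rewrite [X in _ * (if X then _ else _)]ltNge pmulr_rle0 ?ltr0n// subr_le0 ltW// mulr0.
Qed.

Lemma test_fun_bump k q : q < 1 -> test_fun (bumpf k q).
Proof.
move=> q1; split; first exact/smoothP/smooth_bump.
by exists k.+2%:R^-1, q; split => // x; exact: bump_supp.
Qed.

Lemma flat0_cvg (u : nat -> R) : u n @[n --> \oo] --> +oo -> flat 0 (u n) @[n --> \oo] --> (1 : R).
Proof.
move=> uoo; have ui : (u n)^-1 @[n --> \oo] --> 0.
  by apply/gtr0_cvgV0 => //; exact: (cvgry_gt uoo 0).
have : expR (- (u n)^-1) @[n --> \oo] --> expR (- 0).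
  by apply: continuous_cvg; [exact: continuous_expR|exact: cvgN].
rewrite oppr0 expR0; apply: cvg_trans; apply: near_eq_cvg.
near=> n; rewrite /flat expr0 mul1r.
by suff -> : 0 < u n by []; near: n; exact: (cvgry_gt uoo 0).
Unshelve. all: by end_near. Qed.

End Smooth.

(** * Closed spans in L^2 *)

Section ClosedSpan.
Context d (T : measurableType d) (R : realType).
Variable mu : {measure set T -> \bar R}.
Implicit Types f g h : T -> R.
Local Notation Lt f := (f \in Lfun mu 2%:E).
Local Notation nrm := (l2nrm mu).

Lemma nrm_dct (f_ : nat -> T -> R) f g : (forall n, measurable_fun setT (f_ n)) ->
  measurable_fun setT f -> Lt g -> (forall n x, `|f_ n x| <= `|g x|) ->
  (forall x, f_ n x @[n --> \oo] --> f x) -> nrm (f_ n - f) @[n --> \oo] --> 0.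
Proof.
move=> mf_ mf g2 fg ff.
have fg' x : `|f x| <= `|g x|.
  have h : `|f_ n x| @[n --> \oo] --> `|f x| by apply: cvg_norm; exact: ff.
  by apply: (ler_cvg_to h (cvg_cst _)); near=> n; exact: fg.
have f_2 n : Lt (f_ n) by exact: Lt_le (mf_ n) (fg n) g2.
have f2 : Lt f by exact: Lt_le mf fg' g2.
have ipc : l2dot mu (f_ n - f) (f_ n - f) @[n --> \oo] --> 0.
  pose F n x : \bar R := ((f_ n x - f x) ^+ 2)%:E.
  (* From |f_n - f| <= 2 |g|, the square (2 g)^2 is an integrable majorant. *)
  have := @dominated_convergence _ _ _ mu setT measurableT F (cst 0%E)
    (fun x => ((2 *: g) x ^+ 2)%:E).
  case.
  - move=> n; apply/measurable_EFinP; apply: measurable_funX.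
    exact: measurable_funB.
  - exact: measurable_cst.
  - apply: aeW => x _ /=; apply: cvg_EFin; first by near=> n.
    rewrite -[0]/(0 : R).
    have -> : (fine \o (F ^~ x)) = (fun n => (f_ n x - f x) ^+ 2) by [].
    have h : (f_ n x - f x) @[n --> \oo] --> 0.
      by rewrite -(subrr (f x)); apply: cvgB; [exact: ff|exact: cvg_cst].
    rewrite (_ : (fun n => _) = (fun n => (f_ n x - f x) * (f_ n x - f x))); last first.
      by apply/funext => n; rewrite expr2.
    by rewrite -(mulr0 (0 : R)); exact: cvgM.
  - by apply: Lfun2_integrable_sqr; exact: LtZ.
  - apply: aeW => x n _ /=; rewrite lee_fin normrX /GRing.scale/= -[leRHS]real_normK ?num_real//.
    rewrite lerXn2r ?nnegrE// normrM (ger0_norm (ler0n _ 2)).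
    by apply: le_trans (ler_normB _ _) _; have := fg n x; have := fg' x; lra.
  move=> _ _; rewrite integral0 => /fine_cvg.
  by rewrite (_ : fine \o _ = (fun n => l2dot mu (f_ n - f) (f_ n - f))).
have -> : (fun n => nrm (f_ n - f)) = Num.sqrt \o (fun n => l2dot mu (f_ n - f) (f_ n - f)).
  by apply/funext => n /=; rewrite nrmE//; exact: LtB.
by rewrite -(@sqrtr0 R); apply: continuous_cvg ipc; exact: sqrt_continuous.
Unshelve. all: by end_near. Qed.

(** Linear combinations built one generator at a time: the induction principle is exactly closure
    under a *: f + g with f a generator. *)
Inductive lspan (G : set (T -> R)) : set (T -> R) :=
| lspan0 : lspan G 0
| lspanS a f g : G f -> lspan G g -> lspan G (a *: f + g).

Lemma lspan_add G f g : lspan G f -> lspan G g -> lspan G (f + g).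
Proof.
elim=> [|a f1 f2 Gf1 _ ih] sg; first by rewrite add0r.
by rewrite -addrA; apply: lspanS => //; exact: ih.
Qed.

Lemma lspan_scale G a f : lspan G f -> lspan G (a *: f).
Proof.
elim=> [|b f1 f2 Gf1 _ ih]; first by rewrite scaler0; exact: lspan0.
by rewrite scalerDr scalerA; exact: lspanS.
Qed.

Lemma lspan_sub (G H : set (T -> R)) f : H 0 ->
  (forall a f g, G f -> H g -> H (a *: f + g)) -> lspan G f -> H f.
Proof. by move=> H0 HS; elim => // a f1 f2 Gf1 _; exact: HS. Qed.

Variable G : set (T -> R).
Hypothesis GL : forall f, G f -> Lt f.

Lemma lspan_Lt f : lspan G f -> Lt f.
Proof.
apply: (@lspan_sub G (fun f => Lt f)); first exact: Lt0.
by move=> a f1 g1 /GL f2 g2; apply: LtD => //; exact: LtZ.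
Qed.

Definition cspan f := Lt f /\ forall e, 0 < e -> exists2 phi, lspan G phi & nrm (f - phi) <= e.

Lemma cspan_closed f : Lt f ->
  (forall e, 0 < e -> exists2 g, cspan g & nrm (f - g) <= e) -> cspan f.
Proof.
move=> f2 H; split => // e e0; have e20 : 0 < e / 2 by rewrite divr_gt0.
have [g [g2 Hg] fg] := H _ e20; have [phi sp gphi] := Hg _ e20.
exists phi => //; have p2 := lspan_Lt sp.
have -> : f - phi = (f - g) + (g - phi) by rewrite addrA subrK.
rewrite [e]splitr; apply: le_trans (lerD fg gphi).
by apply: nrmD; exact: LtB.
Qed.

Lemma cspan_lim (f_ : nat -> T -> R) f : Lt f -> (forall n, cspan (f_ n)) ->
  nrm (f_ n - f) @[n --> \oo] --> 0 -> cspan f.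
Proof.
move=> f2 cf ff; apply: cspan_closed => // e e0.
move/cvgrPdist_le : ff => /(_ e e0)[n _ hn]; exists (f_ n) => //.
have [fn2 _] := cf n.
by have := hn n (leqnn n); rewrite sub0r normrN ger0_norm ?nrm_ge0//= nrmBC.
Qed.

Lemma cspan_ae f g : Lt g -> f = g %[ae mu] -> cspan f -> cspan g.
Proof.
move=> g2 fg [f2 cf]; split => // e e0; have [phi sp h] := cf e e0.
exists phi => //; rewrite -(@ae_eq_nrm _ _ _ mu (f - phi))//.
by apply: filterS fg => x /= fg _; rewrite !fctE fg.
Qed.

Lemma cspan_span f : lspan G f -> cspan f.
Proof.
move=> sf; split; first exact: lspan_Lt.
by move=> e e0; exists f => //; rewrite subrr nrm0 ltW.
Qed.

Lemma cspan_gen f : G f -> cspan f.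
Proof.
move=> Gf; apply: cspan_span; rewrite -[f]scale1r -[_ *: f]addr0.
by apply: lspanS => //; exact: lspan0.
Qed.

Lemma cspan_add f g : cspan f -> cspan g -> cspan (f + g).
Proof.
move=> [f2 cf] [g2 cg]; split; first exact: LtD.
move=> e e0; have e20 : 0 < e / 2 by rewrite divr_gt0.
have [p sp fp] := cf _ e20; have [q sq gq] := cg _ e20.
exists (p + q); first exact: lspan_add.
have -> : f + g - (p + q) = (f - p) + (g - q) by rewrite opprD addrACA.
rewrite [e]splitr; apply: le_trans (lerD fp gq).
by apply: nrmD; apply: LtB => //; exact: lspan_Lt.
Qed.

Lemma cspan_scale a f : cspan f -> cspan (a *: f).
Proof.
move=> [f2 cf]; split; first exact: LtZ.
move=> e e0; have a1 : 0 < `|a| + 1 by rewrite ltr_wpDl.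
have [p sp fp] := cf (e / (`|a| + 1)) (divr_gt0 e0 a1).
exists (a *: p); first exact: lspan_scale.
rewrite -scalerBr nrmZ; last by apply: LtB => //; exact: lspan_Lt.
move: fp; rewrite ler_pdivlMr//; apply: le_trans.
by rewrite mulrC ler_wpM2l ?nrm_ge0// lerDl.
Qed.

Lemma cspan_sum (I : Type) (r : seq I) (F : I -> T -> R) :
  (forall i, cspan (F i)) -> cspan (\sum_(i <- r) F i).
Proof.
move=> F2; elim/big_rec : _ => [|i x _ x2]; last exact: cspan_add.
by apply: cspan_span; exact: lspan0.
Qed.

Lemma cspan_orth f h : Lt h -> (forall g, G g -> l2dot mu h g = 0) -> cspan f -> l2dot mu h f = 0.
Proof.
move=> h2 H [f2 cf].
have H' g : lspan G g -> l2dot mu h g = 0.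
  suff : lspan G g -> Lt g /\ l2dot mu h g = 0 by move=> + sg => /(_ sg)[].
  apply: (@lspan_sub G (fun g => Lt g /\ l2dot mu h g = 0)).
    by split; [exact: Lt0|rewrite ipC ip0l].
  move=> a f1 g1 Gf1 [g12 hg1]; have f12 := GL Gf1; have af12 := LtZ a f12.
  by split; [exact: LtD|rewrite ipDr// ipZr// H// mulr0 hg1 addr0].
apply/eqP; rewrite -normr_le0; apply/ler_addgt0Pl => e e0; rewrite addr0.
have h1 : 0 < nrm h + 1 by rewrite ltr_wpDl// nrm_ge0.
have [p sp fp] := cf (e / (nrm h + 1)) (divr_gt0 e0 h1).
have p2 := lspan_Lt sp.
have -> : l2dot mu h f = l2dot mu h (f - p) by rewrite ipBr// (H' p)// subr0.
apply: (le_trans (cauchy_schwarz h2 (LtB f2 p2))).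
move: fp; rewrite ler_pdivlMr//; apply: le_trans.
by rewrite mulrC ler_wpM2l ?nrm_ge0// lerDl.
Qed.

Import HBNNSimple.

(** Simple functions are finite sums of scaled indicators; a nonnegative function is the limit of
    simple functions below it, which it dominates itself; a signed function is split into its two
    parts. *)
Lemma cspan_total (mu_fin : (mu setT < +oo)%E) :
  (forall A, measurable A -> cspan (\1_A : T -> R)) -> forall f, Lt f -> cspan f.
Proof.
move=> Hind.
have Hs (h : {nnsfun T >-> R}) : cspan (h : T -> R).
  have -> : (h : T -> R) = \sum_(y <- finmap.enum_fset (fset_set (range h))) (y *: (\1_(h @^-1` [set y]) : T -> R)).
    apply/funext => x; rewrite fimfunE fsbig_finite//= fct_sumE.
    by apply: eq_bigr => i _.
  by apply: cspan_sum => y; apply: cspan_scale; apply: Hind.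
have Hp f : Lt f -> (forall x, 0 <= f x) -> cspan f.
  move=> f2 f0; have mf := Lt_measurable f2.
  have mfE : measurable_fun setT (EFin \o f) by exact/measurable_EFinP.
  pose a := nnsfun_approx measurableT mfE.
  have f0E x : setT x -> (0 <= (EFin \o f) x)%E by rewrite lee_fin.
  have ca x : a n x @[n --> \oo] --> f x.
    have := @cvg_nnsfun_approx _ _ _ _ measurableT _ mfE f0E x I.
    by move=> /fine_cvg.
  have ale n x : a n x <= f x.
    have nda : nondecreasing_seq (fun n => a n x).
      by move=> i j ij; have /lefP := nd_nnsfun_approx measurableT mfE ij; exact.
    have := @nondecreasing_cvgn_le _ _ nda (cvgP _ (ca x)) n.
    by rewrite (cvg_lim _ (ca x)).
  apply: (@cspan_lim (fun n => a n : T -> R)) => //.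
  apply: (@nrm_dct _ _ f) => //.
  by move=> n x; rewrite !ger0_norm.
move=> f f2.
have mf := Lt_measurable f2.
have -> : f = (fun x => Num.max (f x) 0) + (-1) *: (fun x => Num.max (- f x) 0).
  apply/funext => x; rewrite !fctE /GRing.scale/= mulN1r.
  by case: (ltrP (f x) 0); case: (ltrP (- f x) 0); lra.
apply: cspan_add; last apply: cspan_scale; apply: Hp.
- apply: (@Lt_le _ _ _ _ _ f) => //; first by apply: measurable_maxr => //; exact: measurable_cst.
  by move=> x; case: (ltrP (f x) 0) => //; rewrite normr0.
- by move=> x; rewrite le_max lexx orbT.
- apply: (@Lt_le _ _ _ _ _ f) => //.
    by apply: measurable_maxr; [exact: measurableT_comp|exact: measurable_cst].
  by move=> x; case: (ltrP (- f x) 0) => //; rewrite ?normr0 ?normrN.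
- by move=> x; rewrite le_max lexx orbT.
Qed.

End ClosedSpan.

(** * Density of test functions in L^2(0,1) *)

Section Mu01.
Variable R : realType.
Implicit Types (f g phi psi : R -> R) (P : R -> Prop).
Notation mu := (mu01 R).
Notation leb := (@lebesgue_measure R).

Lemma mu01_ae P : (forall x, 0 < x < 1 -> P x) -> \forall x \ae mu, P x.
Proof.
move=> HP; exists (~` `]0, 1[); split.
- by apply: measurableC; exact: measurable_itv.
- by rewrite [LHS](_ : _ = leb (~` `]0, 1[ `&` `]0, 1[))// setICl measure0.
- by move=> x /= nPx; apply: contra_not nPx => x01; apply: HP; move: x01; rewrite /= in_itv.
Qed.

Lemma mu01T : mu setT = 1%E.
Proof.
rewrite [LHS](_ : _ = leb (setT `&` `]0, 1[))// setTI.
by rewrite lebesgue_measure_itv/= lte_fin ltr01 oppr0 adde0.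
Qed.

Lemma mu01T_lty : (mu setT < +oo)%E.
Proof. by rewrite [X in (X < _)%E](_ : _ = 1%E) ?ltry//; exact: mu01T. Qed.

Lemma Rintegral_mu01 f : \int[mu]_x f x = \int[leb]_(x in `]0, 1[) f x.
Proof.
transitivity (\int[mu]_(x in `]0, 1[) f x); last first.
  congr fine; apply: eq_measure_integral => A mA A01.
  by rewrite [LHS](_ : _ = leb (A `&` `]0, 1[))// setIidl.
rewrite [RHS]Rintegral_mkcond; apply: ae_eq_Rintegral.
apply: mu01_ae => x x01 _; by rewrite patchE mem_set.
Qed.

Lemma mu01_cst (c : R) : \int[mu]_x c = c.
Proof.
transitivity (c * fine (mu setT)); first exact: Rintegral_cst.
by rewrite mu01T mulr1.
Qed.

Lemma Lt_cst (c : R) : (cst c : R -> R) \in Lfun mu 2%:E.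
Proof. exact: Lfun_cst. Qed.

Lemma Lt_bounded f (M : R) : measurable_fun (setT : set (measurableTypeR R)) f ->
  (forall x, `|f x| <= M) -> f \in Lfun mu 2%:E.
Proof.
move=> mf fM; apply: (@Lt_le _ (measurableTypeR R) R mu f (cst M) mf _ (Lt_cst M)) => x.
by apply: le_trans (fM x) _; exact: ler_norm.
Qed.

Lemma test_fun_cont phi : test_fun phi -> continuous phi.
Proof. by move=> [/smoothP sp _]; exact: smooth_continuous. Qed.

Lemma test_fun_derivable phi x : test_fun phi -> derivable phi x 1.
Proof. by move=> [/smoothP sp _]; exact: smooth_derivable. Qed.

Lemma test_fun_lin a phi psi : test_fun phi -> test_fun psi -> test_fun (a *: phi + psi).
Proof.
move=> [/smoothP sp [a1 [b1 [a10 b11 p0]]]] [/smoothP sq [a2 [b2 [a20 b21 q0]]]]; split.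
  by apply/smoothP => n; apply: CkD; [exact: CkZ|exact: sq].
exists (Num.min a1 a2), (Num.max b1 b2); split.
- by rewrite lt_min a10 a20.
- by rewrite gt_max b11 b21.
- move=> x; rewrite in_itv/= negb_and ge_min le_max !negb_or -!ltNge => h.
  rewrite !fctE p0 ?q0 ?scaler0 ?addr0//= in_itv/= negb_and -!ltNge;
  by case/orP : h => /andP[h1 h2]; rewrite ?h1 ?h2 ?orbT.
Qed.

Lemma test_fun0 : test_fun (0 : R -> R).
Proof.
split; first by apply/smoothP => n; exact: Ck_cst.
by exists (1/2), (1/2); split => //; rewrite ?divr_gt0// ltr_pdivrMr// mul1r ltr1n.
Qed.

Lemma test_fun_derive1 phi : test_fun phi -> test_fun (derive1 phi).
Proof.
move=> [/smoothP sp [a [b [a0 b1 p0]]]]; split.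
  by apply/smoothP; exact: smooth_derive1.
exists a, b; split => // x xab; apply: derive1_is_derive.
have h := is_derive_cst (0 : R) x 1; apply: near_eq_is_derive h.
move: xab; rewrite in_itv/= negb_and -!ltNge => /orP[xa|bx].
  apply: filterS (lt_nbhsl xa) => s sa; rewrite p0//.
  by rewrite in_itv/= leNgt sa.
apply: filterS (lt_nbhsr bx) => s bs; rewrite p0//.
by rewrite in_itv/= negb_and -!ltNge bs orbT.
Qed.

Lemma test_fun_bounded phi : test_fun phi -> exists M, forall x, `|phi x| <= M.
Proof.
move=> tp; have [_ [a [b [a0 b1 p0]]]] := tp.
have cp := test_fun_cont tp.
have cn : {within `[0, 1], continuous (fun x => `|phi x|)}.
  by apply: continuous_subspaceT => x; apply: continuous_comp; [exact: cp|exact: norm_continuous].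
have [c _ hc] := @EVT_max R (fun x => `|phi x|) 0 1 ler01 cn.
exists `|phi c| => x; have [x01|x01] := boolP (x \in `[0, 1]); first exact: hc.
rewrite p0 ?normr0//; apply: contra x01; rewrite !in_itv/= => /andP[ax xb].
by rewrite (le_trans (ltW a0) ax) (le_trans xb (ltW b1)).
Qed.

Lemma test_fun_measurable phi : test_fun phi -> measurable_fun setT phi.
Proof. by move=> tp; apply: continuous_measurable_fun; exact: test_fun_cont. Qed.

Lemma Lt_test phi : test_fun phi -> phi \in Lfun mu 2%:E.
Proof.
move=> tp; have [M hM] := test_fun_bounded tp.
by apply: Lt_bounded hM; exact: test_fun_measurable.
Qed.

Lemma test_fun_out phi x : test_fun phi -> ~~ (0 < x < 1) -> phi x = 0.
Proof.
move=> [_ [a [b [a0 b1 p0]]]] x01; apply: p0; apply: contra x01.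
by rewrite in_itv/= => /andP[ax xb]; rewrite (lt_le_trans a0 ax) (le_lt_trans xb b1).
Qed.

Local Notation mT := (measurableTypeR R).
(** Rational end points keep the family countable, so that [du_bois_reymond_seq] can enumerate
    it. *)
Definition bumps : set (R -> R) :=
  [set f | exists k (q : rat), (0 < (ratr q : R) < 1) /\ f = bumpf k (ratr q)].

Lemma bumps_Lt f : bumps f -> f \in Lfun mu 2%:E.
Proof. by move=> [k [q [/andP[_ q1] ->]]]; apply: Lt_test; exact: test_fun_bump. Qed.

Local Notation cspanB := (@cspan _ mT R mu bumps).

Lemma cvg_affine_y (c d : R) : 0 < c -> n.+1%:R * c + d @[n --> \oo] --> +oo.
Proof.
move=> c0; apply/cvgryPge => A; near=> n.
rewrite -lerBlDr -ler_pdivrMr//.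
apply: (@le_trans _ _ n%:R); last by rewrite ler_nat.
near: n; exact: nbhs_infty_ger.
Unshelve. all: by end_near. Qed.

Lemma indic_itv_cspan (b : R) : 0 < b -> b <= 1 -> cspanB (\1_(`]-oo, b[) : R -> R).
Proof.
move=> b0 b1.
(* The bound b/2 keeps q_n positive; the other one gives (n+1)(q_n - x) >= (n+1)(b - x) - 1, which
   diverges for x < b. *)
have exq n : exists q : rat, Num.max (b / 2) (b - n.+1%:R^-1) < (ratr q : R) /\ (ratr q : R) < b.
  have : Num.max (b / 2) (b - n.+1%:R^-1) < b.
    by rewrite gt_max ltr_pdivrMr// ltr_pMr// ltr1n gtrBl invr_gt0 ltr0n.
  by move=> /rat_in_itvoo[q]; rewrite in_itv/= => /andP[]; exists q.
have [q hq] := choice exq.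
have mind : measurable_fun setT (\1_(`]-oo, b[) : R -> R).
  by apply: measurable_indic; exact: measurable_itv.
pose G : R -> R := \1_(`]0, b[).
have G2 : G \in Lfun mu 2%:E.
  apply: (@Lt_bounded _ 1); first by apply: measurable_indic; exact: measurable_itv.
  by move=> x; rewrite /G indicE; case: (_ \in _); rewrite ?normr1 ?normr0.
apply: (@cspan_ae _ mT R mu bumps G).
- apply: (@Lt_bounded _ 1) => // x.
  by rewrite indicE; case: (_ \in _); rewrite ?normr1 ?normr0.
- apply: mu01_ae => x /andP[x0 x1] _; rewrite /G !indicE.
  by congr (nat_of_bool _)%:R; apply/idP/idP; rewrite !inE/= !in_itv/= ?x0.
apply: (@cspan_lim _ mT R mu bumps bumps_Lt (fun n => bumpf n (ratr (q n)))) => //.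
  move=> n; apply: (@cspan_gen _ mT R mu bumps bumps_Lt).
  have [+ qb] := hq n; rewrite gt_max => /andP[bq _].
  exists n, (q n); split => //; rewrite (lt_le_trans qb b1) andbT.
  by apply: lt_trans bq; rewrite divr_gt0.
apply: (@nrm_dct _ mT R mu _ _ (cst 1)).
- by move=> n; apply: continuous_measurable_fun; apply: smooth_continuous; exact: smooth_bump.
- by apply: measurable_indic; exact: measurable_itv.
- exact: Lt_cst.
- by move=> n x; rewrite /cst normr1 ger0_norm ?bump_ge0// bump_le1.
move=> x; rewrite /G indicE; have [xG|xG] := pselect ((`]0, b[%classic : set R) x).
  rewrite mem_set//=; move: xG; rewrite /= in_itv/= => /andP[x0 xb]; rewrite -[X in _ --> X](mulr1 1).
  apply: cvgM; apply: flat0_cvg.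
    apply: ger_cvgy (cvg_affine_y (-1) x0); near=> n; rewrite lerD2l lerN2.
    by rewrite ler_pdivrMr ?ltr0n// mul1r ler_nat.
  have bx : 0 < b - x by rewrite subr_gt0.
  apply: ger_cvgy (cvg_affine_y (-1) bx); near=> n.
  have [+ _] := hq n; rewrite gt_max => /andP[_ h].
  have -> : n.+1%:R * (b - x) - 1 = n.+1%:R * (b - n.+1%:R^-1 - x).
    by rewrite !mulrBr mulfV ?pnatr_eq0//; ring.
  by rewrite ler_pM2l ?ltr0n// lerD2r ltW.
rewrite memNset//=; move: xG; rewrite /= in_itv/= => xb.
rewrite (_ : (fun n => _) = (fun=> 0)); first exact: cvg_cst.
apply/funext => n; apply: bump_supp; rewrite in_itv/=; apply/negP => /andP[x0 xq].
apply: xb; apply/andP; split.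
  by apply: lt_le_trans x0; rewrite invr_gt0 ltr0n.
by apply: le_lt_trans xq _; have [] := hq n.
Unshelve. all: by end_near. Qed.

(** The sets whose indicator lies in the closed span form a Dynkin system. It contains the open left
    rays, which are stable under intersection and generate the Borel sets. *)
Lemma bumps_dense f : f \in Lfun mu 2%:E -> cspanB f.
Proof.
apply: (@cspan_total _ mT R mu bumps bumps_Lt mu01T_lty).
have I2 (A : set (measurableTypeR R)) : measurable A -> (\1_A : R -> R) \in Lfun mu 2%:E.
  move=> mA; apply: (@Lt_bounded _ 1); first exact: measurable_indic.
  by move=> x; rewrite indicE; case: (_ \in _); rewrite ?normr1 ?normr0.
have ray b : cspanB (\1_(`]-oo, b[) : R -> R).
  have [b0|b0] := leP b 0.
    apply: (@cspan_ae _ mT R mu bumps 0).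
    - by apply: I2; exact: measurable_itv.
    - apply: mu01_ae => x /andP[x0 _] _; rewrite indicE memNset//= in_itv/=.
      by apply/negP; rewrite -leNgt (le_trans b0)// ltW.
    - by apply: (@cspan_span _ mT R mu bumps bumps_Lt); exact: lspan0.
  have [b1|b1] := leP b 1; first exact: indic_itv_cspan.
  apply: (@cspan_ae _ mT R mu bumps (\1_(`]-oo, 1[))).
  - by apply: I2; exact: measurable_itv.
  - apply: mu01_ae => x /andP[x0 x1] _; rewrite !indicE !mem_set//= in_itv//=.
    exact: lt_trans b1.
  - by apply: indic_itv_cspan.
pose H := [set A : set (measurableTypeR R) | measurable A /\ cspanB (\1_A : R -> R)].
have dH : dynkin H.
  split.
  - split; first exact: measurableT.
    apply: (@cspan_ae _ mT R mu bumps (\1_(`]-oo, 1[))).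
    + by apply: I2; exact: measurableT.
    + apply: mu01_ae => x /andP[x0 x1] _; rewrite !indicE !mem_set//= in_itv//=.
    + by apply: indic_itv_cspan.
  - move=> A [mA cA]; split; first exact: measurableC.
    have -> : (\1_(~` A) : R -> R) = (\1_[set: R] : R -> R) + (-1) *: \1_A.
      apply/funext => x; rewrite !fctE indicC !indicE in_setT /GRing.scale/= mulN1r.
      by case: (_ \in A) => /=; rewrite ?subrr ?subr0.
    apply: (@cspan_add _ mT R mu bumps bumps_Lt); last first.
      exact: (@cspan_scale _ mT R mu bumps bumps_Lt).
    apply: (@cspan_ae _ mT R mu bumps (\1_(`]-oo, 1[))).
    + by apply: I2; exact: measurableT.
    + apply: mu01_ae => x /andP[x0 x1] _; rewrite !indicE !mem_set//= in_itv//=.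
    + by apply: indic_itv_cspan.
  - move=> F tF HF; have mF n : measurable (F n) by have [] := HF n.
    have mU : measurable (\bigcup_k F k) by exact: bigcup_measurable.
    (* Disjointness makes the partial sums indicators of finite unions, hence dominated by 1. *)
    split => //; pose S n : R -> R := \sum_(i < n) \1_(F i).
    have SE n x : S n x = \1_(\big[setU/set0]_(i < n) F i) x.
      rewrite /S fct_sumE; elim: n => [|n ih]; first by rewrite !big_ord0 indic0.
      rewrite !big_ord_recr/= ih !indicE in_setU.
      have [xn|xn] := boolP (x \in F n); last by rewrite orbF addr0.
      rewrite orbT (_ : (x \in _) = false) ?add0r//.
      apply/negbTE; rewrite notin_setE -bigcup_mkord => -[i /= im Fi].
      have := tF i n I I; rewrite inE in xn => /(_ (ex_intro _ x (conj Fi xn))) ei.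
      by rewrite ei ltnn in im.
    apply: (@cspan_lim _ mT R mu bumps bumps_Lt S); first exact: I2.
      by move=> n; apply: (@cspan_sum _ mT R mu bumps bumps_Lt) => // i; have [] := HF i.
    apply: (@nrm_dct _ mT R mu _ _ (cst 1)).
    + move=> n; rewrite (_ : S n = \1_(\big[setU/set0]_(i < n) F i)); last exact/funext.
      by apply: measurable_indic; exact: bigsetU_measurable.
    + exact: measurable_indic.
    + exact: Lt_cst.
    + by move=> n x; rewrite SE indicE; case: (_ \in _); rewrite /cst ?normr1 ?normr0.
    move=> x; rewrite indicE; have [xU|xU] := pselect ((\bigcup_k F k) x).
      rewrite mem_set//=; move: xU => [m _ Fm]; apply: cvg_near_cst; exists m.+1 => // n /= mn.
      rewrite SE indicE mem_set// -bigcup_mkord; by exists m.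
    rewrite memNset//=; rewrite (_ : (fun n => _) = (fun=> 0)); first exact: cvg_cst.
    apply/funext => n; rewrite SE indicE memNset// -bigcup_mkord => -[i _ Fi].
    by apply: xU; exists i.
move=> A mA; suff : H A by case.
have mE := RGenInftyO.measurableE R.
have : <<s @RGenInftyO.G R >> `<=` H.
  apply: lambda_system_subset => //.
  - move=> _ _ [a ->] [b ->]; exists (Num.min a b); apply/seteqP; split => x /=.
      by rewrite !in_itv/= lt_min => -[-> ->].
    by rewrite !in_itv/= lt_min => /andP[].
  - exact/dynkin_lambda_system.
  - by move=> _ [b ->]; split; [exact: measurable_itv|exact: ray].
apply; rewrite -[X in X A]/(@RGenInftyO.G R).-sigma.-measurable -mE.
exact: mA.
Qed.

Lemma bumps_test f : @lspan _ mT R bumps f -> test_fun f.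
Proof.
apply: (@lspan_sub _ mT R bumps (@test_fun R)); first exact: test_fun0.
by move=> a p q [k [r [/andP[_ r1] ->]]]; apply: test_fun_lin; exact: test_fun_bump.
Qed.

Lemma test_fun_dense f e : f \in Lfun mu 2%:E -> 0 < e ->
  exists2 phi, test_fun phi & l2nrm mu (f - phi) <= e.
Proof.
move=> f2 e0; have [_ /(_ e e0)[phi sp h]] := bumps_dense f2.
by exists phi => //; exact: bumps_test.
Qed.

(** Orthogonal to a family with dense span, r is orthogonal to itself. *)
Lemma bumps_orth_eq0 r : r \in Lfun mu 2%:E -> (forall g, bumps g -> l2dot mu r g = 0) ->
  r = 0 %[ae mu].
Proof.
move=> r2 rg; apply: nrm_eq0 => //; rewrite nrmE//.
by rewrite (@cspan_orth _ mT R mu bumps bumps_Lt _ _ r2 rg (bumps_dense r2)) sqrtr0.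
Qed.

End Mu01.

(** * Primitives and the lemma of du Bois-Reymond *)

Section WeakDerivative.
Variable R : realType.
Implicit Types (f g h phi psi : R -> R) (P : R -> Prop).
Notation mu := (mu01 R).
Notation leb := (@lebesgue_measure R).
Notation mT := (measurableTypeR R).
Local Notation Lt f := (f \in Lfun mu 2%:E).
Local Notation ip := (@l2dot _ mT R mu).
Local Notation nrm := (@l2nrm _ mT R mu).

Lemma Rintegral_mu01_cc f : {within `[0, 1], continuous f} ->
  \int[mu]_x f x = \int[leb]_(x in `[0, 1]) f x.
Proof.
move=> cf; have fi : leb.-integrable `[0, 1] (EFin \o f).
  by apply: continuous_compact_integrable => //; exact: segment_compact.
rewrite Rintegral_mu01 Rintegral_itv_bndo_bndc.
  by apply: Rintegral_itv_obnd_cbnd; apply: integrableS fi => //; exact: subset_itv_oc_cc.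
by apply: integrableS fi => //; exact: subset_itv_oo_cc.
Qed.

Lemma int_derive f (df : R -> R) : (forall x : R, is_derive x 1 f (df x)) -> continuous df ->
  \int[mu]_x (df x) = f 1 - f 0.
Proof.
move=> fdf cdf.
have cd : {within `[0, 1], continuous df} by exact: continuous_subspaceT.
have cf x : {for x, continuous f}.
  by apply: differentiable_continuous; apply/derivable1_diffP; case: (fdf x).
rewrite Rintegral_mu01_cc// /Rintegral (@continuous_FTC2 _ _ f)//.
  split; first by move=> x _; case: (fdf x).
    by apply: cvg_at_right_filter; exact: cf.
  by apply: cvg_at_left_filter; exact: cf.
by move=> x _; exact: derive1_is_derive.
Qed.

Lemma int_test_derive1 phi : test_fun phi -> \int[mu]_x (derive1 phi x) = 0.
Proof.
move=> tp.
have D (x : R) : is_derive x 1 phi (derive1 phi x).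
  by apply: is_derive_derive1; exact: (@test_fun_derivable R phi x tp).
rewrite (int_derive D); last exact/test_fun_cont/test_fun_derive1.
by rewrite !(test_fun_out tp) ?ltxx ?andbF//= subrr.
Qed.

Lemma test_fun_mul phi psi : test_fun phi -> smooth psi -> test_fun (fun x => phi x * psi x).
Proof.
move=> [/smoothP sp [a [b [a0 b1 p0]]]] sq; split.
  by apply/smoothP => n; exact: CkM.
by exists a, b; split => // x xab; rewrite p0// mul0r.
Qed.

(** On the whole line psi may be unbounded; cutting it off outside [0,1], where it is bounded by
    compactness, does not change its class. *)
Lemma continuous_Lt psi : continuous psi -> Lt psi.
Proof.
move=> cq.
have cn : {within `[0, 1], continuous (fun x => `|psi x|)}.
  by apply: continuous_subspaceT => x; apply: continuous_comp; [exact: cq|exact: norm_continuous].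
have [c _ hc] := @EVT_max R (fun x => `|psi x|) 0 1 ler01 cn.
have mp : measurable_fun (setT : set mT) psi by exact: continuous_measurable_fun.
pose g : R -> R := fun x => psi x * \1_(`[0, 1]) x.
suff g2 : Lt g.
  apply: Lt_intro => //.
  have := Lfun2_integrable_sqr g2.
  move=> /integrableP[m1 i1]; apply/integrableP; split.
    by apply/measurable_EFinP; exact: measurable_funX.
  apply: le_lt_trans i1; rewrite le_eqVlt; apply/orP; left; apply/eqP.
  apply: ae_eq_integral_nm.
  apply: mu01_ae => x /andP[x0 x1] _; rewrite /= /g indicE mem_set ?mulr1//=.
  by rewrite in_itv/= !ltW.
apply: (@Lt_bounded _ _ `|psi c|).
  by apply: measurable_funM => //; apply: measurable_indic; exact: measurable_itv.
move=> x; rewrite /g indicE; have [x01|x01] := pselect ((`[0, 1]%classic : set R) x).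
  by rewrite mem_set// mulr1; apply: hc.
by rewrite memNset// mulr0 normr0.
Qed.

Lemma smooth_Lt psi : smooth psi -> Lt psi.
Proof. by move=> /smooth_continuous; exact: continuous_Lt. Qed.

Lemma ip_parts phi psi : test_fun phi -> smooth psi ->
  ip psi (derive1 phi) = - ip (derive1 psi) phi.
Proof.
move=> tp sq; have tpq := test_fun_mul tp sq.
have := int_test_derive1 tpq.
have -> : derive1 (fun x => phi x * psi x) =
    (fun x => psi x * derive1 phi x + derive1 psi x * phi x).
  apply/funext => x.
  have h := is_derive_mul (is_derive_derive1 (@test_fun_derivable R phi x tp))
    (is_derive_derive1 (@smooth_derivable R psi x sq)).
  by rewrite (derive1_is_derive h); ring.
have q2 := smooth_Lt sq; have dq2 := smooth_Lt (smooth_derive1 sq).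
have p2 := Lt_test tp; have dp2 := Lt_test (test_fun_derive1 tp).
rewrite (@RintegralD _ mT R mu) //; try exact: Lt_mul_integrable.
by rewrite -/(ip _ _) -/(ip _ _) => /eqP; rewrite addr_eq0 => /eqP.
Qed.

Lemma weak_deriv_test phi : test_fun phi -> weak_deriv phi (derive1 phi).
Proof. by move=> tp psi tpsi; apply: ip_parts => //; apply/smoothP; case: tp. Qed.

Definition ray (x : R) : R -> R := \1_(`]-oo, x]).

Lemma ray_measurable x : measurable_fun (setT : set mT) (ray x).
Proof. by apply: measurable_indic; exact: measurable_itv. Qed.

Lemma ray01 x t : 0 <= ray x t <= 1.
Proof. by rewrite /ray indicE; case: (_ \in _); rewrite ?lexx ?ler01. Qed.

Lemma rayE x t : ray x t = (nat_of_bool (t <= x))%:R.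
Proof. by rewrite /ray indicE; congr (nat_of_bool _)%:R; apply/idP/idP; rewrite inE/= in_itv. Qed.

Lemma Lt_ray x : Lt (ray x).
Proof.
apply: (@Lt_bounded _ _ 1); first exact: ray_measurable.
by move=> t; have /andP[r0 r1] := ray01 x t; rewrite ger0_norm.
Qed.

(** The squared norm is the measure of the part of the interval between x and y inside (0,1). This
    is the source of the Hölder 1/2 continuity of primitives and of [slice_rep]. *)
Lemma nrm_ray_sub x y : nrm (ray x - ray y) ^+ 2 <= `|x - y|.
Proof.
wlog yx : x y / y <= x.
  move=> H; have [yx|xy] := leP y x; first exact: H.
  by rewrite distrC nrmBC; [apply: H; exact: ltW|exact: Lt_ray|exact: Lt_ray].
rewrite nrm_sqr; last by apply: LtB; exact: Lt_ray.
rewrite ger0_norm ?subr_ge0// /l2dot Rintegral_mu01.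
rewrite (@eq_Rintegral _ _ _ leb _ (\1_(`]y, x]))); last first.
  move=> t _; rewrite !fctE !rayE indicE.
  have -> : (t \in `]y, x]%classic) = (y < t <= x).
    by apply/idP/idP; rewrite inE/= in_itv.
  rewrite ltNge; have [tx|tx] := leP t x; have [ty|ty] := leP t y => /=;
    rewrite ?subrr ?subr0 ?mulr0 ?mulr1//.
  by move: (le_lt_trans ty (le_lt_trans yx tx)); rewrite ltxx.
rewrite /Rintegral integral_indic//.
pose A : set mT := `]y, x]%classic; pose B : set mT := `]0, 1[%classic.
have mA : measurable A by exact: measurable_itv.
have mB : measurable B by exact: measurable_itv.
have h : (leb (A `&` B) <= (x - y)%:E)%E.
  apply: (@le_trans _ _ (leb A)).
    by apply: le_measure => //; rewrite ?inE//; exact: measurableI.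
  rewrite lebesgue_measure_itv/= lte_fin; case: ltP => // _.
  by rewrite lee_fin subr_ge0.
rewrite -lee_fin fineK// ge0_fin_numE ?measure_ge0//; apply: le_lt_trans h _.
exact: ltry.
Qed.

Lemma nrm_ray_le1 x : nrm (ray x) <= 1.
Proof.
rewrite -(@ler_pXn2r _ 2)// ?nnegrE ?nrm_ge0// nrm_sqr ?Lt_ray// expr1n.
rewrite -[leRHS](mu01_cst (1 : R)); apply: (@le_Rintegral _ mT R mu) => //.
- by apply: Lt_mul_integrable; exact: Lt_ray.
- exact: finite_measure_integrable_cst.
- by move=> t _; have /andP[r0 r1] := ray01 x t; rewrite mulr_ile1.
Qed.

(** The primitive that vanishes at 0, extended by constants outside [0,1]. As an inner product with
    an indicator it inherits linearity, Cauchy-Schwarz and invariance under a.e. equality. *)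
Definition prim h (x : R) : R := ip (ray x) h.

Lemma prim_lip h x y : Lt h -> (prim h x - prim h y) ^+ 2 <= `|x - y| * nrm h ^+ 2.
Proof.
move=> h2; have := nrm_ray_sub x y.
rewrite /prim -ipBl//; try exact: Lt_ray.
have r2 := LtB (Lt_ray x) (Lt_ray y).
have := cauchy_schwarz r2 h2 => h1 h3.
rewrite -real_normK ?num_real//; apply: (@le_trans _ _ ((nrm (ray x - ray y) * nrm h) ^+ 2)).
  by rewrite lerXn2r ?nnegrE// mulr_ge0// nrm_ge0.
by rewrite exprMn ler_wpM2r// sqr_ge0.
Qed.

Lemma prim_bound h x : Lt h -> `|prim h x| <= nrm h.
Proof.
move=> h2; apply: (le_trans (cauchy_schwarz (Lt_ray x) h2)).
by rewrite ler_piMl ?nrm_ge0// nrm_ray_le1.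
Qed.

Lemma primB h g x : Lt h -> Lt g -> prim (h - g) x = prim h x - prim g x.
Proof. by move=> h2 g2; rewrite /prim ipBr//; exact: Lt_ray. Qed.

Lemma sqr_lip_continuous f (K : R) : (forall x y, (f x - f y) ^+ 2 <= `|x - y| * K) -> continuous f.
Proof.
move=> fK x; apply/cvgrPdist_le => e e0.
have K1 : 0 < `|K| + 1 by rewrite ltr_wpDl.
near=> t; rewrite -(@ler_pXn2r _ 2)// ?nnegrE ?(ltW e0)// real_normK ?num_real//.
apply: le_trans (fK x t) _; apply: (@le_trans _ _ (`|x - t| * (`|K| + 1))).
  by rewrite ler_wpM2l//; apply: le_trans (ler_norm K) _; rewrite lerDl.
rewrite -ler_pdivlMr//; near: t.
have r0 : 0 < e ^+ 2 / (`|K| + 1) by rewrite divr_gt0// exprn_gt0.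
by apply: filterS (nbhsx_ballx x _ r0) => t /ltW.
Unshelve. all: by end_near. Qed.

Lemma prim_continuous h : Lt h -> continuous (prim h).
Proof. by move=> h2; apply: (@sqr_lip_continuous _ (nrm h ^+ 2)) => x y; exact: prim_lip. Qed.

Lemma Lt_prim h : Lt h -> Lt (prim h).
Proof.
move=> h2; apply: (@Lt_bounded _ _ (nrm h)); last by move=> x; exact: prim_bound.
by apply: continuous_measurable_fun; exact: prim_continuous.
Qed.

(** Starting the integral at -1 makes 0 an interior point, so the fundamental theorem of calculus
    applies at every x >= 0. *)
Lemma prim_leb phi x : test_fun phi -> prim phi x = \int[leb]_(t in `[-1, x]) phi t.
Proof.
move=> tp; rewrite /prim /l2dot Rintegral_mu01 Rintegral_mkcond [RHS]Rintegral_mkcond.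
congr Rintegral; apply/funext => t; rewrite !patchE rayE.
have [t01|t01] := boolP (0 < t < 1); last first.
  by rewrite (test_fun_out tp t01) mulr0; case: ifP; case: ifP.
rewrite mem_set/=; last by rewrite in_itv.
have [tx|tx] := leP t x; last by rewrite mul0r memNset//= in_itv/= [t <= x]leNgt tx andbF.
rewrite mul1r mem_set//= in_itv/= tx andbT; case/andP : t01 => t0 _; lra.
Qed.

Lemma is_derive_prim phi (x : R) : test_fun phi -> is_derive x 1 (prim phi) (phi x).
Proof.
move=> tp; have cp := test_fun_cont tp.
have [x0|x0] := ltP x 0.
  rewrite (test_fun_out tp); last by rewrite ltNge ltW.
  have h := is_derive_cst (0 : R) x 1; apply: near_eq_is_derive h.
  apply: filterS (lt_nbhsl x0) => s s0; rewrite prim_leb// Rintegral_mkcond.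
  rewrite -[LHS](@Rintegral_set0 _ mT R leb phi) Rintegral_mkcond; congr Rintegral.
  apply/funext => t; rewrite !patchE in_set0; case: ifPn => //; rewrite inE/= in_itv/= => /andP[_ ts].
  by rewrite (test_fun_out tp)//; apply/negP => /andP[t0 _]; move: (lt_le_trans t0 (le_trans ts (ltW s0))); rewrite ltxx.
have fi : leb.-integrable `[-1, x + 1] (EFin \o phi).
  by apply: continuous_compact_integrable; [exact: segment_compact|exact: continuous_subspaceT].
have x1 : x < x + 1 by rewrite ltrDl.
have x1' : -1 < x by apply: lt_le_trans x0; rewrite ltrN10.
have [d1 d2] := @continuous_FTC1_closed R phi (-1) x (x + 1) x1 fi x1' (cp x).
rewrite (_ : prim phi = (fun x => \int[leb]_(t in `[-1, x]) phi t)); last first.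
  by apply/funext => s; exact: prim_leb.
by rewrite -d2; exact: is_derive_derive1.
Qed.

Lemma smooth_prim phi : test_fun phi -> smooth (prim phi).
Proof.
move=> tp; apply: (@smooth_deriv _ _ phi); first by move=> x; exact: is_derive_prim.
by apply/smoothP; case: tp.
Qed.

Lemma derive1_prim phi : test_fun phi -> derive1 (prim phi) = phi.
Proof. by move=> tp; apply/funext => x; apply: derive1_is_derive; exact: is_derive_prim. Qed.

(** Zero mean is what makes the primitive vanish to the right of the support of phi. *)
Lemma test_fun_prim phi : test_fun phi -> \int[mu]_x phi x = 0 -> test_fun (prim phi).
Proof.
move=> tp i0; have [_ [a [b [a0 b1 p0]]]] := tp.
split; first exact/smoothP/smooth_prim.
exists a, b; split => // x; rewrite in_itv/= negb_and -!ltNge => /orP[xa|bx].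
  rewrite /prim /l2dot -(mu01_cst (0 : R)); apply: (@ae_eq_Rintegral _ mT R mu); apply: aeW => t _.
  rewrite rayE; have [tx|_] := leP t x; last by rewrite mul0r.
  by rewrite p0 ?mulr0// in_itv/= leNgt (le_lt_trans tx xa).
rewrite -[RHS]i0 /prim /l2dot; apply: (@ae_eq_Rintegral _ mT R mu); apply: aeW => t _.
rewrite rayE; have [_|xt] := leP t x; first by rewrite mul1r.
by rewrite mul0r p0// in_itv/= negb_and -!ltNge (lt_trans bx xt) orbT.
Qed.

(** For a test function h this is classical integration by parts; both sides depend continuously on
    h in L^2, where test functions are dense. *)
Lemma weak_deriv_prim h : Lt h -> weak_deriv (prim h) h.
Proof.
move=> h2 phi tp; rewrite -/(ip _ _) -/(ip _ _).
have p2 := Lt_test tp; have dp2 := Lt_test (test_fun_derive1 tp); have ph2 := Lt_prim h2.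
apply/eqP; rewrite -subr_eq0 opprK -normr_le0; apply/ler_addgt0Pl => e e0; rewrite addr0.
pose K := nrm (derive1 phi) + nrm phi + 1.
have K0 : 0 < K by rewrite ltr_wpDl// addr_ge0// nrm_ge0.
have [z tz hz] := test_fun_dense h2 (divr_gt0 e0 K0).
have z2 := Lt_test tz; have pz2 := Lt_prim z2; have hz2 := LtB h2 z2.
have := ip_parts tp (smooth_prim tz); rewrite derive1_prim// => E.
have -> : ip (prim h) (derive1 phi) + ip h phi =
  ip (prim h - prim z) (derive1 phi) + ip (h - z) phi.
  by rewrite !ipBl// E; ring.
have n1 : nrm (prim h - prim z) <= nrm (h - z).
  rewrite -(@ler_pXn2r _ 2)// ?nnegrE ?nrm_ge0// nrm_sqr; last exact: LtB.
  rewrite -[leRHS](mu01_cst (nrm (h - z) ^+ 2)); apply: (@le_Rintegral _ mT R mu) => //.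
  - by apply: Lt_mul_integrable; exact: LtB.
  - exact: finite_measure_integrable_cst.
  - move=> t _; rewrite -expr2 !fctE -primB// -real_normK ?num_real//.
    by rewrite lerXn2r ?nnegrE ?nrm_ge0// prim_bound.
apply: (le_trans (ler_normD _ _)).
apply: (le_trans (lerD (cauchy_schwarz (LtB ph2 pz2) dp2) (cauchy_schwarz hz2 p2))).
move: hz; rewrite ler_pdivlMr//; apply: le_trans; rewrite /K !mulrDr mulr1.
apply: (@le_trans _ _ (nrm (h - z) * nrm (derive1 phi) + nrm (h - z) * nrm phi)).
  by rewrite lerD// ler_wpM2r// nrm_ge0.
by rewrite lerDl nrm_ge0.
Qed.

Definition mean f : R := ip f (cst 1).

Lemma meanE f : mean f = \int[mu]_x f x.
Proof. by apply: (@ae_eq_Rintegral _ mT R mu); apply: aeW => t _; rewrite /cst mulr1. Qed.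

(** If every bump had zero mean, the constant 1 would be orthogonal to a dense span and vanish a.e.,
    although (0,1) has measure 1. *)
Lemma exists_unit_test : exists2 theta : R -> R, test_fun theta & mean theta = 1.
Proof.
have [[g [gb g0]]|nex] := pselect (exists g, @bumps R g /\ mean g != 0).
  have tg : test_fun g by case: gb => k [q [/andP[_ q1] ->]]; exact: test_fun_bump.
  exists ((mean g)^-1 *: g).
    by rewrite -[_ *: g]addr0; apply: test_fun_lin => //; exact: test_fun0.
  by rewrite /mean ipZl ?Lt_cst ?Lt_test// mulVf.
have := @bumps_orth_eq0 R (cst 1) (Lt_cst 1).
case.
  move=> g gb; rewrite ipC; apply/eqP/negP => /negP g0; apply: nex; by exists g.
move=> N [mN N0 sN].
have : mu setT = 0%E.
  apply/eqP; rewrite eq_le measure_ge0 andbT -N0 le_measure ?inE//.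
  by move=> x _; apply: sN => /= /(_ I) /eqP; rewrite oner_eq0.
by rewrite mu01T => /eqP; rewrite eqe oner_eq0.
Qed.

(* Countably many test functions already suffice in the lemma of
   du Bois-Reymond; this is what permits slicing later on. *)
Lemma du_bois_reymond_seq : exists2 Z : nat -> R -> R, (forall n, test_fun (Z n)) &
  forall r, Lt r -> (forall n, ip r (derive1 (Z n)) = 0) -> exists c : R, r = cst c %[ae mu].
Proof.
have [theta tt t1] := exists_unit_test.
have th2 := Lt_test tt.
pose B (kq : nat * rat) : R -> R := if 0 < (ratr kq.2 : R) < 1 then bumpf kq.1 (ratr kq.2) else 0.
have tB kq : test_fun (B kq).
  by rewrite /B; case: ifPn => [/andP[_ q1]|_]; [exact: test_fun_bump|exact: test_fun0].
(* Subtracting a multiple of theta gives zero mean, so [D kq] is the derivative of a test function;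
   these primitives, enumerated through [pickle], are the sequence [Z]. *)
pose D kq : R -> R := - mean (B kq) *: theta + B kq.
have tD kq : test_fun (D kq) by exact: test_fun_lin.
have mD kq : \int[mu]_x D kq x = 0.
  rewrite -meanE /mean ipDl ?LtZ ?Lt_cst ?Lt_test// ipZl ?Lt_cst//.
  by rewrite -/(mean theta) t1 mulr1 -/(mean _) addNr.
pose Z n : R -> R := if unpickle n is Some kq then prim (D kq) else 0.
exists Z => [n|r r2 Hr].
  by rewrite /Z; case: unpickle => [kq|]; [exact: test_fun_prim|exact: test_fun0].
have rD kq : ip r (D kq) = 0.
  by have := Hr (pickle kq); rewrite /Z pickleK derive1_prim.
(* Orthogonality to [D kq] reads <r, B> = mean(B) <r, theta>, so r - <r, theta> is orthogonal to
   every bump. *)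
exists (ip r theta).
have c2 := Lt_cst (ip r theta).
have : (r - cst (ip r theta)) = 0 %[ae mu].
  apply: bumps_orth_eq0; first exact: LtB.
  move=> g [k [q [q01 ->]]].
  have BE : B (k, q) = bumpf k (ratr q) by rewrite /B q01.
  have := rD (k, q); rewrite /D BE -BE.
  have b2 := Lt_test (tB (k, q)).
  rewrite ipDr ?LtZ// ipZr// ipBl//.
  have -> : ip (cst (ip r theta)) (B (k, q)) = ip r theta * mean (B (k, q)).
    rewrite /mean -ipZr ?Lt_cst// ipC; apply: (@ae_eq_Rintegral _ mT R mu); apply: aeW => t _.
    by rewrite -[RHS]/(_ * (_ * 1)) mulr1.
  by move=> <-; ring.
by apply: filterS => x /= h /h /eqP; rewrite !fctE subr_eq0 => /eqP.
Qed.

Lemma du_bois_reymond r : Lt r -> (forall Z, test_fun Z -> ip r (derive1 Z) = 0) ->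
  exists c : R, r = cst c %[ae mu].
Proof.
by move=> r2 H; have [Z tZ HZ] := du_bois_reymond_seq; apply: HZ => // n; exact: H.
Qed.

Lemma test_orth_eq0 r : Lt r -> (forall phi, test_fun phi -> ip r phi = 0) -> r = 0 %[ae mu].
Proof.
move=> r2 H; apply: bumps_orth_eq0 => // g [k [q [/andP[_ q1] ->]]].
by apply: H; exact: test_fun_bump.
Qed.

End WeakDerivative.

(** * The spaces H^1 and H^1_0 *)

Section SobolevSpaces.
Variable R : realType.
Implicit Types (f g h phi psi : R -> R) (P : R -> Prop).
Notation mu := (mu01 R).
Notation leb := (@lebesgue_measure R).
Notation mT := (measurableTypeR R).
Local Notation Lt f := (f \in Lfun mu 2%:E).
Local Notation ip := (@l2dot _ mT R mu).
Local Notation nrm := (@l2nrm _ mT R mu).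

Local Notation aeS := (@ae_mono _ mT R mu).

Lemma weak_deriv_uniq f g g' : Lt g -> Lt g' -> weak_deriv f g -> weak_deriv f g' ->
  g = g' %[ae mu].
Proof.
move=> g2 g2' fg fg'; have : g - g' = 0 %[ae mu].
  apply: test_orth_eq0; first exact: LtB.
  move=> phi tp; rewrite ipBl//; last exact: Lt_test.
  have := fg phi tp; have := fg' phi tp; rewrite -!/(ip _ _) => -> /eqP.
  by rewrite eqr_opp => /eqP ->; rewrite subrr.
by apply: aeS => x h /h /eqP; rewrite !fctE subr_eq0 => /eqP.
Qed.

Lemma wdP f g : Lt g -> weak_deriv f g ->
  [/\ Lt (wd f), weak_deriv f (wd f) & wd f = g %[ae mu]].
Proof.
move=> g2 fg; have [w1 w2] : [set g | @L2 R g /\ weak_deriv f g] (wd f).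
  by rewrite /wd; apply: xgetPex; exists g.
by split => //; exact: (weak_deriv_uniq w1 g2 w2 fg).
Qed.

Lemma H1_intro f g : Lt f -> Lt g -> weak_deriv f g -> H1 R f.
Proof. by move=> f2 g2 fg; split => //; exists g. Qed.

Lemma H1_Lt f : H1 R f -> Lt f. Proof. by case. Qed.

Lemma H1_wd f : H1 R f -> Lt (wd f) /\ weak_deriv f (wd f).
Proof. by move=> [f2 [g [g2 fg]]]; have [] := wdP g2 fg. Qed.

Lemma H1_Lt_wd f : H1 R f -> Lt (wd f). Proof. by move=> /H1_wd[]. Qed.

Lemma weak_deriv_ae f f' g g' : f = f' %[ae mu] -> g = g' %[ae mu] ->
  weak_deriv f g -> weak_deriv f' g'.
Proof.
move=> ff gg fg phi tp; have := fg phi tp; rewrite -!/(ip _ _).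
by rewrite (ae_eq_ipl _ ff) (ae_eq_ipl _ gg).
Qed.

Lemma weak_deriv_lin a f g f' g' : Lt f -> Lt g -> Lt f' -> Lt g' ->
  weak_deriv f f' -> weak_deriv g g' -> weak_deriv (a *: f + g) (a *: f' + g').
Proof.
move=> f2 g2 f'2 g'2 ff gg phi tp; rewrite -/(ip _ _) -/(ip _ _).
have p2 := Lt_test tp; have dp2 := Lt_test (test_fun_derive1 tp).
have := ff phi tp; have := gg phi tp; rewrite -!/(ip _ _) => E1 E2.
by rewrite !ipDl ?LtZ// !ipZl// E1 E2; ring.
Qed.

Lemma H1_lin a f g : H1 R f -> H1 R g -> H1 R (a *: f + g).
Proof.
move=> hf hg; have [f'2 ff] := H1_wd hf; have [g'2 gg] := H1_wd hg.
have f2 := H1_Lt hf; have g2 := H1_Lt hg.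
apply: (@H1_intro _ (a *: wd f + wd g)); [|by apply: LtD => //; exact: LtZ|].
  by apply: LtD => //; exact: LtZ.
exact: weak_deriv_lin.
Qed.

Lemma wd_lin a f g : H1 R f -> H1 R g -> wd (a *: f + g) = a *: wd f + wd g %[ae mu].
Proof.
move=> hf hg; have [f'2 ff] := H1_wd hf; have [g'2 gg] := H1_wd hg.
have f2 := H1_Lt hf; have g2 := H1_Lt hg.
have s2 : Lt (a *: wd f + wd g) by apply: LtD => //; exact: LtZ.
by have [] := wdP s2 (weak_deriv_lin a f2 g2 f'2 g'2 ff gg).
Qed.

Lemma fun_subE f g : f - g = -1 *: g + f.
Proof. by rewrite scaleN1r addrC. Qed.

Lemma H1_sub f g : H1 R f -> H1 R g -> H1 R (f - g).
Proof. by move=> hf hg; rewrite fun_subE; exact: H1_lin. Qed.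

Lemma wd_sub f g : H1 R f -> H1 R g -> wd (f - g) = wd f - wd g %[ae mu].
Proof. by move=> hf hg; rewrite !fun_subE; exact: wd_lin. Qed.

(** The equality is pointwise: f enters the set from which [wd] chooses only through integrals, so
    both choices are made from the same set. *)
Lemma wd_ae f g : f = g %[ae mu] -> wd f = wd g.
Proof.
move=> fg; rewrite /wd; congr xget; apply/seteqP; split => h /= [h2 fh]; split => //.
  by apply: weak_deriv_ae fh => //; exact: ae_eq_refl.
by apply: weak_deriv_ae fh; [exact: ae_eq_sym|exact: ae_eq_refl].
Qed.

Lemma H1norm_sqr f : H1norm f ^+ 2 = nrm f ^+ 2 + nrm (wd f) ^+ 2.
Proof. by rewrite /H1norm sqr_sqrtr// addr_ge0// sqr_ge0. Qed.

Lemma H1norm_ge0 f : 0 <= H1norm f. Proof. exact: sqrtr_ge0. Qed.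

Lemma H1norm_ae f g : f = g %[ae mu] -> H1norm f = H1norm g.
Proof. by move=> fg; rewrite /H1norm (wd_ae fg); congr (Num.sqrt (_ ^+ 2 + _)); exact: ae_eq_nrm. Qed.

Lemma nrm_le_H1norm f : nrm f <= H1norm f.
Proof.
by rewrite -(@ler_pXn2r _ 2)// ?nnegrE ?nrm_ge0 ?H1norm_ge0// H1norm_sqr lerDl sqr_ge0.
Qed.

Lemma nrm_wd_le_H1norm f : nrm (wd f) <= H1norm f.
Proof.
by rewrite -(@ler_pXn2r _ 2)// ?nnegrE ?nrm_ge0 ?H1norm_ge0// H1norm_sqr lerDr sqr_ge0.
Qed.

Lemma H1norm_le f : H1norm f <= nrm f + nrm (wd f).
Proof.
rewrite -(@ler_pXn2r _ 2)// ?nnegrE ?addr_ge0 ?nrm_ge0 ?H1norm_ge0// H1norm_sqr.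
have : 0 <= nrm f * nrm (wd f) by rewrite mulr_ge0 ?nrm_ge0.
by rewrite sqrrD; lra.
Qed.

(** The factor 2 is the price of comparing the H^1 norm with the sum of two L^2 norms; it is
    harmless in density arguments. *)
Lemma H1norm_lin_le a f g : H1 R f -> H1 R g ->
  H1norm (a *: f + g) <= 2 * (`|a| * H1norm f + H1norm g).
Proof.
move=> hf hg; have f2 := H1_Lt hf; have g2 := H1_Lt hg.
have f'2 := H1_Lt_wd hf; have g'2 := H1_Lt_wd hg.
apply: le_trans (H1norm_le _) _; rewrite (ae_eq_nrm (wd_lin a hf hg)).
have h1 := nrmD (LtZ a f2) g2; have h2 := nrmD (LtZ a f'2) g'2.
rewrite nrmZ// in h1; rewrite nrmZ// in h2.
have := ler_wpM2l (normr_ge0 a) (nrm_le_H1norm f).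
have := ler_wpM2l (normr_ge0 a) (nrm_wd_le_H1norm f).
have := nrm_le_H1norm g; have := nrm_wd_le_H1norm g; lra.
Qed.

Lemma H1_test phi : test_fun phi -> H1 R phi.
Proof.
move=> tp; apply: (@H1_intro _ (derive1 phi)); [exact: Lt_test| |exact: weak_deriv_test].
by apply: Lt_test; exact: test_fun_derive1.
Qed.

Lemma wd_test phi : test_fun phi -> wd phi = derive1 phi %[ae mu].
Proof.
move=> tp; have h : Lt (derive1 phi) by apply: Lt_test; exact: test_fun_derive1.
by have [] := wdP h (weak_deriv_test tp).
Qed.

Lemma H10_H1 f : H10 R f -> H1 R f. Proof. by case. Qed.

Lemma H10_test phi : test_fun phi -> H10 R phi.
Proof.
move=> tp; split; first exact: H1_test.
move=> e e0; exists phi => //; rewrite subrr.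
have h0 := H1_test (@test_fun0 R).
apply: (le_lt_trans (H1norm_le _)); rewrite nrm0 add0r.
have := nrmZ 0 (H1_Lt_wd h0); rewrite normr0 mul0r.
have := ae_eq_nrm (wd_lin 0 h0 h0); rewrite scaler0 addr0 scale0r add0r => _ _.
have -> : nrm (wd (0 : R -> R)) = 0; last by [].
rewrite (ae_eq_nrm (wd_test (@test_fun0 R))).
rewrite (_ : derive1 (0 : R -> R) = 0) ?nrm0//.
by apply/funext => x; apply: derive1_is_derive; exact: is_derive_cst.
Qed.

Lemma H10_lin a f g : H10 R f -> H10 R g -> H10 R (a *: f + g).
Proof.
move=> [hf Hf] [hg Hg]; split; first exact: H1_lin.
move=> e e0; have a1 : 0 < `|a| + 1 by rewrite ltr_wpDl.
(* Quarters absorb the factor 2 of [H1norm_lin_le], and dividing by |a| + 1 absorbs the scalar. *)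
have e10 : 0 < e / 4 / (`|a| + 1) by rewrite !divr_gt0.
have e20 : 0 < e / 4 by rewrite divr_gt0.
have [p tp fp] := Hf _ e10; have [q tq gq] := Hg _ e20.
exists (a *: p + q); first exact: test_fun_lin.
have -> : a *: f + g - (a *: p + q) = a *: (f - p) + (g - q).
  by rewrite scalerBr opprD addrACA.
have hfp := H1_sub hf (H1_test tp); have hgq := H1_sub hg (H1_test tq).
apply: le_lt_trans (H1norm_lin_le _ hfp hgq) _.
have : `|a| * H1norm (f - p) <= e / 4.
  move: fp; rewrite ltr_pdivlMr// => /ltW; apply: le_trans.
  by rewrite mulrC ler_wpM2l ?H1norm_ge0// lerDl.
lra.
Qed.

Lemma H10_sub f g : H10 R f -> H10 R g -> H10 R (f - g).
Proof. by move=> hf hg; rewrite fun_subE; exact: H10_lin. Qed.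

Lemma prim_ae f g x : f = g %[ae mu] -> prim f x = prim g x.
Proof. by move=> fg; exact: ae_eq_ipr. Qed.

(** The difference f - [prim (wd f)] has zero weak derivative. The right-hand side is the continuous
    representative to which boundary values refer. *)
Lemma H1_prim f : H1 R f -> exists c : R, f = (fun y => c + prim (wd f) y) %[ae mu].
Proof.
move=> hf; have [f'2 ff] := H1_wd hf; have f2 := H1_Lt hf; have p2 := Lt_prim f'2.
have := @du_bois_reymond R (f - prim (wd f)) (LtB f2 p2).
case.
  move=> Z tZ; have dZ2 := Lt_test (test_fun_derive1 tZ).
  have := ff Z tZ; have := weak_deriv_prim f'2 tZ.
  by rewrite -!/(ip _ _) => E1 E2; rewrite ipBl// E1 E2 subrr.
move=> c hc; exists c; apply: aeS hc => x h /h.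
by rewrite !fctE /cst => <-; rewrite subrK.
Qed.

Lemma mu01_ae_exists P (c d : R) : 0 <= c -> c < d -> d <= 1 -> (\forall x \ae mu, P x) ->
  exists2 x, c < x < d & P x.
Proof.
move=> c0 cd d1 [N [mN N0 sN]]; apply: contrapT => nex.
pose A : set mT := `]c, d[%classic.
have mA : measurable A by exact: measurable_itv.
have AN : A `<=` N.
  by move=> x xA; apply: sN => /= Px; apply: nex; exists x.
have : (mu A <= 0)%E by rewrite -N0 le_measure ?inE.
rewrite [X in (X <= _)%E](_ : _ = leb (A `&` `]0, 1[))// setIidl.
  by rewrite lebesgue_measure_itv/= lte_fin cd -EFinB lee_fin leNgt subr_gt0 cd.
move=> x; rewrite /A/= !in_itv/= => /andP[cx xd].
by rewrite (le_lt_trans c0 cx) (lt_le_trans xd d1).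
Qed.

Lemma within01_eps f (x l : R) : f t @[t --> within `[0, 1] (nbhs x)] --> l ->
  forall e, 0 < e -> exists2 r, 0 < r &
    forall t, t \in `[0, 1] -> `|t - x| < r -> `|f t - l| <= e.
Proof.
move=> /cvgrPdist_le H e e0; have := H e e0; rewrite near_withinE => -[r /= r0 hr].
exists r => // t t01 tr; rewrite distrC; apply: hr => //.
by rewrite /ball_/= distrC.
Qed.

(** The tool that turns identities for a.e. x into identities at every x of [0,1]: a set of full
    measure has points as close to a as desired, even from one side at the end points. *)
Lemma within_ae_eq f g (a : R) : a \in `[0, 1] ->
  {within `[0, 1], continuous f} -> {within `[0, 1], continuous g} ->
  f = g %[ae mu] -> f a = g a.
Proof.
move=> a01 cf cg fg.
apply/eqP; rewrite -subr_eq0 -normr_le0; apply/ler_addgt0Pl => e e0; rewrite addr0.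
have e20 : 0 < e / 2 by rewrite divr_gt0.
have [r1 r10 hr1] := within01_eps (iffLR (subspace_continuousP _ _) cf a a01) e20.
have [r2 r20 hr2] := within01_eps (iffLR (subspace_continuousP _ _) cg a a01) e20.
pose r := Num.min r1 r2; have r0 : 0 < r by rewrite lt_min r10.
have fg' : \forall x \ae mu, f x = g x by apply: aeS fg => x; exact.
have [x [x01 xr] gx] : exists2 x, x \in `[0, 1] /\ `|x - a| < r & f x = g x.
  move: a01; rewrite in_itv/= => /andP[a0 a1].
  (* The nearby point is sought to the right of a, and to the left only when a = 1. *)
  have [al1|a1'] := ltP a 1.
    have c1 : a < Num.min (a + r) 1 by rewrite lt_min ltrDl r0.
    have c2 : Num.min (a + r) 1 <= 1 by rewrite ge_min lexx orbT.
    have [x /andP[ax]] := mu01_ae_exists a0 c1 c2 fg'.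
    rewrite lt_min => /andP[xr x1] E; exists x => //; split.
      by rewrite in_itv/= (ltW x1) (le_trans a0 (ltW ax)).
    by rewrite gtr0_norm ?subr_gt0// ltrBlDl.
  have ae1 : a = 1 by apply/eqP; rewrite eq_le a1.
  have c1 : 0 <= Num.max 0 (1 - r) by rewrite le_max lexx.
  have c2 : Num.max 0 (1 - r) < 1 by rewrite gt_max ltr01 gtrBl.
  have [x /andP[+ x1] E] := mu01_ae_exists c1 c2 (lexx 1) fg'.
  rewrite gt_max => /andP[x0 xr]; exists x => //; split.
    by rewrite in_itv/= !ltW.
  by rewrite ae1 ltr0_norm ?subr_lt0// opprB ltrBlDl -ltrBlDr.
move: xr; rewrite lt_min => /andP[xr1 xr2].
have h1 := hr1 x x01 xr1; have h2 := hr2 x x01 xr2.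
have -> : f a - g a = (g x - g a) - (f x - f a) by rewrite gx; ring.
by rewrite [e]splitr; apply: (le_trans (ler_normB _ _)); exact: lerD.
Qed.

Lemma value_at_eq f F (a v : R) : continuous F -> f = F %[ae mu] -> a \in `[0, 1] ->
  value_at f a v -> v = F a.
Proof.
move=> cF fF a01 [g [cg fg <-]]; apply: within_ae_eq => //.
  exact: continuous_subspaceT.
by apply: ae_eq_trans fF; exact: ae_eq_sym.
Qed.

Lemma nrm_prim_le h : Lt h -> nrm (prim h) <= nrm h.
Proof.
move=> h2; rewrite -(@ler_pXn2r _ 2)// ?nnegrE ?nrm_ge0// nrm_sqr; last exact: Lt_prim.
rewrite -[leRHS](mu01_cst (nrm h ^+ 2)); apply: (@le_Rintegral _ mT R mu) => //.
- by apply: Lt_mul_integrable; exact: Lt_prim.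
- exact: finite_measure_integrable_cst.
- move=> t _; rewrite -expr2 -real_normK ?num_real//.
  by rewrite lerXn2r ?nnegrE ?nrm_ge0// prim_bound.
Qed.

Lemma nrm_cst1 : nrm (cst 1) = 1.
Proof.
rewrite nrmE; last exact: Lt_cst.
by rewrite -/(mean (cst 1)) meanE mu01_cst sqrtr1.
Qed.

Lemma prim0 h : prim h 0 = 0.
Proof.
rewrite /prim -[RHS](ip0l mu h); apply: ae_eq_ipl; apply: mu01_ae => x /andP[x0 _] _.
by rewrite rayE leNgt x0.
Qed.

Lemma prim1 h : prim h 1 = mean h.
Proof.
rewrite /prim /mean ipC; apply: ae_eq_ipr; apply: mu01_ae => x /andP[_ x1] _.
by rewrite rayE ltW.
Qed.

(** The boundary values say that f is the primitive of h = f' and that h has zero mean.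
    Approximating h by test functions of zero mean, their primitives are test functions that
    approximate f in H^1. *)
Lemma H10_value_at f : H1 R f -> value_at f 0 0 -> value_at f 1 0 -> H10 R f.
Proof.
move=> hf v0 v1; split => // e e0.
have aux (a b : R) : a <= b -> b <= e / 4 -> a + b < e by lra.
have [h2 fh] := H1_wd hf; set h := wd f in h2 fh; have f2 := H1_Lt hf.
have [c fc] := H1_prim hf; rewrite -/h in fc.
have cF : continuous (fun y => c + prim h y).
  by move=> y; apply: cvgD; [exact: cvg_cst|exact: prim_continuous].
have c0 : c = 0.
  have i0 : (0 : R) \in `[0, 1] by rewrite in_itv/= lexx ler01.
  by have := value_at_eq cF fc i0 v0; rewrite prim0 addr0.
have m0 : mean h = 0.
  have i1 : (1 : R) \in `[0, 1] by rewrite in_itv/= lexx ler01.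
  by have := value_at_eq cF fc i1 v1; rewrite prim1 c0 add0r.
have [theta tt t1] := exists_unit_test R; have th2 := Lt_test tt.
pose K := 1 + nrm theta; have K0 : 0 < K by rewrite ltr_pwDl// nrm_ge0.
have eK : 0 < e / 4 / K by rewrite !divr_gt0.
have [z tz hz] := test_fun_dense h2 eK; have z2 := Lt_test tz; have hz2 := LtB h2 z2.
(* Since h has zero mean, the mean of z is no larger than the error already made; removing it with
   theta costs at most the factor [K]. *)
have mz : `|mean z| <= nrm (h - z).
  have -> : mean z = - mean (h - z).
    by rewrite /mean ipBl ?Lt_cst// -!/(mean _) m0 sub0r opprK.
  rewrite normrN /mean; apply: (le_trans (cauchy_schwarz hz2 (Lt_cst 1))).
  by rewrite nrm_cst1 mulr1.
pose z' := - mean z *: theta + z.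
have tz' : test_fun z' by exact: test_fun_lin.
have z'2 := Lt_test tz'; have hz'2 := LtB h2 z'2.
have mz' : \int[mu]_x z' x = 0.
  rewrite -meanE /mean ipDl ?LtZ ?Lt_cst// ipZl ?Lt_cst// -/(mean theta) t1 mulr1.
  by rewrite -/(mean z) addNr.
have tpz := test_fun_prim tz' mz'.
exists (prim z') => //.
have hz' : nrm (h - z') <= e / 4.
  have -> : h - z' = (h - z) + mean z *: theta.
    by rewrite /z' scaleNr opprD opprK addrA addrAC.
  apply: (le_trans (nrmD hz2 (LtZ _ th2))); rewrite nrmZ//.
  apply: (@le_trans _ _ (nrm (h - z) * K)); last by rewrite -ler_pdivlMr.
  by rewrite /K mulrDr mulr1 lerD2l ler_wpM2r ?nrm_ge0.
apply: (le_lt_trans (H1norm_le _)).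
have -> : nrm (wd (f - prim z')) = nrm (h - z').
  apply: ae_eq_nrm; apply: ae_eq_trans (wd_sub hf (H1_test tpz)) _.
  by apply: aeS (wd_test tpz) => x E _; rewrite !fctE E// derive1_prim.
have -> : nrm (f - prim z') = nrm (prim (h - z')).
  apply: ae_eq_nrm; apply: aeS fc => x E _.
  by rewrite !fctE E// c0 add0r primB.
by apply: aux hz'; exact: nrm_prim_le.
Qed.

(** Both sides are continuous in psi for the H^1 norm, so the defining identity passes from test
    functions to their closure. *)
Lemma H10_weak_deriv f g psi : Lt f -> Lt g -> weak_deriv f g -> H10 R psi ->
  ip f (wd psi) = - ip g psi.
Proof.
move=> f2 g2 fg [hp Hp]; have p2 := H1_Lt hp; have dp2 := H1_Lt_wd hp.
apply/eqP; rewrite -subr_eq0 opprK -normr_le0; apply/ler_addgt0Pl => e e0; rewrite addr0.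
pose K := nrm f + nrm g + 1.
have K0 : 0 < K by rewrite ltr_wpDl// addr_ge0// nrm_ge0.
have [z tz hz] := Hp _ (divr_gt0 e0 K0).
have z2 := Lt_test tz; have dz2 := Lt_test (test_fun_derive1 tz).
have hd : wd (psi - z) = wd psi - derive1 z %[ae mu].
  apply: ae_eq_trans (wd_sub hp (H1_test tz)) _.
  by apply: aeS (wd_test tz) => x E _; rewrite !fctE E.
have := fg z tz; rewrite -!/(ip _ _) => E.
have -> : ip f (wd psi) + ip g psi = ip f (wd (psi - z)) + ip g (psi - z).
  by rewrite (ae_eq_ipr _ hd) !ipBr// E; ring.
have hpz := H1_sub hp (H1_test tz).
apply: (le_trans (ler_normD _ _)).
apply: (le_trans (lerD (cauchy_schwarz f2 (H1_Lt_wd hpz)) (cauchy_schwarz g2 (LtB p2 z2)))).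
have n1 := nrm_wd_le_H1norm (psi - z); have n2 := nrm_le_H1norm (psi - z).
move: hz; rewrite ltr_pdivlMr// => /ltW; apply: le_trans.
rewrite /K [leRHS]mulrC !mulrDl mul1r.
have := ler_wpM2l (@nrm_ge0 _ _ _ mu f) n1; have := ler_wpM2l (@nrm_ge0 _ _ _ mu g) n2.
have := H1norm_ge0 (psi - z); lra.
Qed.

End SobolevSpaces.

(** * The scalar energy identity and Gronwall's inequality *)

Section RealCalculus.
Variable R : realType.
Implicit Types (f F : R -> R).

Lemma is_derive_cvg f (x l : R) : is_derive x 1 f l -> {for x, continuous f}.
Proof. by move=> [df _]; apply: differentiable_continuous; apply/derivable1_diffP. Qed.

Lemma derive_within_continuous f (df : R -> R) (a b : R) :
  (forall x, a <= x <= b -> is_derive x 1 f (df x)) -> {within `[a, b], continuous f}.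
Proof.
move=> H; apply: derivable_within_continuous => x; rewrite in_itv/= => xab.
by have [] := H x xab.
Qed.

(** A first-order Taylor bound whose error is the oscillation M of the derivative around l; no
    second derivative is involved. *)
Lemma mvt_bound f (df : R -> R) (a b M l : R) : a <= b ->
  (forall x, a <= x <= b -> is_derive x 1 f (df x)) ->
  (forall x, a <= x <= b -> `|df x - l| <= M) ->
  `|f b - f a - l * (b - a)| <= M * (b - a).
Proof.
rewrite le_eqVlt => /predU1P[<-|ab] H B; first by rewrite !subrr !mulr0 subrr normr0.
have [c cab E] : exists2 c, c \in `]a, b[ & f b - f a = df c * (b - a).
  apply: MVT => //; last exact: derive_within_continuous H.
  by move=> x; rewrite in_itv/= => /andP[ax xb]; apply: H; rewrite !ltW.
rewrite E -mulrBl normrM (gtr0_norm (_ : 0 < b - a)) ?subr_gt0//.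
rewrite ler_wpM2r ?subr_ge0 ?(ltW ab)//; apply: B.
by move: cab; rewrite in_itv/= => /andP[ac cb]; rewrite !ltW.
Qed.

Lemma mvt_bound_sym f (df : R -> R) (x k M l : R) :
  (forall y, `|y - x| <= `|k| -> is_derive y 1 f (df y)) ->
  (forall y, `|y - x| <= `|k| -> `|df y - l| <= M) ->
  `|f (x + k) - f x - l * k| <= M * `|k|.
Proof.
move=> H B; have [k0|k0] := leP 0 k.
  rewrite (ger0_norm k0); have := @mvt_bound f df x (x + k) M l; rewrite lerDl => /(_ k0).
  rewrite [x + k - x]addrC addKr; apply => y /andP[xy yk]; [apply: H|apply: B];
    by rewrite (ger0_norm k0) ger0_norm ?subr_ge0// lerBlDl.
rewrite (ltr0_norm k0); have := @mvt_bound f df (x + k) x M l.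
rewrite gerDl ltW// opprD addrA subrr add0r => /(_ isT).
have -> : f x - f (x + k) - l * - k = - (f (x + k) - f x - l * k) by ring.
rewrite normrN; apply => y /andP[xy yk]; [apply: H|apply: B];
  by rewrite (ltr0_norm k0) ler0_norm ?subr_le0//; lra.
Qed.

(** It produces the function [B] of [energy_identity]. The lower limit -1 again keeps 0 away from
    the end of the interval. *)
Lemma antiderivative f : continuous f ->
  exists F : R -> R, forall x : R, 0 <= x -> is_derive x 1 F (f x).
Proof.
move=> cf; exists (fun x => \int[lebesgue_measure]_(t in `[-1, x]) f t) => x x0.
have fi : lebesgue_measure.-integrable `[-1, x + 1] (EFin \o f).
  by apply: continuous_compact_integrable; [exact: segment_compact|exact: continuous_subspaceT].
have x1 : x < x + 1 by rewrite ltrDl.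
have x1' : -1 < x by apply: lt_le_trans x0; rewrite ltrN10.
have [d1 d2] := @continuous_FTC1_closed R f (-1) x (x + 1) x1 fi x1' (cf x).
by rewrite -d2; exact: is_derive_derive1.
Qed.

Definition unit_itv (x : R) : Prop := 0 < x < 1.

Lemma unit_itv_near x : unit_itv x -> exists2 r, 0 < r & forall y, `|y - x| <= r -> unit_itv y.
Proof.
move=> /andP[x0 x1]; exists (Num.min (x / 2) ((1 - x) / 2)).
  by rewrite lt_min !divr_gt0// subr_gt0.
move=> y; rewrite le_min !ler_norml => /andP[/andP[h1 h2] /andP[h3 h4]].
by apply/andP; split; lra.
Qed.

(** Joint continuity on the open unit square, with perturbed points also confined to it: nothing is
    required of F elsewhere. *)
Definition cont2 (F : R -> R -> R) := forall s t, unit_itv s -> unit_itv t ->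
  forall e, 0 < e -> exists2 r, 0 < r & forall s' t', unit_itv s' -> unit_itv t' ->
    `|s' - s| <= r -> `|t' - t| <= r -> `|F s' t' - F s t| <= e.

(** Moving one coordinate at a time, the mean value bound controls each increment by the oscillation
    of one partial derivative, which joint continuity makes small. *)
Lemma dir_derive (P Ps Pt : R -> R -> R) (sigma tau alpha beta x : R) :
  cont2 Ps -> cont2 Pt ->
  (forall s t, unit_itv s -> unit_itv t -> is_derive s 1 (fun s => P s t) (Ps s t)) ->
  (forall s t, unit_itv s -> unit_itv t -> is_derive t 1 (P s) (Pt s t)) ->
  unit_itv (sigma * x + alpha) -> unit_itv (tau * x + beta) ->
  is_derive x 1 (fun r => P (sigma * r + alpha) (tau * r + beta))
    (sigma * Ps (sigma * x + alpha) (tau * x + beta) +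
     tau * Pt (sigma * x + alpha) (tau * x + beta)).
Proof.
move=> cs ct ds dt; set s0 := sigma * x + alpha; set t0 := tau * x + beta => us ut.
apply: is_derive_eps => e e0.
pose K := `|sigma| + `|tau| + 1.
have K0 : 0 < K by rewrite ltr_wpDl// addr_ge0.
have sK : `|sigma| <= K by rewrite /K -addrA lerDl addr_ge0.
have tK : `|tau| <= K by have := normr_ge0 sigma; rewrite /K; lra.
have e10 : 0 < e / K by rewrite divr_gt0.
have [r1 r10 h1] := cs _ _ us ut _ e10.
have [r2 r20 h2] := ct _ _ us ut _ e10.
have [r3 r30 h3] := unit_itv_near us.
have [r4 r40 h4] := unit_itv_near ut.
pose r := Num.min (Num.min r1 r2) (Num.min r3 r4).
have r0 : 0 < r by rewrite !lt_min r10 r20 r30.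
have rr y : y <= r -> [/\ y <= r1, y <= r2, y <= r3 & y <= r4].
  by rewrite !le_min => /andP[/andP[-> ->] /andP[-> ->]].
exists (r / K); first by rewrite divr_gt0.
move=> h h0 hr.
have hK : `|h| * K <= r by rewrite -ler_pdivlMr// ltW.
have sh : `|sigma * h| <= r by rewrite normrM mulrC; apply: le_trans hK; rewrite ler_wpM2l.
have th : `|tau * h| <= r by rewrite normrM mulrC; apply: le_trans hK; rewrite ler_wpM2l.
have [th1 th2 th3 th4] := rr _ th; have [sh1 sh2 sh3 sh4] := rr _ sh.
have uth : unit_itv (t0 + tau * h) by apply: h4; rewrite addrAC subrr add0r.
have inS y : `|y - s0| <= `|sigma * h| -> unit_itv y.
  by move=> yh; apply: h3; exact: le_trans yh _.
have inT y : `|y - t0| <= `|tau * h| -> unit_itv y.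
  by move=> yh; apply: h4; exact: le_trans yh _.
have B1 : `|P (s0 + sigma * h) (t0 + tau * h) - P s0 (t0 + tau * h) - Ps s0 t0 * (sigma * h)|
    <= e / K * `|sigma * h|.
  apply: (@mvt_bound_sym (fun s => P s (t0 + tau * h)) (fun s => Ps s (t0 + tau * h))) => y yh.
    by apply: ds => //; exact: inS.
  by apply: h1 => //; [exact: inS|exact: le_trans yh _|rewrite addrAC subrr add0r].
have B2 : `|P s0 (t0 + tau * h) - P s0 t0 - Pt s0 t0 * (tau * h)| <= e / K * `|tau * h|.
  apply: (@mvt_bound_sym (P s0) (Pt s0)) => y yh; first by apply: dt => //; exact: inT.
  by apply: h2 => //; [exact: inT|rewrite subrr normr0 ltW|exact: le_trans yh _].
have Es : sigma * (x + h) + alpha = s0 + sigma * h by rewrite /s0; ring.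
have Et : tau * (x + h) + beta = t0 + tau * h by rewrite /t0; ring.
rewrite Es Et.
have -> : h^-1 * (P (s0 + sigma * h) (t0 + tau * h) - P s0 t0) - (sigma * Ps s0 t0 + tau * Pt s0 t0)
  = h^-1 * ((P (s0 + sigma * h) (t0 + tau * h) - P s0 (t0 + tau * h) - Ps s0 t0 * (sigma * h)) +
            (P s0 (t0 + tau * h) - P s0 t0 - Pt s0 t0 * (tau * h))) by field.
have hn : 0 < `|h| by rewrite normr_gt0.
rewrite normrM normfV ler_pdivrMl//.
apply: (le_trans (ler_normD _ _)); apply: (le_trans (lerD B1 B2)).
rewrite !normrM.
have -> : e / K * (`|sigma| * `|h|) + e / K * (`|tau| * `|h|) = `|h| * (e / K * (`|sigma| + `|tau|)) by ring.
rewrite ler_pM2l// mulrAC ler_pdivrMr//.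
by rewrite ler_pM2l// /K lerDl.
Qed.

(* With p(s,t) = <w'(s),w(t)>, a = <w_y(s),w_y(t)>, b = <f(s),w(t)>, c = <f(s),w'(t)>,
   d = <w'(s),w'(t)> this is the energy identity for w'' - w_yy + f = 0: the
   function p(x+h,x-h) - p(x-h,x+h) has x-derivative b(x-h,x+h) - b(x+h,x-h),
   where the unbounded term a has cancelled; dividing by h and letting h tend
   to 0 yields the identity without differentiating w' or w_y. *)
Lemma energy_identity (p a b c d : R -> R -> R) (B : R -> R) :
  cont2 a -> cont2 b -> cont2 c -> cont2 d ->
  (forall s t, a s t = a t s) -> (forall s t, d s t = d t s) ->
  (forall s t, unit_itv s -> unit_itv t ->
    is_derive s 1 (fun s => p s t) (- a s t - b s t)) ->
  (forall s t, unit_itv s -> unit_itv t -> is_derive t 1 (p s) (d s t)) ->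
  (forall s t, unit_itv s -> unit_itv t -> is_derive t 1 (b s) (c s t)) ->
  (forall s, unit_itv s -> is_derive s 1 B (b s s)) ->
  forall x, unit_itv x -> is_derive x 1 (fun x => a x x + d x x) (- (2 * c x x)).
Proof.
move=> ca cb cc cd sa sd dps dpt db dB x ux.
have cab : cont2 (fun s t => - a s t - b s t).
  move=> s t us ut e e0; have e20 : 0 < e / 2 by rewrite divr_gt0.
  have [r1 r10 h1] := ca _ _ us ut _ e20.
  have [r2 r20 h2] := cb _ _ us ut _ e20.
  exists (Num.min r1 r2); first by rewrite lt_min r10.
  move=> s' t' us' ut'; rewrite !le_min => /andP[s1 s2] /andP[t1 t2].
  have -> : - a s' t' - b s' t' - (- a s t - b s t) = - ((a s' t' - a s t) + (b s' t' - b s t)) by ring.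
  rewrite normrN (le_trans (ler_normD _ _))// [e]splitr lerD//; [exact: h1|exact: h2].
apply: is_derive_eps => e e0.
have [r0 r00 hr0] := unit_itv_near ux.
have e40 : 0 < e / 4 by rewrite divr_gt0.
have [rc rc0 hrc] := cc _ _ ux ux _ e40.
pose r := Num.min r0 rc / 2.
have rp : 0 < r by rewrite divr_gt0// lt_min r00.
have r2 : r + r = Num.min r0 rc by rewrite -splitr.
have r2r0 : r + r <= r0 by rewrite r2 ge_min lexx.
have r2rc : r + r <= rc by rewrite r2 ge_min lexx orbT.
exists r => // k k0 kr.
pose T h y := p (y + h) (y - h) - p (y - h) (y + h).
(* Only the second variable of b can be differentiated. The [B] terms complete the derivative of
   [T h] to b(y+h,y+h) - b(y+h,y-h) + b(y-h,y+h) - b(y-h,y-h), a sum of increments in that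
   variable. *)
pose W h y := h^-1 * (T h y + (B (y + h) - B (y - h))).
have uin y : `|y - x| <= r + r -> unit_itv y.
  by move=> yr; apply: hr0; exact: le_trans yr _.
have sft y h : `|y - x| <= `|k| -> 0 < h < r -> `|y + h - x| <= r + r /\ `|y - h - x| <= r + r.
  move=> yk /andP[h0 hr]; have yr : `|y - x| <= r by apply: le_trans yk (ltW kr).
  by move: yr; rewrite !ler_norml => /andP[y1 y2]; split; apply/andP; split; lra.
have dW h y : 0 < h < r -> `|y - x| <= `|k| ->
  is_derive y 1 (W h) (h^-1 * (b (y - h) (y + h) - b (y + h) (y - h) + (b (y + h) (y + h) - b (y - h) (y - h)))).
  move=> hh yk; have [/uin u1 /uin u2] := sft y h yk hh.
  apply: is_derive_scale; apply: is_derive_add.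
    have d1 := @dir_derive p _ _ 1 1 h (- h) y cab cd dps dpt.
    have d2 := @dir_derive p _ _ 1 1 (- h) h y cab cd dps dpt.
    rewrite !mul1r in d1 d2.
    have := is_derive_add (d1 u1 u2) (is_derive_scale (-1) (d2 u2 u1)).
    rewrite (_ : (fun t => _) = T h); last first.
      by apply/funext => t; rewrite /T !mul1r mulN1r.
    apply: is_derive_congr.
    by rewrite (sa (y - h)) (sd (y - h)); ring.
  have dBa := @is_derive_chain R B (fun t => 1 * t + h) y _ _.
  have dBb := @is_derive_chain R B (fun t => 1 * t - h) y _ _.
  rewrite mul1r in dBa; rewrite mul1r in dBb.
  have := is_derive_add (dBa _ _ (dB _ u1) (is_derive_affine 1 h y))
    (is_derive_scale (-1) (dBb _ _ (dB _ u2) (is_derive_affine 1 (-h) y))).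
  rewrite (_ : (fun t => _) = (fun t => B (t + h) - B (t - h))); last first.
    by apply/funext => t; rewrite !mul1r mulN1r.
  by apply: is_derive_congr; ring.
(* Each of the two increments of b runs over a length 2h and equals 2h c(x,x) up to 2h e/4; after
   division by h the slope is 4 c(x,x) up to e, uniformly in h. *)
have bW h : 0 < h < r -> `|W h (x + k) - W h x - 4 * c x x * k| <= e * `|k|.
  move=> hh; have /andP[h0 hr] := hh; apply: mvt_bound_sym => y yk; first exact: dW.
  have [v1 v2] := sft y h yk hh.
  have inb s t : `|s - x| <= r + r -> `|t - (y - h)| <= `|h + h| -> 0 <= t - (y - h) -> unit_itv t /\ `|c s t - c x x| <= e / 4.
    move=> sr; rewrite (gtr0_norm (addr_gt0 h0 h0)) ler_norml => /andP[t1 t2] t3.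
    have tr : `|t - x| <= r + r.
      move: v1 v2; rewrite !ler_norml => /andP[v3 v4] /andP[v5 v6]; apply/andP; split; lra.
    split; first exact: uin.
    by apply: hrc; [exact: uin|exact: uin|exact: le_trans sr _|exact: le_trans tr _].
  have half s : `|s - x| <= r + r -> `|b s (y + h) - b s (y - h) - c x x * (h + h)| <= e / 4 * (h + h).
    move=> sr.
    have yh : y - h <= y + h by lra.
    have -> : h + h = y + h - (y - h) by ring.
    apply: (@mvt_bound (b s) (c s)) => // t /andP[t1 t2]; have := inb s t sr _ _.
      rewrite ler_norml gtr0_norm ?addr_gt0// subr_ge0 => /(_ _ t1)[]; first by apply/andP; split; lra.
      by move=> ut _; apply: db => //; exact: uin.
    rewrite ler_norml gtr0_norm ?addr_gt0// subr_ge0 => /(_ _ t1)[]//; apply/andP; split; lra.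
  have H1 := half _ v1; have H2 := half _ v2.
  rewrite -[X in `|X|](_ : h^-1 * ((b (y + h) (y + h) - b (y + h) (y - h) - c x x * (h + h)) +
     (b (y - h) (y + h) - b (y - h) (y - h) - c x x * (h + h))) = _); last first.
    by field; rewrite gt_eqF.
  rewrite normrM normfV (gtr0_norm h0) ler_pdivrMl//.
  apply: le_trans (ler_normD _ _) _; apply: le_trans (lerD H1 H2) _.
  by rewrite le_eqVlt; apply/orP; left; apply/eqP; field.
(* As h tends to 0, the quotient tends to 2(p_s - p_t) + 2b = -2(a + d) on the diagonal: the terms
   in b cancel. *)
have lW y : unit_itv y -> forall e1, 0 < e1 -> exists2 r1, 0 < r1 & forall h, 0 < h < r1 ->
    `|W h y + 2 * (a y y + d y y)| <= e1.
  move=> uy e1 e10.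
  have u0 : unit_itv (1 * 0 + y) by rewrite mulr0 add0r.
  have u0' : unit_itv (-1 * 0 + y) by rewrite mulr0 add0r.
  have d1 := @dir_derive p _ _ 1 (-1) y y 0 cab cd dps dpt u0 u0'.
  have d2 := @dir_derive p _ _ (-1) 1 y y 0 cab cd dps dpt u0' u0.
  have dBa := @is_derive_chain R B (fun t => 1 * t + y) 0 (b y y) _.
  have dBb := @is_derive_chain R B (fun t => -1 * t + y) 0 (b y y) _.
  rewrite mulr0 add0r in dBa; rewrite mulr0 add0r in dBb.
  have D := is_derive_add (is_derive_add d1 (is_derive_scale (-1) d2))
    (is_derive_add (dBa _ (dB _ uy) (is_derive_affine 1 y 0))
      (is_derive_scale (-1) (dBb _ (dB _ uy) (is_derive_affine (-1) y 0)))).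
  have [r1 r10 h1] := is_derive_epsP D e10.
  exists r1 => // h /andP[h0 hr1].
  have := h1 h; rewrite (gtr0_norm h0) gt_eqF// => /(_ isT hr1).
  rewrite !mulr0 !add0r !mul1r !mulN1r /W /T ![h + y]addrC ![- h + y]addrC.
  congr (_ <= _); congr `|_|.
  by set A1 := p _ _; set A2 := p _ _; set A3 := B _; set A4 := B _; ring.
have hk : 0 < `|k| by rewrite normr_gt0.
have uxk : unit_itv (x + k).
  by apply: uin; rewrite addrAC subrr add0r; apply: le_trans (ltW kr) _; rewrite lerDl ltW.
(* The increment k is fixed while h tends to 0 in [bW], with the limit [lW] taken at x and at x +
   k. *)
have main : `|2 * (a (x + k) (x + k) + d (x + k) (x + k)) - 2 * (a x x + d x x) + 4 * c x x * k| <= e * `|k|.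
  apply/ler_addgt0Pr => e1 e10; have e20 : 0 < e1 / 2 by rewrite divr_gt0.
  have [r1 r10 l1] := lW _ uxk _ e20; have [r3 r30 l3] := lW _ ux _ e20.
  pose h := Num.min r (Num.min r1 r3) / 2.
  have h0 : 0 < h by rewrite divr_gt0// !lt_min rp r10.
  have hm : h < Num.min r (Num.min r1 r3) by rewrite ltr_pdivrMr// ltr_pMr ?ltr1n// !lt_min rp r10.
  move: (hm); rewrite !lt_min => /andP[hr /andP[hr1 hr3]].
  have B1 := l1 h; rewrite h0 hr1 in B1; have {}B1 := B1 isT.
  have B3 := l3 h; rewrite h0 hr3 in B3; have {}B3 := B3 isT.
  have B2 := bW h; rewrite h0 hr in B2; have {}B2 := B2 isT.
  move: B1 B2 B3; rewrite !ler_norml => /andP[? ?] /andP[? ?] /andP[? ?].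
  by apply/andP; split; lra.
rewrite opprK -(@ler_pM2l _ (2 * `|k|)) ?mulr_gt0//.
rewrite -[2 * `|k|](@gtr0_norm _ _) ?mulr_gt0// normrM normr_id -!normrM.
have -> : 2 * k * (k^-1 * (a (x + k) (x + k) + d (x + k) (x + k) - (a x x + d x x)) + 2 * c x x) =
  2 * (a (x + k) (x + k) + d (x + k) (x + k)) - 2 * (a x x + d x x) + 4 * c x x * k by field.
apply: (le_trans main); rewrite normrM (gtr0_norm (_ : 0 < 2))// mulrC.
by rewrite ler_wpM2r ?(ltW e0)//; lra.
Qed.

(** The function exp(-K t) E(t) - G t is nonincreasing. Bounding exp(-K t) G by G is what leaves the
    plain term G x in the estimate. *)
Lemma gronwall (E dE : R -> R) (K G : R) : 0 <= K -> 0 <= G ->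
  {within `[0, 1], continuous E} ->
  (forall x, unit_itv x -> is_derive x 1 E (dE x)) ->
  (forall x, unit_itv x -> dE x <= K * E x + G) ->
  forall x, 0 <= x <= 1 -> E x <= (E 0 + G * x) * expR (K * x).
Proof.
move=> K0 G0 cE dEE bE x /andP[x0 x1].
have [->|xn0] := eqVneq x 0; first by rewrite !mulr0 addr0 expR0 mulr1.
have xp : 0 < x by rewrite lt_neqAle eq_sym xn0.
pose Y t := expR (- K * t) * E t - G * t.
have dexp (t : R) : is_derive t 1 (fun t => expR (- K * t)) (expR (- K * t) * - K).
  apply: (@is_derive_chain R expR (fun t => - K * t)).
  by have := is_derive_affine (- K) 0 t; under eq_fun do rewrite addr0.
have [c c01 EY] : exists2 c, c \in `]0, x[ &
   Y x - Y 0 = (expR (- K * c) * - K * E c + expR (- K * c) * dE c - G) * (x - 0).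
  apply: (@MVT _ Y (fun c => expR (- K * c) * - K * E c + expR (- K * c) * dE c - G) 0 x xp).
    move=> t; rewrite in_itv/= => /andP[t0 tx].
    have ut : unit_itv t by rewrite /unit_itv t0 (lt_le_trans tx).
    have := is_derive_add (is_derive_mul (dexp t) (dEE t ut)) (is_derive_affine (- G) 0 t).
    rewrite (_ : (fun t => _) = Y)//; apply/funext => z.
    by rewrite /Y addr0 (mulNr G).
  have cE' : {within `[0, x], continuous E}.
    by apply: continuous_subspaceW cE; apply: subset_itvl; rewrite bnd_simp.
  have ce : {within `[0, x], continuous (fun t => expR (- K * t))}.
    by apply: (@continuous_subspaceT _ _ _ (fun t => expR (- K * t))) => z; exact: is_derive_cvg (dexp z).
  have cG : {within `[0, x], continuous (fun t : R => G * t)}.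
    apply: (@continuous_subspaceT _ _ _ (fun t : R => G * t)) => z.
    exact: is_derive_cvg (is_derive_scale G (is_derive_id z 1)).
  by move=> t; apply: cvgB; [apply: cvgM; [exact: ce|exact: cE']|exact: cG].
have : Y x <= Y 0.
  rewrite -subr_le0 EY subr0 mulr_le0_ge0 ?(ltW xp)//.
  move: c01; rewrite in_itv/= => /andP[c0 cx].
  have uc : unit_itv c by rewrite /unit_itv c0 (lt_le_trans cx).
  have := bE c uc => bc.
  have e1 : expR (- K * c) <= 1.
    by rewrite -expR0 ler_expR mulNr oppr_le0 mulr_ge0// ltW.
  have eG : expR (- K * c) * (dE c - K * E c) <= G.
    apply: (@le_trans _ _ (expR (- K * c) * G)).
      by rewrite ler_wpM2l ?expR_ge0// lerBlDl.
    by rewrite ler_piMl.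
  rewrite subr_le0; apply: le_trans eG; rewrite le_eqVlt; apply/orP; left; apply/eqP; ring.
rewrite /Y !mulr0 expR0 mul1r subr0 lerBlDr => h.
rewrite -ler_pdivrMr ?expR_gt0// -expRN -mulNr mulrC.
exact: h.
Qed.

End RealCalculus.

(** * Continuous functions with values in L^2(0,1) *)

Section ValuedFunctions.
Variable R : realType.
Implicit Types (u v w : R -> R -> R) (phi psi : R -> R).
Notation mu := (mu01 R).
Notation leb := (@lebesgue_measure R).
Notation mT := (measurableTypeR R).
Local Notation Lt f := (f \in Lfun mu 2%:E).
Local Notation ip := (@l2dot _ mT R mu).
Local Notation nrm := (@l2nrm _ mT R mu).
Local Notation aeS2 := (@ae_mono2 _ mT R mu).

(** The retraction onto [0,1]. Composing with it turns curves controlled on [0,1] only into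
    functions continuous on the whole line, as the lemmas on weak derivatives require. *)
Definition clamp (x : R) : R := Num.max 0 (Num.min 1 x).

Lemma clamp_in x : clamp x \in `[0, 1].
Proof.
rewrite in_itv/= /clamp le_max lexx/= ge_max ler01/=.
by rewrite ge_min lexx.
Qed.

Lemma clamp_id x : x \in `[0, 1] -> clamp x = x.
Proof. by rewrite in_itv/= => /andP[x0 x1]; rewrite /clamp min_r// max_r. Qed.

Lemma clamp_lip x y : `|clamp x - clamp y| <= `|x - y|.
Proof.
wlog xy : x y / y <= x.
  move=> H; have [yx|xy] := leP y x; first exact: H.
  by rewrite distrC [leRHS]distrC; apply: H; exact: ltW.
rewrite [leRHS]ger0_norm ?subr_ge0// /clamp.
case: (leP 1 x) => h1; case: (leP 1 y) => h2; case: (leP 0 x) => h3; case: (leP 0 y) => h4;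
  rewrite ?(max_r ler01) ?subrr ?normr0 ?subr_ge0// ?ler_norml; try (apply/andP; split); lra.
Qed.

Lemma unit_itv_in (x : R) : unit_itv x -> x \in `[0, 1].
Proof. by move=> /andP[x0 x1]; rewrite in_itv/= !ltW. Qed.

(** A single notion of continuity for u, u_y, u_x, P u and Q u, whichever space their continuity
    comes from. *)
Definition cont_L2 v := (forall x, x \in `[0, 1] -> Lt (v x)) /\
  forall x, x \in `[0, 1] -> forall e, 0 < e -> exists2 r, 0 < r &
    forall t, t \in `[0, 1] -> `|t - x| < r -> nrm (v t - v x) <= e.

Lemma C01_eps (V : fspace R) u x : C01 V u -> x \in `[0, 1] -> forall e, 0 < e ->
  exists2 r, 0 < r & forall t, t \in `[0, 1] -> `|t - x| < r -> fnorm V (u t - u x) <= e.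
Proof.
move=> [_ cu] x01 e e0; have [r r0 hr] := within01_eps (cu x x01) e0.
exists r => // t t01 tx; have := hr t t01 tx; rewrite subr0; apply: le_trans.
exact: ler_norm.
Qed.

Lemma C01_cont_L2 v : C01 (L2 R) v -> cont_L2 v.
Proof. by move=> cv; split; [case: cv|move=> x x01 e e0; exact: (@C01_eps (L2 R))]. Qed.

Lemma C01_H10_cont_L2 u : C01 (H10 R) u -> cont_L2 u.
Proof.
move=> cu; have [uV _] := cu; split; first by move=> x /uV /H10_H1 /H1_Lt.
move=> x x01 e e0; have [r r0 hr] := C01_eps cu x01 e0.
by exists r => // t t01 tx; apply: le_trans (nrm_le_H1norm _) (hr t t01 tx).
Qed.

Lemma C01_H10_cont_wd u : C01 (H10 R) u -> cont_L2 (fun x => wd (u x)).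
Proof.
move=> cu; have [uV _] := cu; split; first by move=> x /uV /H10_H1 /H1_Lt_wd.
move=> x x01 e e0; have [r r0 hr] := C01_eps cu x01 e0.
exists r => // t t01 tx; apply: le_trans (hr t t01 tx).
apply: le_trans (nrm_wd_le_H1norm _); rewrite (ae_eq_nrm (wd_sub _ _))//; exact/H10_H1/uV.
Qed.

Lemma cont_L2_cst psi : Lt psi -> cont_L2 (fun=> psi).
Proof.
move=> p2; split => // x x01 e e0; exists 1; first exact: ltr01.
by move=> t _ _; rewrite subrr nrm0 ltW.
Qed.

Lemma cont_L2_ae v w : (forall x, x \in `[0, 1] -> Lt (w x)) ->
  (forall x, x \in `[0, 1] -> v x = w x %[ae mu]) -> cont_L2 v -> cont_L2 w.
Proof.
move=> w2 vw [v2 cv]; split => // x x01 e e0; have [r r0 hr] := cv x x01 e e0.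
exists r => // t t01 tx; rewrite -(@ae_eq_nrm _ _ _ mu (v t - v x)); first exact: hr.
by apply: aeS2 (vw t t01) (vw x x01) => y h1 h2 _; rewrite !fctE h1// h2.
Qed.

Lemma cont_L2_lin a v w : cont_L2 v -> cont_L2 w -> cont_L2 (fun x => a *: v x + w x).
Proof.
move=> [v2 cv] [w2 cw]; split.
  by move=> x x01; apply: LtD; [apply: LtZ; exact: v2|exact: w2].
move=> x x01 e e0; have a1 : 0 < `|a| + 1 by rewrite ltr_wpDl.
have [r1 r10 h1] := cv x x01 _ (divr_gt0 (divr_gt0 e0 (ltr0Sn R 1)) a1).
have [r2 r20 h2] := cw x x01 _ (divr_gt0 e0 (ltr0Sn R 1)).
exists (Num.min r1 r2); first by rewrite lt_min r10.
move=> t t01; rewrite lt_min => /andP[t1 t2].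
have -> : a *: v t + w t - (a *: v x + w x) = a *: (v t - v x) + (w t - w x).
  by rewrite scalerBr opprD addrACA.
have vtx := LtB (v2 t t01) (v2 x x01); have wtx := LtB (w2 t t01) (w2 x x01).
apply: le_trans (nrmD (LtZ a vtx) wtx) _; rewrite nrmZ// [e]splitr lerD//; last exact: h2.
have := h1 t t01 t1; rewrite ler_pdivlMr//; apply: le_trans.
by rewrite mulrC ler_wpM2l ?nrm_ge0// lerDl.
Qed.

Lemma cont_L2_sub v w : cont_L2 v -> cont_L2 w -> cont_L2 (fun x => v x - w x).
Proof.
move=> cv cw; have := cont_L2_lin (-1) cw cv.
by rewrite (_ : (fun x => -1 *: w x + v x) = (fun x => v x - w x))//; apply/funext => x; rewrite fun_subE.
Qed.

Lemma cont_L2_ip v w s t : cont_L2 v -> cont_L2 w -> s \in `[0, 1] -> t \in `[0, 1] ->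
  forall e, 0 < e -> exists2 r, 0 < r & forall s' t', s' \in `[0, 1] -> t' \in `[0, 1] ->
    `|s' - s| < r -> `|t' - t| < r -> `|ip (v s') (w t') - ip (v s) (w t)| <= e.
Proof.
move=> [v2 cv] [w2 cw] s01 t01 e e0.
pose K := nrm (v s) + nrm (w t) + 1.
have K0 : 0 < K by rewrite ltr_wpDl// addr_ge0// nrm_ge0.
(* The bound 1 keeps |w(t')| below |w(t)| + 1; the other bound makes each of the two error terms at
   most e/2. *)
have e1 : 0 < Num.min 1 (e / 2 / K) by rewrite lt_min ltr01 !divr_gt0.
have [r1 r10 h1] := cv s s01 _ e1; have [r2 r20 h2] := cw t t01 _ e1.
exists (Num.min r1 r2); first by rewrite lt_min r10.
move=> s' t' s'01 t'01; rewrite !lt_min => /andP[s1 _] /andP[_ t2].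
have := h1 s' s'01 s1; have := h2 t' t'01 t2; rewrite !le_min !ler_pdivlMr//.
set A := nrm _; set B := nrm _ => /andP[A1 AK] /andP[B1 BK].
have vs := LtB (v2 s' s'01) (v2 s s01); have wt := LtB (w2 t' t'01) (w2 t t01).
have -> : ip (v s') (w t') - ip (v s) (w t) = ip (v s' - v s) (w t') + ip (v s) (w t' - w t).
  by rewrite ipBl ?ipBr ?v2 ?w2//; ring.
apply: le_trans (ler_normD _ _) _.
apply: le_trans (lerD (cauchy_schwarz vs (w2 t' t'01)) (cauchy_schwarz (v2 s s01) wt)) _.
rewrite -/A -/B.
have wt' : nrm (w t') <= nrm (w t) + 1.
  have := nrm_dist (w2 t' t'01) (w2 t t01); rewrite -/A ler_norml => /andP[_]; lra.
have A0 : 0 <= A by exact: nrm_ge0.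
have B0 : 0 <= B by exact: nrm_ge0.
have := ler_wpM2l B0 wt'; have := @nrm_ge0 _ _ _ mu (v s); have := @nrm_ge0 _ _ _ mu (w t).
move: AK BK; rewrite /K; set a := l2nrm _ _; set b := l2nrm _ _; set c := l2nrm _ _.
move=> AK BK ? ? ?.
have : 0 <= A * b by rewrite mulr_ge0.
have : 0 <= B * a by rewrite mulr_ge0.
nra.
Qed.

Lemma cont2_ip v w : cont_L2 v -> cont_L2 w -> cont2 (fun s t => ip (v s) (w t)).
Proof.
move=> cv cw s t us ut e e0.
have [r r0 hr] := cont_L2_ip cv cw (unit_itv_in us) (unit_itv_in ut) e0.
exists (r / 2); first by rewrite divr_gt0.
move=> s' t' us' ut' s1 t1.
by apply: hr; try exact: unit_itv_in; lra.
Qed.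

Lemma clamp_ip_continuous v w : cont_L2 v -> cont_L2 w ->
  continuous (fun x => ip (v (clamp x)) (w (clamp x))).
Proof.
move=> cv cw x; apply/cvgrPdist_le => e e0.
have [r r0 hr] := cont_L2_ip cv cw (clamp_in x) (clamp_in x) e0.
exists r => //= t; rewrite /ball_/= distrC => tx; rewrite distrC.
by apply: hr; rewrite ?clamp_in// (le_lt_trans (clamp_lip _ _)).
Qed.

Lemma within_ip_continuous v w : cont_L2 v -> cont_L2 w ->
  {within `[0, 1], continuous (fun x => ip (v x) (w x))}.
Proof.
move=> cv cw.
have h : {within `[0, 1], continuous (fun x => ip (v (clamp x)) (w (clamp x)))}.
  exact: continuous_subspaceT (clamp_ip_continuous cv cw).
apply: subspace_eq_continuous h => x; rewrite inE/= => x01.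
by rewrite /from_subspace/= clamp_id.
Qed.

Lemma ae_clamp (F : R -> R) : (fun x => F (clamp x)) = F %[ae mu].
Proof. by apply: mu01_ae => x ux _; rewrite clamp_id//; exact: unit_itv_in. Qed.

Lemma mean_ray (x : R) : 0 <= x <= 1 -> mean (ray x) = x.
Proof.
move=> /andP[x0 x1]; rewrite meanE Rintegral_mu01 /Rintegral integral_indic//.
pose A : set mT := `]-oo, x]%classic; pose B : set mT := `]0, 1[%classic.
rewrite -/A -/B; have -> : fine (leb (A `&` B)) = fine (leb (`]0, x[)).
  have [x1'|] := ltP x 1; last first.
    move=> xx1; have -> : x = 1 by apply/eqP; rewrite eq_le x1.
    rewrite /A /B; congr (fine (leb _)); apply/seteqP; split => y /=; rewrite !in_itv/=.
      by case.
    by move=> /andP[y0 y1]; split; [exact: ltW (lt_le_trans y1 xx1)|rewrite y0].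
  have -> : leb (`]0, x[) = leb (`]0, x]) by rewrite !lebesgue_measure_itv.
  rewrite /A /B; congr (fine (leb _)); apply/seteqP; split => y /=; rewrite !in_itv/=.
    by move=> [yx /andP[y0 _]]; rewrite y0 yx.
  by move=> /andP[y0 yx]; rewrite yx y0 (le_lt_trans yx).
rewrite lebesgue_measure_itv/= lte_fin; case: ltP => [|x0']; first by rewrite oppr0 adde0.
by apply/eqP; rewrite eq_le x0 x0'.
Qed.

(** Unlike for test functions, q need not vanish at 0 and 1, where the primitive may have corners;
    hence the restriction to interior points. *)
Lemma is_derive_prim_continuous (q : R -> R) (x : R) : continuous q -> unit_itv x ->
  is_derive x 1 (prim q) (q x).
Proof.
move=> cq ux; have q2 := continuous_Lt cq.
apply: is_derive_eps => e e0.
have /cvgrPdist_le/(_ _ e0)[r1 /= r10 hr1] := cq x.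
have [r2 r20 hr2] := unit_itv_near ux.
exists (Num.min r1 r2); first by rewrite lt_min r10.
move=> h h0; rewrite lt_min => /andP[hr hr'].
have uxh : unit_itv (x + h) by apply: hr2; rewrite addrAC subrr add0r ltW.
have key y z : unit_itv y -> unit_itv z -> y <= z -> (forall t, y <= t <= z -> `|q t - q x| <= e) ->
    `|prim q z - prim q y - q x * (z - y)| <= e * (z - y).
  move=> uy uz yz qe.
  have E (c : R) : c * (z - y) = ip (ray z - ray y) (cst c).
    have -> : (cst c : R -> R) = c *: cst 1 by apply/funext => t; rewrite -[RHS]/(c * 1) mulr1.
    rewrite ipZr ?ipBl ?LtB ?Lt_ray ?Lt_cst// -!/(mean _) !mean_ray//.
      by case/andP: uy => *; rewrite !ltW.
    by case/andP: uz => *; rewrite !ltW.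
  rewrite !E /prim -ipBl ?Lt_ray// -ipBr ?Lt_cst ?LtB ?Lt_ray//.
  have r2' := LtB (Lt_ray z) (Lt_ray y).
  have i1 : mu.-integrable setT (EFin \o (fun t => (ray z - ray y) t * (q - cst (q x)) t)).
    by apply: Lt_mul_integrable => //; apply: LtB => //; exact: Lt_cst.
  have i2 : mu.-integrable setT (EFin \o (fun t => (ray z - ray y) t * cst e t)).
    by apply: Lt_mul_integrable => //; exact: Lt_cst.
  apply: le_trans (@le_normr_Rintegral _ mT R mu setT _ measurableT i1) _.
  apply: (@le_Rintegral _ mT R mu) => //.
    by have := integrable_norm i1.
  move=> t _; rewrite normrM !fctE !rayE /cst.
  have [tz|tz] := leP t z; have [ty|ty] := leP t y => /=;
    rewrite ?subrr ?normr0 ?mul0r ?subr0 ?normr1 ?mul1r//.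
    by apply: qe; rewrite tz ltW.
  by move: (le_lt_trans ty (le_lt_trans yz tz)); rewrite ltxx.
have qe t : `|t - x| <= `|h| -> `|q t - q x| <= e.
  by move=> th; rewrite distrC; apply: hr1 => /=; rewrite distrC (le_lt_trans th).
have -> : h^-1 * (prim q (x + h) - prim q x) - q x = h^-1 * (prim q (x + h) - prim q x - q x * h) by field.
have hn : 0 < `|h| by rewrite normr_gt0.
rewrite normrM normfV ler_pdivrMl// [leRHS]mulrC.
have [hp|hp] := leP 0 h.
  have := key x (x + h) ux uxh; rewrite lerDl [x + h - x]addrAC subrr add0r (ger0_norm hp); apply => // t /andP[t1 t2].
  by apply: qe; rewrite (ger0_norm hp) ger0_norm; lra.
have := key (x + h) x uxh ux; rewrite gerDl (ltW hp) opprD addrA subrr add0r (ltr0_norm hp).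
have -> : prim q x - prim q (x + h) - q x * - h = - (prim q (x + h) - prim q x - q x * h) by ring.
rewrite normrN; apply => // t /andP[t1 t2].
by apply: qe; rewrite (ltr0_norm hp) ler0_norm; lra.
Qed.

(** By du Bois-Reymond p - [prim q] is constant a.e., hence everywhere on [0,1] by continuity.
    Distributional equations in x become classical derivatives here. *)
Lemma weak_deriv_is_derive (p q : R -> R) (x : R) : continuous p -> continuous q -> weak_deriv p q ->
  unit_itv x -> is_derive x 1 p (q x).
Proof.
move=> cp cq pq ux; have p2 := continuous_Lt cp; have q2 := continuous_Lt cq.
have pr2 := Lt_prim q2.
have [c hc] : exists c : R, p - prim q = cst c %[ae mu].
  apply: du_bois_reymond; first exact: LtB.
  move=> Z tZ; have dZ2 := Lt_test (test_fun_derive1 tZ).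
  have := pq Z tZ; have := weak_deriv_prim q2 tZ.
  by rewrite -!/(ip _ _) => E1 E2; rewrite ipBl// E1 E2 subrr.
have cpr : continuous (p - prim q).
  by move=> y; apply: cvgB; [exact: cp|exact: prim_continuous].
have E y : unit_itv y -> p y = c + prim q y.
  move=> /unit_itv_in y01.
  have : (p - prim q) y = cst c y.
    apply: within_ae_eq => //; first exact: continuous_subspaceT.
    by apply: continuous_subspaceT; exact: cst_continuous.
  by rewrite !fctE /cst => <-; rewrite subrK.
have := is_derive_add (is_derive_cst c x 1) (is_derive_prim_continuous cq ux).
rewrite add0r; apply: near_eq_is_derive.
have [r r0 hr] := unit_itv_near ux.
exists r => //= y; rewrite /ball_/= distrC => yx; apply/esym; apply: E.
by apply: hr; exact: ltW.
Qed.

Lemma is_derive_weak_deriv (p q : R -> R) : continuous p -> continuous q ->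
  (forall x : R, unit_itv x -> is_derive x 1 p (q x)) -> weak_deriv p q.
Proof.
move=> cp cq pq phi tp; have p2 := continuous_Lt cp; have q2 := continuous_Lt cq.
have t2 := Lt_test tp; have dt2 := Lt_test (test_fun_derive1 tp).
have D (x : R) : is_derive x 1 (fun t => phi t * p t) (derive1 phi x * p x + phi x * q x).
  have [ux|nux] := pselect (unit_itv x).
    by apply: is_derive_mul; [apply: is_derive_derive1; exact: (@test_fun_derivable R phi x tp)|exact: pq].
  (* Outside (0,1) nothing is known of p, but phi vanishes in a neighbourhood of x. *)
  have nux' : ~~ (0 < x < 1) by apply/negP.
  rewrite (test_fun_out (test_fun_derive1 tp) nux') (test_fun_out tp nux') !mul0r addr0.
  have [_ [a [b [a0 b1 p0]]]] := tp.
  have h := is_derive_cst (0 : R) x 1; apply: near_eq_is_derive h.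
  move: nux'; rewrite negb_and -!leNgt => /orP[x0|x1].
    apply: filterS (lt_nbhsl (le_lt_trans x0 a0)) => s sa; rewrite p0 ?mul0r//.
    by rewrite in_itv/= leNgt sa.
  apply: filterS (lt_nbhsr (lt_le_trans b1 x1)) => s sb; rewrite p0 ?mul0r//.
  by rewrite in_itv/= negb_and -!ltNge sb orbT.
have c : continuous (fun x => derive1 phi x * p x + phi x * q x).
  move=> x; apply: cvgD; apply: cvgM; [|exact: cp| |exact: cq].
    by apply: test_fun_cont; exact: test_fun_derive1.
  exact: test_fun_cont.
have := int_derive D c; rewrite !(test_fun_out tp) ?ltxx ?andbF// !mul0r subrr.
have -> : (fun x => derive1 phi x * p x + phi x * q x) = (fun x => p x * derive1 phi x + q x * phi x).
  by apply/funext => x; rewrite mulrC [phi x * _]mulrC.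
rewrite (@RintegralD _ mT R mu) //; try exact: Lt_mul_integrable.
by move/eqP; rewrite addr_eq0 => /eqP.
Qed.

Lemma is_dx_is_derive u (x : R) (v : R -> R) psi : (forall x, x \in `[0, 1] -> Lt (u x)) -> unit_itv x ->
  is_dx_at u x v -> Lt psi -> is_derive x 1 (fun s => ip (u s) psi) (ip v psi).
Proof.
move=> u2 ux [v2 H] p2; apply: is_derive_eps => e e0.
have K0 : 0 < nrm psi + 1 by rewrite ltr_wpDl// nrm_ge0.
have /cvgrPdist_le/(_ _ (divr_gt0 e0 K0)) := H.
rewrite near_withinE => -[r1 /= r10 hr1].
have [r2 r20 hr2] := unit_itv_near ux.
exists (Num.min r1 r2); first by rewrite lt_min r10.
move=> h h0; rewrite lt_min => /andP[h1 h2].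
have uxh : unit_itv (x + h) by apply: hr2; rewrite addrAC subrr add0r ltW.
have := hr1 (x + h); rewrite /ball_/= opprD addrA subrr add0r normrN => /(_ h1).
have nx : x + h != x by rewrite -subr_eq0 addrAC subrr add0r.
move=> /(_ nx (unit_itv_in uxh)); rewrite sub0r normrN ger0_norm ?nrm_ge0//.
rewrite addrAC subrr add0r -/(nrm _) => B.
have ud := LtB (u2 _ (unit_itv_in uxh)) (u2 _ (unit_itv_in ux)).
have -> : h^-1 * (ip (u (x + h)) psi - ip (u x) psi) - ip v psi = ip (h^-1 *: (u (x + h) - u x) - v) psi.
  rewrite ipBl// ?LtZ// ipZl// ipBl// ?u2//; exact: unit_itv_in.
have dd := LtB (LtZ h^-1 ud) v2.
apply: le_trans (cauchy_schwarz dd p2) _.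
move: B; rewrite ler_pdivlMr//; apply: le_trans.
by rewrite ler_wpM2l ?nrm_ge0// lerDl.
Qed.

Lemma C1_L2_dx u x : C1_L2 u -> x \in `[0, 1] -> is_dx_at u x (dx u x).
Proof. by move=> [_ ex _] x01; rewrite /dx; apply: (@xgetPex _ (cst 0)); exact: ex. Qed.

End ValuedFunctions.

(** * Slices of functions on the square *)

Section Slices.
Variable R : realType.
Implicit Types (K : R * R -> R) (m eta zeta : R -> R).
Notation mu := (mu01 R).
Notation mu2 := (mu01sq R).
Notation mT := (measurableTypeR R).
Local Notation Lt f := (f \in Lfun mu 2%:E).
Local Notation L2s K := (K \in Lfun mu2 2%:E).
Local Notation ip := (@l2dot _ mT R mu).
Local Notation nrm := (@l2nrm _ mT R mu).
Local Notation ip2 := (@l2dot _ (mT * mT)%type R mu2).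
Local Notation nrm2 := (@l2nrm _ (mT * mT)%type R mu2).
Local Notation aeS := (@ae_mono _ mT R mu).

Lemma EFin_Rintegral d (T : measurableType d) (nu : {measure set T -> \bar R}) (f : T -> R) :
  nu.-integrable setT (EFin \o f) -> ((\int[nu]_x f x)%:E = \int[nu]_x (f x)%:E)%E.
Proof. by move=> fi; rewrite /Rintegral fineK//; exact: integrable_fin_num fi. Qed.

Definition tensor eta zeta : R * R -> R := fun z => eta z.1 * zeta z.2.

Lemma tensor_measurable eta m : measurable_fun (setT : set mT) eta ->
  measurable_fun (setT : set mT) m -> measurable_fun (setT : set (mT * mT)) (tensor eta m).
Proof.
move=> me mm; apply: measurable_funM.
  exact: (measurableT_comp me measurable_fst).
exact: (measurableT_comp mm measurable_snd).
Qed.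

Lemma L2s_tensor eta m : Lt eta -> Lt m -> L2s (tensor eta m).
Proof.
move=> e2 m2; have me := Lt_measurable e2; have mm := Lt_measurable m2.
have mt := tensor_measurable me mm.
apply: Lt_intro => //.
have mt2 : measurable_fun (setT : set (mT * mT)) (EFin \o (fun z => tensor eta m z ^+ 2)).
  by apply/measurable_EFinP; exact: measurable_funX.
apply/(@integrable12ltyP _ _ mT mT R mu mu _ mt2).
have ie := Lfun2_integrable_sqr e2; have im := Lfun2_integrable_sqr m2.
have -> : (\int[mu]_x \int[mu]_y `|(EFin \o (fun z => (tensor eta m z ^+ 2)%R)) (x, y)| =
    \int[mu]_x ((nrm m ^+ 2)%:E * (eta x ^+ 2)%:E))%E.
  apply: eq_integral => x _.
  transitivity (\int[mu]_y ((eta x ^+ 2)%:E * (m y ^+ 2)%:E))%E.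
    apply: eq_integral => y _ /=; rewrite ger0_norm ?sqr_ge0//.
    by rewrite /tensor/= exprMn EFinM.
  rewrite (@integralZl _ mT R mu setT measurableT _ im) muleC; congr (_ * _)%E.
  by rewrite nrm_sqr// -EFin_Rintegral.
rewrite (@integralZl _ mT R mu setT measurableT _ ie).
by rewrite -EFin_Rintegral// -EFinM ltry.
Qed.

Lemma L2s_mul_tensor_integrable K eta m : L2s K -> Lt eta -> Lt m ->
  mu2.-integrable setT (EFin \o (fun z => K z * tensor eta m z)).
Proof. by move=> K2 e2 m2; apply: Lt_mul_integrable => //; exact: L2s_tensor. Qed.

Lemma L2s_slice K : L2s K -> \forall x \ae mu, Lt (fun y => K (x, y)).
Proof.
move=> K2; have mK := Lt_measurable K2.
have := @ae_integrable1 _ _ mT mT R mu mu _ (Lfun2_integrable_sqr K2).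
apply: aeS => x iK; apply: Lt_intro => //.
exact: (measurableT_comp mK (pair1_measurable x)).
Qed.

(** The partial pairing in y, a function of x; the slices of K belong to L^2 for a.e. x only. *)
Definition sly K m (x : R) : R := ip (fun y => K (x, y)) m.

Lemma sly_measurable K m : L2s K -> Lt m -> measurable_fun (setT : set mT) (sly K m).
Proof.
move=> K2 m2.
have h := @measurable_fubini_F _ _ mT mT R mu mu _ (L2s_mul_tensor_integrable K2 (Lt_cst 1) m2).
have -> : sly K m = fine \o (fubini_F mu (EFin \o (fun z => K z * tensor (cst 1) m z))).
  apply/funext => x; rewrite /sly /l2dot /Rintegral /=; congr fine.
  by apply: eq_integral => y _; rewrite /tensor/= /cst mul1r.
exact: measurableT_comp h.
Qed.

(** Cauchy-Schwarz on almost every slice, then Tonelli. *)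
Lemma Lt_sly K m : L2s K -> Lt m -> Lt (sly K m) /\ nrm (sly K m) <= nrm m * nrm2 K.
Proof.
move=> K2 m2; have ms := sly_measurable K2 m2.
have iK := Lfun2_integrable_sqr K2.
pose k2 x := (\int[mu]_y (K (x, y) ^+ 2)%:E)%E.
have mk2 : measurable_fun (setT : set mT) k2 by exact: (@measurable_fubini_F _ _ mT mT R mu mu _ iK).
have k20 x : (0 <= k2 x)%E by apply: integral_ge0 => y _; rewrite lee_fin sqr_ge0.
have bd : (\int[mu]_x (sly K m x ^+ 2)%:E <= ((nrm m * nrm2 K) ^+ 2)%:E)%E.
  apply: (@le_trans _ _ (\int[mu]_x ((nrm m ^+ 2)%:E * k2 x))%E).
    apply: (@ae_ge0_le_integral _ mT R mu setT measurableT) => //.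
    - by move=> x _; rewrite lee_fin sqr_ge0.
    - by apply/measurable_EFinP; exact: measurable_funX.
    - by move=> x _; rewrite mule_ge0// lee_fin sqr_ge0.
    - exact: measurable_funeM.
    apply: aeS (L2s_slice K2) => x Kx _.
    have -> : k2 x = (nrm (fun y => K (x, y)) ^+ 2)%:E.
      rewrite nrm_sqr// EFin_Rintegral; last exact: Lt_mul_integrable.
      by apply: eq_integral => y _; rewrite expr2.
    rewrite -EFinM lee_fin -exprMn -real_normK ?num_real//.
    rewrite lerXn2r ?nnegrE ?mulr_ge0 ?nrm_ge0// mulrC.
    exact: cauchy_schwarz.
  rewrite (@ge0_integralZl_EFin _ mT R mu setT measurableT k2)//; last exact: sqr_ge0.
  rewrite exprMn [X in (_ <= X)%E]EFinM; apply: lee_wpmul2l; first by rewrite lee_fin sqr_ge0.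
  rewrite [X in (X <= _)%E](@integral12_prod_meas1 _ _ mT mT R mu mu _ iK).
  rewrite nrm_sqr// EFin_Rintegral; last exact: Lt_mul_integrable.
  by rewrite le_eqVlt; apply/orP; left; apply/eqP; apply: eq_integral => z _ /=; rewrite expr2.
have s2 : Lt (sly K m).
  apply: Lt_intro => //; apply/integrableP; split.
    by apply/measurable_EFinP; exact: measurable_funX.
  apply: (@le_lt_trans _ _ (\int[mu]_x (sly K m x ^+ 2)%:E)%E).
    rewrite le_eqVlt; apply/orP; left; apply/eqP; apply: eq_integral => x _ /=.
    by rewrite ger0_norm// sqr_ge0.
  by apply: le_lt_trans bd _; rewrite ltry.
split => //; rewrite -(@ler_pXn2r _ 2)// ?nnegrE ?mulr_ge0 ?nrm_ge0//.
rewrite nrm_sqr// -lee_fin EFin_Rintegral; last exact: Lt_mul_integrable.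
by apply: le_trans bd; rewrite le_eqVlt; apply/orP; left; apply/eqP; apply: eq_integral => x _; rewrite expr2.
Qed.

(** By Fubini, identities between partial pairings reduce to identities on the square against tensor
    products; with [ip_slx], either variable can be integrated first. *)
Lemma ip_sly K m eta : L2s K -> Lt m -> Lt eta -> ip (sly K m) eta = ip2 K (tensor eta m).
Proof.
move=> K2 m2 e2; have i2 := L2s_mul_tensor_integrable K2 e2 m2.
rewrite /l2dot /Rintegral; congr fine.
rewrite -[RHS](@integral12_prod_meas1 _ _ mT mT R mu mu _ i2).
apply: ae_eq_integral_nm; apply: aeS (L2s_slice K2) => x Kx _.
have iKm := Lt_mul_integrable Kx m2.
rewrite EFinM /sly EFin_Rintegral// muleC -(@integralZl _ mT R mu setT measurableT _ iKm).
by apply: eq_integral => y _ /=; rewrite /tensor/= -EFinM; congr EFin; ring.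
Qed.

Definition swap2 (z : R * R) : R * R := (z.2, z.1).

Lemma integral_swap (f : R * R -> R) : mu2.-integrable setT (EFin \o f) ->
  mu2.-integrable setT (EFin \o (f \o swap2)) /\ \int[mu2]_z f (swap2 z) = \int[mu2]_z f z.
Proof.
move=> fi; have /integrableP[mf _] := fi.
have mf' : measurable_fun (setT : set (mT * mT)) (EFin \o (f \o swap2)).
  exact: (measurableT_comp mf (@measurable_swap _ _ mT mT)).
have fi' : mu2.-integrable setT (EFin \o (f \o swap2)).
  apply/(@integrable12ltyP _ _ mT mT R mu mu _ mf').
  by have /(@integrable21ltyP _ _ mT mT R mu mu _ mf) := fi.
split => //; rewrite /Rintegral; congr fine.
rewrite -[LHS](@integral12_prod_meas1 _ _ mT mT R mu mu _ fi').
by rewrite -[RHS](@integral21_prod_meas1 _ _ mT mT R mu mu _ fi).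
Qed.

Lemma L2s_swap K : L2s K -> L2s (K \o swap2).
Proof.
move=> K2; apply: Lt_intro.
  exact: (measurableT_comp (Lt_measurable K2) (@measurable_swap _ _ mT mT)).
by have [] := integral_swap (Lfun2_integrable_sqr K2).
Qed.

(** The partial pairing in x, obtained by exchanging coordinates so that the facts on [sly] carry
    over. *)
Definition slx K m : R -> R := sly (K \o swap2) m.

Lemma Lt_slx K m : L2s K -> Lt m -> Lt (slx K m).
Proof. by move=> /L2s_swap K2 m2; have [] := Lt_sly K2 m2. Qed.

Lemma nrm2_swap K : L2s K -> nrm2 (K \o swap2) = nrm2 K.
Proof.
move=> K2; rewrite !nrmE ?L2s_swap//; congr Num.sqrt.
by have [] := integral_swap (Lt_mul_integrable K2 K2).
Qed.

Lemma nrm_slx K m : L2s K -> Lt m -> nrm (slx K m) <= nrm m * nrm2 K.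
Proof. by move=> K2 m2; rewrite -nrm2_swap//; have [] := Lt_sly (L2s_swap K2) m2. Qed.

Lemma ip_slx K m zeta : L2s K -> Lt m -> Lt zeta -> ip (slx K m) zeta = ip2 K (tensor m zeta).
Proof.
move=> K2 m2 z2; rewrite ip_sly ?L2s_swap//.
rewrite -[RHS](integral_swap (L2s_mul_tensor_integrable K2 m2 z2)).2.
by apply: eq_Rintegral => z _ /=; rewrite /tensor/= [zeta _ * _]mulrC.
Qed.

Lemma ip2_tensor_linr K eta a m m' : L2s K -> Lt eta -> Lt m -> Lt m' ->
  ip2 K (tensor eta (a *: m + m')) = a * ip2 K (tensor eta m) + ip2 K (tensor eta m').
Proof.
move=> K2 e2 m2 m'2.
have -> : tensor eta (a *: m + m') = a *: tensor eta m + tensor eta m'.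
  by apply/funext => z; rewrite /tensor !fctE /GRing.scale/=; ring.
by rewrite ipDr ?ipZr ?LtZ ?L2s_tensor.
Qed.

Lemma ae_eq_ip (f g : R -> R) : Lt f -> Lt g -> (forall h, Lt h -> ip f h = ip g h) ->
  f = g %[ae mu].
Proof.
move=> f2 g2 H; have fg := LtB f2 g2.
have : f - g = 0 %[ae mu].
  apply: nrm_eq0 => //; rewrite nrmE// ipBl// H// subrr sqrtr0//.
by apply: aeS => x h /h /eqP; rewrite !fctE subr_eq0 => /eqP.
Qed.

(** Proved by duality: tested against any h, both sides are pairings on the square. *)
Lemma sly_lin K a m m' : L2s K -> Lt m -> Lt m' ->
  sly K (a *: m + m') = a *: sly K m + sly K m' %[ae mu].
Proof.
move=> K2 m2 m'2; have am2 := LtD (LtZ a m2) m'2.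
have [s1 _] := Lt_sly K2 m2; have [s2 _] := Lt_sly K2 m'2; have [s3 _] := Lt_sly K2 am2.
apply: ae_eq_ip => //; first by apply: LtD => //; exact: LtZ.
by move=> h h2; rewrite ipDl ?ipZl ?LtZ// !ip_sly// ip2_tensor_linr.
Qed.

Lemma slx_sub K m m' : L2s K -> Lt m -> Lt m' ->
  slx K (m - m') = slx K m - slx K m' %[ae mu].
Proof. by move=> K2 m2 m'2; rewrite !fun_subE; exact: sly_lin (L2s_swap K2) _ _. Qed.

End Slices.

(** * The energy estimate for an abstract error w with x-derivative v and forcing f *)

Section EnergyEstimate.
Variable R : realType.
Implicit Types (u v w f : R -> R -> R) (phi psi : R -> R).
Notation mu := (mu01 R).
Notation mT := (measurableTypeR R).
Local Notation Lt f := (f \in Lfun mu 2%:E).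
Local Notation ip := (@l2dot _ mT R mu).
Local Notation nrm := (@l2nrm _ mT R mu).

(** Origin of 7/3 = 1 + 2/3 + 2/3: the term in L H V costs L; the term in W V costs 1 <= 2L/3;
    Young's inequality for q V is weighted to cost another 2L/3, which leaves 3/(2L) in front of
    q^2. *)
Lemma energy_young (L q H V W : R) : 3 / 2 <= L -> 0 <= q -> 0 <= W -> W <= H -> 0 <= V ->
  2 * ((L * H + q) * V) + 2 * (W * V) <= 7 / 3 * L * (V ^+ 2 + H ^+ 2) + 3 / (2 * L) * q ^+ 2.
Proof.
move=> L32 q0 W0 WH V0; have L0 : 0 < L by lra.
have h1 : 2 * (L * H * V) <= L * (V ^+ 2 + H ^+ 2).
  have -> : 2 * (L * H * V) = L * (2 * (H * V)) by ring.
  by rewrite ler_pM2l//; have := sqr_ge0 (V - H); rewrite sqrrB; lra.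
have h2 : 2 * (W * V) <= V ^+ 2 + H ^+ 2.
  have : W * V <= H * V by rewrite ler_wpM2r.
  by have := sqr_ge0 (V - H); rewrite sqrrB; lra.
have h3 : V ^+ 2 + H ^+ 2 <= 2 / 3 * L * (V ^+ 2 + H ^+ 2).
  by rewrite ler_peMl ?addr_ge0 ?sqr_ge0//; lra.
have h4 : 2 * (q * V) <= 2 / 3 * L * V ^+ 2 + 3 / (2 * L) * q ^+ 2.
  have := sqr_ge0 (2 * L * V - 3 * q).
  rewrite -(@pmulr_rge0 _ (1 / (6 * L))) ?divr_gt0 ?mulr_gt0//.
  rewrite (_ : 1 / (6 * L) * (2 * L * V - 3 * q) ^+ 2 =
    2 / 3 * L * V ^+ 2 + 3 / (2 * L) * q ^+ 2 - 2 * (q * V)); first by rewrite subr_ge0.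
  by field; rewrite gt_eqF.
have h5 : 2 / 3 * L * V ^+ 2 <= 2 / 3 * L * (V ^+ 2 + H ^+ 2).
  by rewrite ler_wpM2l ?lerDl ?sqr_ge0// mulr_ge0 ?ltW.
lra.
Qed.

Lemma within_continuousD (A : set R) (f g : R -> R) :
  {within A, continuous f} -> {within A, continuous g} ->
  {within A, continuous (fun x => f x + g x)}.
Proof. by move=> cf cg x; apply: cvgD; [exact: cf|exact: cg]. Qed.

(** The equation enters only through derivatives of pairings with fixed psi. [energy_identity]
    handles |w_y|^2 + |v|^2; the remaining |w|^2 is differentiated along the diagonal by
    [dir_derive]. *)
Lemma energy_estimate w v f (L q : R) :
  (forall x, x \in `[0, 1] -> H10 R (w x)) -> cont_L2 w -> cont_L2 (fun x => wd (w x)) ->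
  cont_L2 v -> cont_L2 f ->
  (forall psi (x : R), Lt psi -> unit_itv x -> is_derive x 1 (fun s => ip (w s) psi) (ip (v x) psi)) ->
  (forall psi (x : R), H10 R psi -> unit_itv x ->
    is_derive x 1 (fun s => ip (v s) psi) (- ip (wd (w x)) (wd psi) - ip (f x) psi)) ->
  (forall x, x \in `[0, 1] -> nrm (f x) <= L * H1norm (w x) + q) -> 3 / 2 <= L -> 0 <= q ->
  forall x, x \in `[0, 1] -> nrm (v x) ^+ 2 + H1norm (w x) ^+ 2 <=
    (nrm (v 0) ^+ 2 + H1norm (w 0) ^+ 2 + 3 / (2 * L) * q ^+ 2 * x) * expR (7 / 3 * L * x).
Proof.
move=> wH cw cwy cv cf dw dv fb L32 q0.
have [w2 _] := cw; have [wy2 _] := cwy; have [v2 _] := cv; have [f2 _] := cf.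
have L0 : 0 < L by lra.
pose E x := ip (wd (w x)) (wd (w x)) + ip (v x) (v x) + ip (w x) (w x).
have EE x : x \in `[0, 1] -> E x = nrm (v x) ^+ 2 + H1norm (w x) ^+ 2.
  by move=> x01; rewrite /E H1norm_sqr !nrm_sqr ?w2 ?v2 ?wy2//; ring.
(* An antiderivative of x -> <f(x), w(x)>, the auxiliary function of [energy_identity]. *)
have [B dB] := antiderivative (clamp_ip_continuous cf cw).
have dwr psi (x : R) : Lt psi -> unit_itv x -> is_derive x 1 (fun t => ip psi (w t)) (ip psi (v x)).
  move=> p2 ux; rewrite ipC; have := dw psi x p2 ux.
  by rewrite (_ : (fun t => ip psi (w t)) = (fun s => ip (w s) psi))//; apply/funext => t; rewrite ipC.
have h1 (s t : R) : unit_itv s -> unit_itv t ->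
    is_derive s 1 (fun s => ip (v s) (w t)) (- ip (wd (w s)) (wd (w t)) - ip (f s) (w t)).
  by move=> us /unit_itv_in t01; apply: dv => //; exact: wH.
have h2 (s t : R) : unit_itv s -> unit_itv t ->
    is_derive t 1 (fun t => ip (v s) (w t)) (ip (v s) (v t)).
  by move=> /unit_itv_in s01 ut; apply: dwr => //; exact: v2.
have h3 (s t : R) : unit_itv s -> unit_itv t ->
    is_derive t 1 (fun t => ip (f s) (w t)) (ip (f s) (v t)).
  by move=> /unit_itv_in s01 ut; apply: dwr => //; exact: f2.
have h4 (s : R) : unit_itv s -> is_derive s 1 B (ip (f s) (w s)).
  move=> us; have := dB s; rewrite clamp_id; last exact: unit_itv_in.
  by apply; case/andP: us => /ltW.
have h5 (s t : R) : unit_itv s -> unit_itv t ->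
    is_derive s 1 (fun s => ip (w s) (w t)) (ip (v s) (w t)).
  by move=> us /unit_itv_in t01; apply: dw => //; exact: w2.
have h6 (s t : R) : unit_itv s -> unit_itv t ->
    is_derive t 1 (fun t => ip (w s) (w t)) (ip (w s) (v t)).
  by move=> /unit_itv_in s01 ut; apply: dwr => //; exact: w2.
have D1 (x : R) : unit_itv x ->
    is_derive x 1 (fun x => ip (wd (w x)) (wd (w x)) + ip (v x) (v x)) (- (2 * ip (f x) (v x))).
  move=> ux.
  exact (@energy_identity R (fun s t => ip (v s) (w t)) (fun s t => ip (wd (w s)) (wd (w t)))
    (fun s t => ip (f s) (w t)) (fun s t => ip (f s) (v t)) (fun s t => ip (v s) (v t)) B
    (cont2_ip cwy cwy) (cont2_ip cf cw) (cont2_ip cf cv) (cont2_ip cv cv)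
    (fun s t => ipC mu _ _) (fun s t => ipC mu _ _) h1 h2 h3 h4 x ux).
have D2 (x : R) : unit_itv x -> is_derive x 1 (fun x => ip (w x) (w x)) (2 * ip (w x) (v x)).
  move=> ux.
  have u1 : unit_itv (1 * x + 0) by rewrite mul1r addr0.
  have D := @dir_derive R (fun s t => ip (w s) (w t)) (fun s t => ip (v s) (w t)) (fun s t => ip (w s) (v t))
    1 1 0 0 x (cont2_ip cv cw) (cont2_ip cw cv) h5 h6 u1 u1.
  have E1 : (fun r => ip (w (1 * r + 0)) (w (1 * r + 0))) = (fun x => ip (w x) (w x)).
    by apply/funext => r; rewrite mul1r addr0.
  have E2 : 1 * ip (v (1 * x + 0)) (w (1 * x + 0)) + 1 * ip (w (1 * x + 0)) (v (1 * x + 0)) =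
      2 * ip (w x) (v x).
    by rewrite !mul1r addr0 (ipC mu (v x)); ring.
  by rewrite -E1 -E2.
have dE (x : R) : unit_itv x -> is_derive x 1 E (- (2 * ip (f x) (v x)) + 2 * ip (w x) (v x)).
  by move=> ux; have := is_derive_add (D1 x ux) (D2 x ux).
have cE : {within `[0, 1], continuous E}.
  exact: (within_continuousD (within_continuousD (within_ip_continuous cwy cwy)
    (within_ip_continuous cv cv)) (within_ip_continuous cw cw)).
have K0 : 0 <= 7 / 3 * L by rewrite mulr_ge0 ?ltW.
have G0 : 0 <= 3 / (2 * L) * q ^+ 2 by rewrite mulr_ge0 ?sqr_ge0// divr_ge0// mulr_ge0// ltW.
have i0 : (0 : R) \in `[0, 1] by rewrite in_itv/= lexx ler01.
move=> x x01; rewrite -!EE//.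
have bE (y : R) : unit_itv y -> - (2 * ip (f y) (v y)) + 2 * ip (w y) (v y) <=
    7 / 3 * L * E y + 3 / (2 * L) * q ^+ 2; last first.
  by apply: (@gronwall R E _ _ _ K0 G0 cE dE bE); move: x01; rewrite in_itv.
move=> uy; have y01 := unit_itv_in uy; rewrite EE//.
apply: le_trans (energy_young L32 q0 (@nrm_ge0 _ _ _ mu (w y)) (nrm_le_H1norm (w y)) (@nrm_ge0 _ _ _ mu (v y))).
apply: lerD; last by rewrite ler_pM2l// le_ip ?w2 ?v2.
rewrite -mulrN ler_pM2l//.
apply: (@le_trans _ _ (nrm (f y) * nrm (v y))).
  have := cauchy_schwarz (f2 y y01) (v2 y y01); rewrite ler_norml => /andP[+ _]; lra.
by rewrite ler_wpM2r ?nrm_ge0// fb.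
Qed.

End EnergyEstimate.

(** * Strong solutions of the Laplace equation *)

Section StrongSolutions.
Variable R : realType.
Implicit Types (K : R * R -> R) (f g h kappa m eta zeta phi psi theta : R -> R).
Notation mu := (mu01 R).
Notation mu2 := (mu01sq R).
Notation mT := (measurableTypeR R).
Local Notation Lt f := (f \in Lfun mu 2%:E).
Local Notation L2s K := (K \in Lfun mu2 2%:E).
Local Notation ip := (@l2dot _ mT R mu).
Local Notation nrm := (@l2nrm _ mT R mu).
Local Notation ip2 := (@l2dot _ (mT * mT)%type R mu2).
Local Notation nrm2 := (@l2nrm _ (mT * mT)%type R mu2).
Local Notation aeS := (@ae_mono _ mT R mu).
Local Notation aeS2 := (@ae_mono2 _ mT R mu).

Lemma ae_conj (P Q : mT -> Prop) : (\forall x \ae mu, P x) -> (\forall x \ae mu, Q x) ->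
  \forall x \ae mu, P x /\ Q x.
Proof. by apply: ae_mono2 => x p q. Qed.

(** On the square, the null set of exceptional x depends on the test function in y; a countable
    family admits a common one. It suffices because it already forces f - [prim g] to be
    constant. *)
Lemma weak_deriv_seq : exists2 Z : nat -> R -> R, (forall n, test_fun (Z n)) &
  forall f g, Lt f -> Lt g -> (forall n, ip f (derive1 (Z n)) = - ip g (Z n)) -> weak_deriv f g.
Proof.
have [Z tZ HZ] := du_bois_reymond_seq R; exists Z => // f g f2 g2 fg.
have p2 := Lt_prim g2; have [n|c hc] := HZ (f - prim g) (LtB f2 p2).
  have dZ2 := Lt_test (test_fun_derive1 (tZ n)); have E := weak_deriv_prim g2 (tZ n).
  by rewrite -!/(ip _ _) in E; rewrite ipBl// fg E subrr.
move=> phi tp; rewrite -!/(ip _ _); have d2 := Lt_test (test_fun_derive1 tp).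
have E := weak_deriv_prim g2 tp; rewrite -!/(ip _ _) in E; rewrite -E.
apply/eqP; rewrite -subr_eq0 -ipBl// (ae_eq_ipl _ hc).
rewrite (_ : cst c = c *: cst 1 :> (R -> R)); last by apply/funext => x; rewrite /cst/= [RHS]mulr1.
by rewrite ipZl// ?Lt_cst// ipC -/(mean _) meanE int_test_derive1// mulr0.
Qed.

Lemma weak_deriv_prim_cst f g : Lt f -> Lt g -> weak_deriv f g ->
  exists c : R, f = (fun y => c + prim g y) %[ae mu].
Proof.
move=> f2 g2 fg; have [_ _ wg] := wdP g2 fg; have [c hc] := H1_prim (H1_intro f2 g2 fg).
by exists c; apply: aeS hc => x h /h ->; rewrite (prim_ae x wg).
Qed.

(** Integration by parts against 1 - [prim theta]: one factor vanishes at 0, and the other at 1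
    because theta has mean 1. *)
Lemma prim_adjoint_test theta zeta : test_fun theta -> mean theta = 1 -> test_fun zeta ->
  ip (prim zeta) theta = ip zeta (cst 1 - prim theta).
Proof.
move=> tt t1 tz; have t2 := Lt_test tt; have z2 := Lt_test tz.
have pt2 := Lt_prim t2; have pz2 := Lt_prim z2.
have b2 : Lt (cst 1 - prim theta) by apply: LtB; [exact: Lt_cst|exact: Lt_prim].
have D (x : R) : is_derive x 1 (fun s => prim zeta s * (1 + -1 * prim theta s))
    (zeta x * (1 + -1 * prim theta x) + prim zeta x * (0 + -1 * theta x)).
  apply: is_derive_mul; first exact: is_derive_prim.
  exact: (is_derive_add (is_derive_cst (1 : R) x 1) (is_derive_scale (-1) (is_derive_prim x tt))).
have c : continuous (fun x => zeta x * (1 + -1 * prim theta x) + prim zeta x * (0 + -1 * theta x)).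
  move=> x; apply: cvgD; apply: cvgM.
  - exact: test_fun_cont.
  - apply: cvgD; first exact: cvg_cst.
    by apply: cvgM; [exact: cvg_cst|exact: prim_continuous].
  - exact: prim_continuous.
  - apply: cvgD; first exact: cvg_cst.
    by apply: cvgM; [exact: cvg_cst|exact: test_fun_cont].
have := int_derive D c; rewrite !prim0 !prim1 t1 !mul0r mulN1r subrr mulr0 subr0.
have -> : (fun x => zeta x * (1 + -1 * prim theta x) + prim zeta x * (0 + -1 * theta x)) =
    (fun x => zeta x * (cst 1 - prim theta) x - prim zeta x * theta x).
  by apply/funext => x; rewrite !fctE /cst; ring.
rewrite (@RintegralB _ mT R mu) //; try exact: Lt_mul_integrable.
by rewrite -!/(ip _ _) => /eqP; rewrite subr_eq0 => /eqP ->.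
Qed.

Lemma prim_adjoint theta kappa : test_fun theta -> mean theta = 1 -> Lt kappa ->
  ip (prim kappa) theta = ip kappa (cst 1 - prim theta).
Proof.
move=> tt t1 k2; have t2 := Lt_test tt; have pt2 := Lt_prim t2; have pk2 := Lt_prim k2.
have b2 : Lt (cst 1 - prim theta) by apply: LtB; [exact: Lt_cst|exact: Lt_prim].
apply/eqP; rewrite -subr_eq0 -normr_le0; apply/ler_addgt0Pl => e e0; rewrite addr0.
pose K := nrm theta + nrm (cst 1 - prim theta) + 1.
have K0 : 0 < K by rewrite ltr_wpDl// addr_ge0// nrm_ge0.
have [z tz hz] := test_fun_dense k2 (divr_gt0 e0 K0).
have z2 := Lt_test tz; have pz2 := Lt_prim z2; have kz2 := LtB k2 z2.
have E := prim_adjoint_test tt t1 tz.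
have -> : ip (prim kappa) theta - ip kappa (cst 1 - prim theta) =
    ip (prim (kappa - z)) theta - ip (kappa - z) (cst 1 - prim theta).
  have -> : prim (kappa - z) = prim kappa - prim z by apply/funext => x; rewrite primB.
  by rewrite (ipBl pk2 pz2 t2) (ipBl k2 z2 b2) E; ring.
apply: (le_trans (ler_normB _ _)).
apply: (le_trans (lerD (cauchy_schwarz (Lt_prim kz2) t2) (cauchy_schwarz kz2 b2))).
move: hz; rewrite ler_pdivlMr//; apply: le_trans; rewrite /K !mulrDr mulr1.
apply: (@le_trans _ _ (nrm (kappa - z) * nrm theta + nrm (kappa - z) * nrm (cst 1 - prim theta))).
  by rewrite lerD// ler_wpM2r ?nrm_ge0// nrm_prim_le.
by rewrite lerDl nrm_ge0.
Qed.

(* the kernel of the representation of a weakly differentiable function through its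
   mean against [theta] and its derivative *)
Definition rep_ker theta (x : R) : R -> R := ray x - (cst 1 - prim theta).

Lemma Lt_rep_ker theta x : Lt theta -> Lt (rep_ker theta x).
Proof. by move=> t2; apply: LtB; [exact: Lt_ray|apply: LtB; [exact: Lt_cst|exact: Lt_prim]]. Qed.

(** Pairing f = c + [prim g] with theta expresses the constant c through f and g. The resulting
    formula is linear in (f, g) and can be applied to all slices at once. *)
Lemma weak_deriv_rep theta f g : test_fun theta -> mean theta = 1 -> Lt f -> Lt g ->
  weak_deriv f g -> f = (fun x => ip f theta + ip g (rep_ker theta x)) %[ae mu].
Proof.
move=> tt t1 f2 g2 fg; have t2 := Lt_test tt; have pg2 := Lt_prim g2.
have b2 : Lt (cst 1 - prim theta) by apply: LtB; [exact: Lt_cst|exact: Lt_prim].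
have [c hc] := weak_deriv_prim_cst f2 g2 fg.
have Ec : ip f theta = c + ip g (cst 1 - prim theta).
  rewrite (ae_eq_ipl _ hc) (_ : (fun y => c + prim g y) = c *: cst 1 + prim g); last first.
    by apply/funext => y; rewrite !fctE /cst/= [_ *: _]mulr1.
  by rewrite ipDl ?ipZl ?LtZ ?Lt_cst// prim_adjoint// [ip (cst 1) _]ipC -/(mean _) t1 mulr1.
apply: aeS hc => x h /h ->; rewrite Ec /rep_ker (ipBr (Lt_ray x) b2 g2).
by rewrite /prim (ipC mu g (ray x)); ring.
Qed.

Lemma is_derive_tensorl eta (c x : R) : derivable eta x 1 ->
  is_derive x 1 (fun s => eta s * c) (derive1 eta x * c).
Proof.
move=> d; have := is_derive_scale c (is_derive_derive1 d).
rewrite mulrC (_ : (fun s => eta s * c) = (fun s => c * eta s))//.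
by apply/funext => s; rewrite mulrC.
Qed.

(** Mixed derivatives of a tensor product in any order are again tensor products, which settles
    smoothness for all sequences of partial derivatives. *)
Lemma foldr_partial_tensor eta zeta (s : seq bool) : test_fun eta -> test_fun zeta ->
  exists a b, foldr (@partial R) (tensor eta zeta) s = tensor (derive1n a eta) (derive1n b zeta).
Proof.
move=> [de _] [dz _]; elim: s => [|[] s [a [b /= ->]]]; first by exists 0%N, 0%N.
- exists a.+1, b; apply/funext => -[x y]; rewrite /partial/= /tensor/=.
  exact: (derive1_is_derive (is_derive_tensorl _ (de a x))).
- exists a, b.+1; apply/funext => -[x y]; rewrite /partial/= /tensor/=.
  exact: (derive1_is_derive (is_derive_scale _ (is_derive_derive1 (dz b y)))).
Qed.

Lemma test_fun2_tensor eta zeta : test_fun eta -> test_fun zeta -> test_fun2 (tensor eta zeta).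
Proof.
move=> te tz; split; last first.
  have [_ [a [b [a0 b1 e0]]]] := te; have [_ [c [d [c0 d1 z0]]]] := tz.
  exists (Num.min a c), (Num.max b d); split; first by rewrite lt_min a0.
    by rewrite gt_max b1.
  move=> x y; rewrite /tensor/= => /orP[xn|yn].
    rewrite e0 ?mul0r//; apply: contra xn; rewrite !in_itv/= => /andP[h1 h2].
    by rewrite ge_min h1 le_max h2.
  rewrite z0 ?mulr0//; apply: contra yn; rewrite !in_itv/= => /andP[h1 h2].
  by rewrite ge_min h1 le_max h2 !orbT.
have tn phi n : test_fun phi -> test_fun (derive1n n phi).
  by move=> tp; elim: n => // n ih; rewrite derive1nS; exact: test_fun_derive1.
move=> s; have [a [b ->]] := foldr_partial_tensor s te tz.
have ta := tn _ a te; have tb := tn _ b tz; split => [x y|x y|].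
- by case: (is_derive_tensorl (derive1n b zeta y) (@test_fun_derivable R _ x ta)).
- by case: (is_derive_scale (derive1n a eta x) (is_derive_derive1 (@test_fun_derivable R _ y tb))).
- move=> z; apply: cvgM.
    by apply: (@cvg_comp _ _ _ fst (derive1n a eta)); [exact: cvg_fst|exact: test_fun_cont].
  by apply: (@cvg_comp _ _ _ snd (derive1n b zeta)); [exact: cvg_snd|exact: test_fun_cont].
Qed.

Lemma weak_partial_tensor K K' eta zeta : weak_partial true K K' -> test_fun eta -> test_fun zeta ->
  ip2 K (tensor (derive1 eta) zeta) = - ip2 K' (tensor eta zeta).
Proof.
move=> h te tz; rewrite -(h _ (test_fun2_tensor te tz)); congr (@l2dot _ _ R mu2 K _).
apply/funext => -[x y]; rewrite /partial/= /tensor/=; apply/esym.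
by apply: derive1_is_derive; apply: is_derive_tensorl; exact: test_fun_derivable.
Qed.

Lemma weak_partial_tensorr K K' eta zeta : weak_partial false K K' -> test_fun eta -> test_fun zeta ->
  ip2 K (tensor eta (derive1 zeta)) = - ip2 K' (tensor eta zeta).
Proof.
move=> h te tz; rewrite -(h _ (test_fun2_tensor te tz)); congr (@l2dot _ _ R mu2 K _).
apply/funext => -[x y]; rewrite /partial/= /tensor/=; apply/esym.
by apply: derive1_is_derive; apply: is_derive_scale; apply: is_derive_derive1; exact: test_fun_derivable.
Qed.

Lemma ip_test_ext f g h : Lt f -> Lt g -> (forall phi, test_fun phi -> ip f phi = - ip g phi) ->
  Lt h -> ip f h = - ip g h.
Proof.
move=> f2 g2 fg h2.
have E : f + g = 0 %[ae mu].
  apply: test_orth_eq0 => [|phi tp]; first exact: LtD.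
  by have p2 := Lt_test tp; rewrite ipDl// fg// addNr.
by apply/eqP; rewrite -addr_eq0 -ipDl// (ae_eq_ipl _ E) ip0l.
Qed.

(** The hypothesis applies to tensors of test functions. Passing to the partial pairing in x turns
    psi into the element tested against, where density extends the identity to all of L^2. *)
Lemma weak_deriv_sly K K' psi : L2s K -> L2s K' -> weak_partial true K K' -> Lt psi ->
  weak_deriv (sly K psi) (sly K' psi).
Proof.
move=> K2 K'2 h p2 phi tp; rewrite -!/(ip _ _).
have t2 := Lt_test tp; have d2 := Lt_test (test_fun_derive1 tp).
rewrite !ip_sly// -!ip_slx//; apply: ip_test_ext => //; try exact: Lt_slx.
by move=> z tz; have z2 := Lt_test tz; rewrite !ip_slx// (weak_partial_tensor h).
Qed.

Lemma weak_deriv_slx K K' eta : L2s K -> L2s K' -> weak_partial false K K' -> Lt eta ->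
  weak_deriv (slx K eta) (slx K' eta).
Proof.
move=> K2 K'2 h e2 phi tp; rewrite -!/(ip _ _).
have t2 := Lt_test tp; have d2 := Lt_test (test_fun_derive1 tp).
rewrite !ip_slx// -!ip_sly//; apply: ip_test_ext => //; try exact: (Lt_sly _ _).1.
by move=> z tz; have z2 := Lt_test tz; rewrite !ip_sly// (weak_partial_tensorr h).
Qed.

(** Integration by parts in y without slicing: after testing in x, it is [H10_weak_deriv] for the
    partial pairings in x. *)
Lemma sly_H10 K K' psi : L2s K -> L2s K' -> weak_partial false K K' -> H10 R psi ->
  sly K (wd psi) = - sly K' psi %[ae mu].
Proof.
move=> K2 K'2 h hp; have p2 := H1_Lt (H10_H1 hp); have d2 := H1_Lt_wd (H10_H1 hp).
have [s1 _] := Lt_sly K2 d2; have [s2 _] := Lt_sly K'2 p2.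
apply: ae_eq_ip => //; first exact: LtN.
move=> m m2; rewrite ipNl// !ip_sly// -!ip_slx//.
by apply: H10_weak_deriv => //; [exact: Lt_slx|exact: Lt_slx|exact: weak_deriv_slx].
Qed.

Lemma sly_ae K K' psi : L2s K -> L2s K' -> K = K' %[ae mu2] -> Lt psi ->
  sly K psi = sly K' psi %[ae mu].
Proof.
move=> K2 K'2 KK p2; have [s1 _] := Lt_sly K2 p2; have [s2 _] := Lt_sly K'2 p2.
by apply: ae_eq_ip => // m m2; rewrite !ip_sly//; exact: ae_eq_ipl.
Qed.

(* the representative, continuous in x with values in L^2(0,1), of G with x-derivative Gx *)
Definition slice_rep theta (G Gx : R * R -> R) (x : R) : R -> R :=
  slx G theta + slx Gx (rep_ker theta x).

Lemma Lt_slice_rep theta (G Gx : R * R -> R) x : Lt theta -> L2s G -> L2s Gx ->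
  Lt (slice_rep theta G Gx x).
Proof. by move=> t2 G2 Gx2; apply: LtD; apply: Lt_slx => //; exact: Lt_rep_ker. Qed.

(** In a difference the terms with theta cancel and the kernel becomes [ray t - ray x], of norm at
    most |t - x|^(1/2); hence the squared radius. *)
Lemma cont_L2_slice_rep theta (G Gx : R * R -> R) : Lt theta -> L2s G -> L2s Gx ->
  cont_L2 (slice_rep theta G Gx).
Proof.
move=> t2 G2 Gx2; split=> [x _|x x01 e e0]; first exact: Lt_slice_rep.
pose C := nrm2 Gx + 1; have C0 : 0 < C by rewrite ltr_wpDl// nrm_ge0.
exists ((e / C) ^+ 2); first by rewrite exprn_gt0// divr_gt0.
move=> t _ tx.
have k2 y := Lt_rep_ker y t2.
have E : slice_rep theta G Gx t - slice_rep theta G Gx x =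
    slx Gx (rep_ker theta t - rep_ker theta x) %[ae mu].
  by apply: aeS (slx_sub Gx2 (k2 t) (k2 x)) => y h _; rewrite h// /slice_rep !fctE; ring.
rewrite (ae_eq_nrm E).
have -> : rep_ker theta t - rep_ker theta x = ray t - ray x.
  by apply/funext => y; rewrite /rep_ker !fctE; ring.
have r2 : Lt (ray t - ray x) by apply: LtB; exact: Lt_ray.
apply: le_trans (nrm_slx Gx2 r2) _.
have n1 : nrm (ray t - ray x) <= e / C.
  rewrite -(@ler_pXn2r _ 2)// ?nnegrE ?nrm_ge0//; last by rewrite divr_ge0 ?ltW.
  by apply: le_trans (nrm_ray_sub t x) _; exact: ltW.
apply: (@le_trans _ _ (e / C * C)); last by rewrite divfK ?gt_eqF.
by apply: ler_pM => //; rewrite ?nrm_ge0// /C lerDl.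
Qed.

(** This is [weak_deriv_rep] for the scalar function [sly G psi], whose weak derivative is
    [sly Gx psi]. *)
Lemma ip_slice_rep theta (G Gx : R * R -> R) psi : test_fun theta -> mean theta = 1 ->
  L2s G -> L2s Gx -> weak_partial true G Gx -> Lt psi ->
  (fun x => ip (slice_rep theta G Gx x) psi) = sly G psi %[ae mu].
Proof.
move=> tt t1 G2 Gx2 h p2; have t2 := Lt_test tt.
have [s1 _] := Lt_sly G2 p2; have [s2 _] := Lt_sly Gx2 p2.
have := weak_deriv_rep tt t1 s1 s2 (weak_deriv_sly G2 Gx2 h p2).
apply: aeS => x E _; have k2 := Lt_rep_ker x t2.
by rewrite E// /slice_rep ipDl ?Lt_slx// !ip_slx// !ip_sly.
Qed.

Lemma wpdP b K : H1sq K -> L2s (wpd b K) /\ weak_partial b K (wpd b K).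
Proof.
move=> [_ /(_ b) hb]; have [w1 w2] : [set G | L2sq G /\ weak_partial b K G] (wpd b K).
  by rewrite /wpd; apply: xgetPex.
by split.
Qed.

Lemma is_derive_unit_eq (F G : R -> R) (l x : R) : unit_itv x ->
  (forall s, unit_itv s -> F s = G s) -> is_derive x 1 F l -> is_derive x 1 G l.
Proof.
move=> ux FG; apply: near_eq_is_derive; have [r r0 hr] := unit_itv_near ux.
by exists r => //= y /= /ltW xy; rewrite FG//; apply: hr; rewrite distrC.
Qed.

Lemma is_derive_clamp (F : R -> R) (l x : R) : unit_itv x ->
  is_derive x 1 (fun s => F (clamp s)) l <-> is_derive x 1 F l.
Proof.
move=> ux; split; apply: (is_derive_unit_eq ux) => s /unit_itv_in us; by rewrite clamp_id.
Qed.

Lemma is_derive_C1_L2 (u : R -> R -> R) psi (x : R) : C1_L2 u -> Lt psi -> unit_itv x ->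
  is_derive x 1 (fun s => ip (u s) psi) (ip (dx u x) psi).
Proof.
move=> hu p2 ux; have [cu _ _] := hu; have [u2 _] := cu.
exact: (is_dx_is_derive u2 ux (C1_L2_dx hu (unit_itv_in ux)) p2).
Qed.

Lemma weak_deriv_C1_L2 (u : R -> R -> R) psi : C1_L2 u -> Lt psi ->
  weak_deriv (fun x => ip (u (clamp x)) psi) (fun x => ip (dx u (clamp x)) psi).
Proof.
move=> hu p2; have [cu _ cdu] := hu.
have cp := cont_L2_cst p2; have c1 := clamp_ip_continuous (C01_cont_L2 cu) cp.
apply: is_derive_weak_deriv => //; first exact: clamp_ip_continuous (C01_cont_L2 cdu) cp.
move=> x ux; rewrite (clamp_id (unit_itv_in ux)).
exact: (iffRL (@is_derive_clamp (fun s => ip (u s) psi) _ x ux) (is_derive_C1_L2 hu p2 ux)).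
Qed.

(** Here G stands for U_y. Its continuous representative g is shown to be the weak derivative of
    u(x) at every x, and the four conclusions are read off from g. *)
Lemma laplace_slices (u : R -> R -> R) (Ux G Uxx Gy Gx : R * R -> R) :
  let U := fun z : R * R => u z.1 z.2 in
  C1_L2 u -> (forall x, x \in `[0, 1] -> value_at (u x) 0 0 /\ value_at (u x) 1 0) ->
  L2s U -> L2s Ux -> L2s G -> L2s Uxx -> L2s Gy -> L2s Gx ->
  weak_partial true U Ux -> weak_partial false U G -> weak_partial true Ux Uxx ->
  weak_partial false G Gy -> weak_partial true G Gx -> Uxx + Gy = 0 %[ae mu2] ->
  [/\ forall x, x \in `[0, 1] -> H10 R (u x),
      cont_L2 (fun x => wd (u x)),
      \forall x \ae mu, H2 (u x) &
      forall psi (x : R), H10 R psi -> unit_itv x ->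
        is_derive x 1 (fun s => ip (dx u s) psi) (ip (wd (u x)) (wd psi))].
Proof.
move=> U hC bc U2 Ux2 G2 Uxx2 Gy2 Gx2 hUx hG hUxx hGy hGx eqn.
have [cu' _ cdu'] := hC; have cu := C01_cont_L2 cu'; have cdu := C01_cont_L2 cdu'.
have [u2 _] := cu.
have [theta tt t1] := exists_unit_test R; have t2 := Lt_test tt.
pose g := slice_rep theta G Gx.
have cg : cont_L2 g by exact: cont_L2_slice_rep.
have [g2 _] := cg.
have gG psi : Lt psi -> (fun x => ip (g x) psi) = sly G psi %[ae mu].
  by move=> p2; exact: ip_slice_rep.
(* For fixed phi the identity holds for a.e. x and both sides are continuous in x, so no x is
   lost. *)
have ug x : x \in `[0, 1] -> weak_deriv (u x) (g x).
  move=> x01 phi tp; rewrite -!/(ip _ _).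
  have p2 := Lt_test tp; have d2 := Lt_test (test_fun_derive1 tp).
  have e1 : sly U (derive1 phi) = - sly G phi %[ae mu].
    have := sly_H10 U2 G2 hG (H10_test tp); apply: aeS => y h hy; move: (h hy).
    by rewrite /sly (ae_eq_ipr _ (wd_test tp)).
  have cN := cont_L2_lin (-1) cg (cont_L2_cst (Lt0 mu)).
  have E : (fun y => ip (u y) (derive1 phi)) = (fun y => ip (-1 *: g y + 0) phi) %[ae mu].
    have h01 : \forall y \ae mu, y \in `[0, 1] by apply: mu01_ae => y; exact: unit_itv_in.
    apply: aeS2 (ae_conj e1 (gG phi p2)) h01 => y [h1 h2] y01 _.
    rewrite addr0 ipZl ?g2// mulN1r -[LHS]/(sly U (derive1 phi) y) h1// fctE.
    by rewrite h2.
  have := within_ae_eq x01 (within_ip_continuous cu (cont_L2_cst d2))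
    (within_ip_continuous cN (cont_L2_cst p2)) E.
  by rewrite /= addr0 ipZl ?g2// mulN1r.
have H1u x : x \in `[0, 1] -> H1 R (u x).
  by move=> x01; apply: (H1_intro (u2 x x01) (g2 x x01)); exact: ug.
have H10u x : x \in `[0, 1] -> H10 R (u x).
  by move=> x01; have [b0 b1] := bc x x01; apply: H10_value_at => //; exact: H1u.
have wg x : x \in `[0, 1] -> wd (u x) = g x %[ae mu].
  by move=> x01; have [_ _] := wdP (g2 x x01) (ug x x01).
have h01 : \forall y \ae mu, y \in `[0, 1] by apply: mu01_ae => y; exact: unit_itv_in.
split => //.
- apply: (@cont_L2_ae _ g) => //; first by move=> x x01; apply: H1_Lt_wd; exact: H1u.
  by move=> x x01; apply: ae_eq_sym; exact: wg.
(* The second derivative in y is the slice of [Gy], which is in L^2 for a.e. x only; the countable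
   family gives a null set independent of the test function. *)
- have [Z tZ hZ] := weak_deriv_seq.
  have hn : \forall x \ae mu, forall n,
      ip (g x) (derive1 (Z n)) = - ip (fun y => Gy (x, y)) (Z n).
    apply/(@ae_foralln _ mT R mu) => n; have z2 := Lt_test (tZ n).
    have d2 := Lt_test (test_fun_derive1 (tZ n)).
    apply: aeS2 (gG _ d2) (sly_H10 G2 Gy2 hGy (H10_test (tZ n))) => x h1 h2.
    by rewrite h1// -[RHS]h2// /sly (ae_eq_ipr _ (wd_test (tZ n))).
  apply: aeS2 (ae_conj hn (L2s_slice Gy2)) h01 => x [h1 h2] x01; split; first exact: H1u.
  have w2 := H1_Lt_wd (H1u x x01).
  apply: (H1_intro w2 h2); apply: weak_deriv_ae (hZ _ _ (g2 x x01) h2 h1); last exact: ae_eq_refl.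
  by apply: ae_eq_sym; exact: wg.
- move=> psi x hp ux; have p2 := H1_Lt (H10_H1 hp); have d2 := H1_Lt_wd (H10_H1 hp).
  have cp := cont_L2_cst p2; have cd := cont_L2_cst d2.
  have c1 := clamp_ip_continuous cdu cp; have c2 := clamp_ip_continuous cg cd.
  have [s1 _] := Lt_sly Ux2 p2.
  (* Both are weak derivatives of x -> <u(x), psi>; uniqueness links the derivative of the curve to
     the weak derivative on the square. *)
  have e1 : (fun x => ip (dx u (clamp x)) psi) = sly Ux psi %[ae mu].
    apply: (weak_deriv_uniq (continuous_Lt c1) s1 (weak_deriv_C1_L2 hC p2)).
    apply: (weak_deriv_ae _ _ (weak_deriv_sly U2 Ux2 hUx p2)); last exact: ae_eq_refl.
    by apply: ae_eq_sym; exact: (ae_clamp (fun x => ip (u x) psi)).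
  (* The equation replaces U_xx by -U_yy, and integration by parts in y moves one derivative to psi,
     leaving a function continuous in x. *)
  have e2 : sly Uxx psi = (fun x => ip (g (clamp x)) (wd psi)) %[ae mu].
    have N2 : L2s (- Gy) by exact: LtN.
    have eN : Uxx = - Gy %[ae mu2].
      by move: eqn; apply: ae_mono => z h hz; move/eqP: (h hz); rewrite !fctE addr_eq0 => /eqP.
    have f1 := sly_ae Uxx2 N2 eN p2.
    have f2 := sly_H10 G2 Gy2 hGy hp.
    have f3 := ae_clamp (fun x => ip (g x) (wd psi)).
    have f4 := gG _ d2.
    have f5 := L2s_slice Gy2.
    apply: aeS2 (ae_conj f1 f2) (ae_conj (ae_conj f3 f4) f5) => y [a1 a2] [[a3 a4] a5] _.
    rewrite (a1 I) (a3 I) (a4 I) (a2 I); exact: (ipNl a5 p2).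
  have wp : weak_deriv (fun x => ip (dx u (clamp x)) psi) (fun x => ip (g (clamp x)) (wd psi)).
    by apply: (weak_deriv_ae _ e2 (weak_deriv_sly Ux2 Uxx2 hUxx p2)); exact: ae_eq_sym.
  have := weak_deriv_is_derive c1 c2 wp ux; rewrite clamp_id ?unit_itv_in//.
  rewrite -(ae_eq_ipl _ (wg x (unit_itv_in ux))).
  exact: (iffLR (@is_derive_clamp (fun s => ip (dx u s) psi) _ x ux)).
Qed.

Lemma strong_solution_weak u0 u : strong_solution u0 u ->
  [/\ forall x, x \in `[0, 1] -> H10 R (u x),
      cont_L2 (fun x => wd (u x)),
      \forall x \ae mu, H2 (u x) &
      forall psi (x : R), H10 R psi -> unit_itv x ->
        is_derive x 1 (fun s => ip (dx u s) psi) (ip (wd (u x)) (wd psi))].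
Proof.
move=> [[[hU hd] hC] eqn bc _ _].
have [Ux2 hUx] := wpdP true hU; have [G2 hG] := wpdP false hU.
have [Gx2 hGx] := wpdP true (hd false); have [Gy2 hGy] := wpdP false (hd false).
have [Uxx2 hUxx] := wpdP true (hd true); have [U2 _] := hU.
exact: (laplace_slices hC bc U2 Ux2 G2 Uxx2 Gy2 Gx2 hUx hG hUxx hGy hGx eqn).
Qed.

End StrongSolutions.

(** * The error estimate *)

Section MainEstimate.
Variable R : realType.
Implicit Types (f g phi psi : R -> R) (u v w : R -> R -> R).
Notation mu := (mu01 R).
Notation mT := (measurableTypeR R).
Local Notation Lt f := (f \in Lfun mu 2%:E).
Local Notation ip := (@l2dot _ mT R mu).
Local Notation nrm := (@l2nrm _ mT R mu).
Local Notation aeS := (@ae_mono _ mT R mu).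
Local Notation aeS2 := (@ae_mono2 _ mT R mu).

Lemma C01_H10_intro u : (forall x, x \in `[0, 1] -> H10 R (u x)) -> cont_L2 u ->
  cont_L2 (fun x => wd (u x)) -> C01 (H10 R) u.
Proof.
move=> hu cu cwu; split=> // x x01.
apply/cvgrPdist_le => e e0; have e20 : 0 < e / 2 by rewrite divr_gt0.
have [_ /(_ x x01 _ e20)[r1 r10 h1]] := cu; have [_ /(_ x x01 _ e20)[r2 r20 h2]] := cwu.
rewrite near_withinE; exists (Num.min r1 r2) => /=; first by rewrite lt_min r10.
move=> t /=; rewrite distrC lt_min => /andP[t1 t2] t01.
rewrite sub0r normrN ger0_norm; last exact: H1norm_ge0.
apply: le_trans (H1norm_le _) _; rewrite [e]splitr lerD//; first exact: h1.
have hh y : y \in `[0, 1] -> H1 R (u y) by move=> /hu /H10_H1.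
by rewrite (ae_eq_nrm (wd_sub (hh t t01) (hh x x01))); exact: h2.
Qed.

Lemma linear_map_sub (D : (R -> R) -> Prop) T f g : linear_map D T -> D f -> D g ->
  T (f - g) = T f - T g %[ae mu].
Proof.
move=> [_ _ lin] hf hg; rewrite !fun_subE; exact: lin.
Qed.

(** Continuity is measured in V while T is linear on a larger domain D: H^1_0 inside H^1 for P, and
    W inside L^2 for Q. *)
Lemma linear_cont_L2 (D : (R -> R) -> Prop) (V : fspace R) T u (M : R) :
  linear_map D T -> (forall f, V f -> D f) -> (forall f, V f -> 0 <= fnorm V f) ->
  (forall f g, V f -> V g -> V (f - g)) ->
  (forall f, V f -> nrm (T f) <= M * fnorm V f) ->
  C01 V u -> cont_L2 (fun x => T (u x)).
Proof.
move=> lT VD V0 Vsub bT cu; have [uV _] := cu; have [T2 _ _] := lT.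
split=> [x x01|x x01 e e0]; first exact/T2/VD/uV.
pose K := `|M| + 1; have K0 : 0 < K by rewrite ltr_wpDl.
have [r r0 hr] := C01_eps cu x01 (divr_gt0 e0 K0).
exists r => // t t01 tx; have ut := uV t t01; have ux := uV x x01.
rewrite -(ae_eq_nrm (linear_map_sub lT (VD _ ut) (VD _ ux))).
apply: le_trans (bT _ (Vsub _ _ ut ux)) _; have := hr t t01 tx.
have := V0 _ (Vsub _ _ ut ux); set N := fnorm V _ => N0 hN.
apply: (@le_trans _ _ (K * N)); last by rewrite mulrC -ler_pdivlMr.
by rewrite ler_wpM2r// /K; have := ler_norm M; lra.
Qed.

Lemma within_continuous_eps (F : R -> R) :
  (forall x, x \in `[0, 1] -> forall e, 0 < e -> exists2 r, 0 < r &
    forall t, t \in `[0, 1] -> `|t - x| < r -> `|F t - F x| <= e) ->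
  {within `[0, 1], continuous F}.
Proof.
move=> h; apply/subspace_continuousP => x x01; apply/cvgrPdist_le => e e0.
have [r r0 hr] := h x x01 e e0; rewrite near_withinE; exists r => //= t /= xt t01.
by rewrite distrC; apply: hr => //; rewrite distrC.
Qed.

(** The supremum is an upper bound only for a bounded set; boundedness comes from the continuity of
    the norm along u, by the reverse triangle inequality. *)
Lemma C01norm_ub (W : fspace R) u x : normed_L2_subspace W -> C01 W u -> x \in `[0, 1] ->
  fnorm W (u x) <= C01norm W u.
Proof.
move=> hW cu x01; have [uW _] := cu.
have Wsub f g : W f -> W g -> W (f - g) by move=> hf hg; rewrite fun_subE; exact: W_linear.
have tri f g : W f -> W g -> fnorm W f <= fnorm W g + fnorm W (f - g).
  move=> hf hg; have := W_normD hW hg (Wsub f g hf hg).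
  by rewrite (_ : g + (f - g) = f)//; apply/funext => y; rewrite !fctE; ring.
have sym f g : W f -> W g -> fnorm W (f - g) = fnorm W (g - f).
  move=> hf hg; have := W_normZ hW (-1) (Wsub g f hg hf).
  by rewrite scaleN1r opprB normrN1 mul1r.
have cN : {within `[0, 1], continuous (fun x => fnorm W (u x))}.
  apply: within_continuous_eps => y y01 e e0; have [r r0 hr] := C01_eps cu y01 e0.
  exists r => // t t01 ty; have := hr t t01 ty; have ut := uW t t01; have uy := uW y y01.
  have := tri _ _ ut uy; have := tri _ _ uy ut; rewrite (sym _ _ uy ut) => h1 h2 h3.
  by rewrite ler_norml; apply/andP; split; lra.
have [c c01 hc] := EVT_max ler01 cN.
apply: sup_upper_bound; last by exists x.
split; first by exists (fnorm W (u x)), x.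
by exists (fnorm W (u c)) => _ [y /= y01 <-]; exact: hc.
Qed.

(** The second derivative is a distribution equal for a.e. x to an expression that is continuous in
    x, so the pairing of u_x with psi is classically differentiable. *)
Lemma weak_solution_derive (P : (R -> R) -> R -> R) (u0 : R -> R) u psi (x : R) :
  weak_solution P u0 u -> cont_L2 (fun x => P (u x)) -> H10 R psi -> unit_itv x ->
  is_derive x 1 (fun s => ip (dx u s) psi) (- ip (wd (u x)) (wd psi) - ip (P (u x)) psi).
Proof.
have E (r a b : R) : r + a + b = 0 -> r = - a - b by move=> h; lra.
move=> [cH hC [F [_ hF eF]] _ _] cP hp ux; have [_ _ cdu'] := hC.
have p2 := H1_Lt (H10_H1 hp); have d2 := H1_Lt_wd (H10_H1 hp).
have c1 := clamp_ip_continuous (C01_cont_L2 cdu') (cont_L2_cst p2).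
have c2 := clamp_ip_continuous (C01_H10_cont_wd cH) (cont_L2_cst d2).
have c3 := clamp_ip_continuous cP (cont_L2_cst p2).
pose q y := - ip (wd (u (clamp y))) (wd psi) - ip (P (u (clamp y))) psi.
have cq : continuous q.
  by move=> y; apply: cvgB; [apply: cvgN; exact: c2|exact: c3].
have wp : weak_deriv (fun y => ip (dx u (clamp y)) psi) q.
  move=> phi tp; transitivity (\int[mu]_y (L2ip (dx u y) psi * derive1 phi y)).
    apply: (@ae_eq_Rintegral _ mT R mu).
    by apply: aeS (ae_clamp (fun y => ip (dx u y) psi)) => y h _; rewrite h.
  rewrite hF//; congr (- _); apply: (@ae_eq_Rintegral _ mT R mu).
  apply: aeS2 (eF psi hp) (ae_conj (ae_clamp (fun y => ip (wd (u y)) (wd psi)))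
    (ae_clamp (fun y => ip (P (u y)) psi))) => y h1 [h2 h3] _.
  by rewrite /q (h2 I) (h3 I) (E _ _ _ h1).
have := weak_deriv_is_derive c1 cq wp ux; rewrite /q (clamp_id (unit_itv_in ux)).
exact: (iffLR (@is_derive_clamp R (fun s => ip (dx u s) psi) _ x ux)).
Qed.

(* For the exact solution the stabilized operator is known only where u_yy is in L^2, i.e.
   for a.e. x; the weak identity extends to every x by continuity. *)
Lemma stabilization_weak (P Q : (R -> R) -> R -> R) u psi (x : R) :
  (forall f, H2 f -> H10 R f -> P f = Q f + 2 *: wd (wd f) %[ae mu]) ->
  (forall x, x \in `[0, 1] -> H10 R (u x)) -> cont_L2 (fun x => wd (u x)) ->
  cont_L2 (fun x => P (u x)) -> cont_L2 (fun x => Q (u x)) ->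
  (\forall x \ae mu, H2 (u x)) -> H10 R psi -> x \in `[0, 1] ->
  ip (P (u x)) psi = ip (Q (u x)) psi - 2 * ip (wd (u x)) (wd psi).
Proof.
move=> hPQ hu cw cP cQ h2u hp x01.
have p2 := H1_Lt (H10_H1 hp); have d2 := H1_Lt_wd (H10_H1 hp).
have [w2 _] := cw; have [P2 _] := cP; have [Q2 _] := cQ.
have cPQ := cont_L2_sub cP cQ; have cN := cont_L2_lin (-2) cw (cont_L2_cst (Lt0 mu)).
have h01 : \forall y \ae mu, y \in `[0, 1] by apply: mu01_ae => y; exact: unit_itv_in.
have E : (fun y => ip (P (u y) - Q (u y)) psi) = (fun y => ip (-2 *: wd (u y) + 0) (wd psi)) %[ae mu].
  apply: aeS2 h2u h01 => y [h1 h2] y01 _.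
  have [s2 ws] := H1_wd h2; have Qy := Q2 y y01; have wy := w2 y y01.
  rewrite addr0 (ipZl _ wy d2) (H10_weak_deriv wy s2 ws hp).
  rewrite (ipBl (P2 y y01) Qy p2) (ae_eq_ipl _ (hPQ _ (conj h1 h2) (hu y y01))).
  rewrite (ipDl Qy (LtZ 2 s2) p2) (ipZl _ s2 p2); ring.
have := within_ae_eq x01 (within_ip_continuous cPQ (cont_L2_cst p2))
  (within_ip_continuous cN (cont_L2_cst d2)) E.
rewrite /= addr0 (ipZl _ (w2 x x01) d2) (ipBl (P2 x x01) (Q2 x x01) p2); lra.
Qed.

Lemma is_derive_ip_sub v w psi (x a b : R) :
  (forall x, x \in `[0, 1] -> Lt (v x)) -> (forall x, x \in `[0, 1] -> Lt (w x)) -> Lt psi ->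
  unit_itv x -> is_derive x 1 (fun s => ip (v s) psi) a -> is_derive x 1 (fun s => ip (w s) psi) b ->
  is_derive x 1 (fun s => ip (v s - w s) psi) (a - b).
Proof.
move=> v2 w2 p2 ux dv dw; have h := is_derive_add dv (is_derive_scale (-1) dw).
rewrite mulN1r in h; move: h; apply: (is_derive_unit_eq ux) => s /unit_itv_in s01.
by rewrite mulN1r (ipBl (v2 s s01) (w2 s s01) p2).
Qed.

(** The estimate for one fixed pair of operators, with L and C their bounds on H^1 and on W; the
    dependence on the regularization parameter enters afterwards. *)
Lemma error_energy (P Q : (R -> R) -> R -> R) (W : fspace R) (L C : R) (u0 u0e : R -> R) u ue :
  normed_L2_subspace W -> linear_map (fcarrier (L2 R)) Q -> linear_map (fcarrier (H1 R)) P ->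
  (forall f, W f -> nrm (Q f) <= C * fnorm W f) ->
  (forall f, H1 R f -> nrm (P f) <= L * H1norm f) ->
  (forall f, H2 f -> H10 R f -> P f = Q f + 2 *: wd (wd f) %[ae mu]) ->
  C01 W u -> strong_solution u0 u -> weak_solution P u0e ue -> 3 / 2 <= L -> 0 <= C ->
  forall x, x \in `[0, 1] -> nrm (dx ue x - dx u x) ^+ 2 + H1norm (ue x - u x) ^+ 2 <=
    (H1norm (u0e - u0) ^+ 2 + 3 / (2 * L) * (C * C01norm W u) ^+ 2 * x) * expR (7 / 3 * L * x).
Proof.
(* With psi fixed, a and b pair psi_y with the y-derivatives of ue and u, c is <P ue, psi> and d is
   <Q u, psi>; d - 2b is <P u, psi>. The identity reverses the sign of the elliptic term. *)
have K (a b c d : R) : - a - c - b = - (a - b) - (c - (d - 2 * b) + d) by ring.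
move=> hW lQ lP bQ bP hPQ cWu hu hue L32 C0.
have [H10u cwu h2u du] := strong_solution_weak hu.
have [[_ hC] _ _ iu0 idu0] := hu; have [cu' _ cdu'] := hC.
have [cHe hCe _ iue0 idue0] := hue; have [_ _ cdue'] := hCe.
have cu := C01_cont_L2 cu'; have cdu := C01_cont_L2 cdu'; have cdue := C01_cont_L2 cdue'.
have cue := C01_H10_cont_L2 cHe; have cwue := C01_H10_cont_wd cHe.
have cHu := C01_H10_intro H10u cu cwu; have [H10ue _] := cHe.
have [ue2 _] := cue; have [u2 _] := cu; have [due2 _] := cdue; have [du2 _] := cdu.
have bP' f : H10 R f -> nrm (P f) <= L * fnorm (H10 R) f by move=> /H10_H1 /bP.
have nH f : H10 R f -> 0 <= fnorm (H10 R) f by move=> _; exact: H1norm_ge0.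
have cPu := linear_cont_L2 lP (@H10_H1 R) nH (@H10_sub R) bP' cHu.
have cPue := linear_cont_L2 lP (@H10_H1 R) nH (@H10_sub R) bP' cHe.
have Wsub f g : W f -> W g -> W (f - g) by move=> hf hg; rewrite fun_subE; exact: W_linear.
have cQu := linear_cont_L2 lQ (W_sub_L2 hW) (W_norm_ge0 hW) Wsub bQ cWu.
have [uW _] := cWu.
pose w x := ue x - u x; pose v x := dx ue x - dx u x.
have H10w x : x \in `[0, 1] -> H10 R (w x) by move=> x01; apply: H10_sub; [exact: H10ue|exact: H10u].
have cw : cont_L2 w by exact: cont_L2_sub.
have cv : cont_L2 v by exact: cont_L2_sub.
have wdw x : x \in `[0, 1] -> wd (w x) = wd (ue x) - wd (u x) %[ae mu].
  by move=> x01; apply: wd_sub; apply: H10_H1; [exact: H10ue|exact: H10u].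
have cwd : cont_L2 (fun x => wd (w x)).
  apply: cont_L2_ae (cont_L2_sub cwue cwu); first by move=> x /H10w /H10_H1 /H1_Lt_wd.
  by move=> x /wdw; exact: ae_eq_sym.
have Pw x : x \in `[0, 1] -> P (w x) = P (ue x) - P (u x) %[ae mu].
  by move=> x01; apply: (linear_map_sub lP); apply: H10_H1; [exact: H10ue|exact: H10u].
have P2w x : x \in `[0, 1] -> Lt (P (w x)).
  by move=> /H10w /H10_H1; exact: (linear_map_L2 lP).
pose f x := 1 *: P (w x) + Q (u x).
have cf : cont_L2 f.
  apply: cont_L2_lin cQu; apply: cont_L2_ae (cont_L2_sub cPue cPu) => //.
  by move=> x /Pw; exact: ae_eq_sym.
have q0 : 0 <= C * C01norm W u.
  have i0 : (0 : R) \in `[0, 1] by rewrite in_itv/= lexx ler01.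
  by rewrite mulr_ge0// (le_trans _ (C01norm_ub hW cWu i0))//; apply: W_norm_ge0 => //; exact: uW.
have [Pu2 _] := cPu; have [Pue2 _] := cPue; have [Qu2 _] := cQu.
have [wu2 _] := cwu; have [wue2 _] := cwue.
have dw psi (x : R) : Lt psi -> unit_itv x -> is_derive x 1 (fun s => ip (w s) psi) (ip (v x) psi).
  move=> p2 ux; have x01 := unit_itv_in ux; rewrite /v (ipBl (due2 x x01) (du2 x x01) p2).
  exact: (is_derive_ip_sub ue2 u2 p2 ux (is_derive_C1_L2 hCe p2 ux) (is_derive_C1_L2 hC p2 ux)).
have dv psi (x : R) : H10 R psi -> unit_itv x ->
    is_derive x 1 (fun s => ip (v s) psi) (- ip (wd (w x)) (wd psi) - ip (f x) psi).
  move=> hp ux; have x01 := unit_itv_in ux; have p2 := H1_Lt (H10_H1 hp).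
  have d2 := H1_Lt_wd (H10_H1 hp).
  have E := stabilization_weak hPQ H10u cwu cPu cQu h2u hp x01.
  rewrite (ae_eq_ipl _ (wdw x x01)) (ipBl (wue2 x x01) (wu2 x x01) d2).
  rewrite /f scale1r (ipDl (P2w x x01) (Qu2 x x01) p2) (ae_eq_ipl _ (Pw x x01)).
  rewrite (ipBl (Pue2 x x01) (Pu2 x x01) p2) E.
  have h := is_derive_ip_sub due2 du2 p2 ux (weak_solution_derive hue cPue hp ux) (du psi x hp ux).
  exact: (is_derive_congr (K (ip (wd (ue x)) (wd psi)) (ip (wd (u x)) (wd psi)) (ip (P (ue x)) psi)
    (ip (Q (u x)) psi)) h).
have bf x : x \in `[0, 1] -> nrm (f x) <= L * H1norm (w x) + C * C01norm W u.
  move=> x01; rewrite /f scale1r; apply: le_trans (nrmD (P2w x x01) (Qu2 x x01)) _.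
  apply: lerD; first by apply: bP; apply: H10_H1; exact: H10w.
  by apply: le_trans (bQ _ (uW x x01)) _; rewrite ler_wpM2l// C01norm_ub.
move=> x x01; have := energy_estimate H10w cw cwd cv cf dw dv bf L32 q0 x01.
have -> : nrm (v 0) = 0.
  rewrite (@ae_eq_nrm _ mT R mu _ 0) ?nrm0//.
  by apply: aeS2 idue0 idu0 => y h1 h2 _; rewrite /v !fctE (h1 I) (h2 I) subrr.
have -> : H1norm (w 0) = H1norm (u0e - u0).
  by apply: H1norm_ae; apply: aeS2 iue0 iu0 => y h1 h2 _; rewrite /w !fctE (h1 I) (h2 I).
by rewrite expr0n add0r.
Qed.

End MainEstimate.

(** * Comparison of the constants with those of the theorem *)

Section FinalBound.
Variable R : realType.

(* The paper's factor (4/3) L^2 is at least 1 because L > 3/2. *)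
Lemma error_bound_weaken (C0 C1 l g n e x y : R) :
  0 < C1 -> 0 < l -> 0 < g -> 0 <= x -> 3 / 2 < C1 * l -> 0 <= y -> y <= e ->
  y ^+ 2 + 3 / (2 * (C1 * l)) * (C0 / g * n) ^+ 2 * x <=
  4 / 3 * C1 ^+ 2 * (4 * e ^+ 2 + 27 / 8 * C0 ^+ 2 * C1 ^- 3 * g ^- 2 * l ^- 3 * x * n ^+ 2) * l ^+ 2.
Proof.
move=> c0 l0 g0 x0 hL y0 ye.
(* In terms of L = C1 l, the claimed factor is (16/3) L^2 e^2 plus three times the forcing term from
   Gronwall's inequality. *)
have -> : 4 / 3 * C1 ^+ 2 * (4 * e ^+ 2 + 27 / 8 * C0 ^+ 2 * C1 ^- 3 * g ^- 2 * l ^- 3 * x * n ^+ 2) * l ^+ 2 =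
    16 / 3 * ((C1 * l) ^+ 2 * e ^+ 2) + 3 * (3 / (2 * (C1 * l)) * (C0 / g * n) ^+ 2 * x).
  by field; rewrite !gt_eqF.
have h1 : y ^+ 2 <= e ^+ 2 by rewrite lerXn2r ?nnegrE// (le_trans y0).
have h2 : 1 * e ^+ 2 <= (C1 * l) ^+ 2 * e ^+ 2.
  by rewrite ler_wpM2r ?sqr_ge0// exprn_ege1//; lra.
have h3 : 0 <= e ^+ 2 := sqr_ge0 e.
have hK : 0 <= 3 / (2 * (C1 * l)) by rewrite divr_ge0 ?mulr_ge0 ?(ltW c0) ?(ltW l0).
have h4 := mulr_ge0 (mulr_ge0 hK (sqr_ge0 (C0 / g * n))) x0.
rewrite mul1r in h2; lra.
Qed.

End FinalBound.

Theorem theorem4p1 (R : realType)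
  (gamma beta : R -> R)
  (gamma_ge1 : forall b, 0 < b < 1 -> 1 <= gamma b)
  (gamma_pinfty : gamma b @[b --> 0^'+] --> +oo)
  (beta01 : forall e, 0 < e < 1 -> 0 < beta e < 1)
  (beta_cvg0 : beta e @[e --> 0^'+] --> 0)
  (W : fspace R) (hW : normed_L2_subspace W)
  (C0 C1 : R) (Q P : R -> (R -> R) -> (R -> R))
  (hQ : perturbing_operator gamma beta W C0 Q)
  (hPQ : stabilization_of P Q)
  (hP : stabilized_operator gamma beta C1 P)
  (eps : R) (eps01 : 0 < eps < 1)
  (u0 u0e : R -> R) (hu0 : H1 R u0) (hu0e : H1 R u0e)
  (u0e_close : H1norm (u0e - u0) <= eps)
  (u0e_bc : value_at u0e 0 0 /\ value_at u0e 1 0)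
  (u : R -> (R -> R)) (uW : C01 W u) (hu : strong_solution u0 u)
  (ue : R -> (R -> R)) (hue : weak_solution (P eps) u0e ue)
  (hgamma : 2 / 3 * C1 * ln (gamma (beta eps)) > 1)
  (x : R) (x01 : x \in `[0, 1]) :
  L2norm (dx ue x - dx u x) ^+ 2 + H1norm (ue x - u x) ^+ 2 <=
  4 / 3 * C1 ^+ 2 *
    (4 * eps ^+ 2 +
     27 / 8 * C0 ^+ 2 * C1 ^- 3 * gamma (beta eps) ^- 2 *
       ln (gamma (beta eps)) ^- 3 * x * C01norm W u ^+ 2) *
    ln (gamma (beta eps)) ^+ 2 *
    gamma (beta eps) `^ (7 * C1 * x / 3).
Proof.
have [b01 g1] : 0 < beta eps < 1 /\ 1 <= gamma (beta eps).
  by split; [exact: beta01|apply: gamma_ge1; exact: beta01].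
have [C00 /(_ _ eps01)[lQ bQ]] := hQ; have [C10 /(_ _ eps01)[lP bP]] := hP.
move: hgamma lP bP lQ bQ hue (hPQ eps eps01) g1.
set g := gamma (beta eps) => hg lP bP lQ bQ hue' hPQ' g1.
have g0 : 0 < g by exact: lt_le_trans ltr01 g1.
have L32 : 3 / 2 < C1 * ln g by lra.
have l0 : 0 < ln g by rewrite -(pmulr_rgt0 _ C10); lra.
have C0g : 0 <= C0 / g by rewrite divr_ge0 ?ltW.
have bQ' f : W f -> L2norm (Q eps f) <= C0 / g * fnorm W f.
  by move=> /bQ; rewrite mulrAC.
(* Applied with L = C1 log(gamma(beta)) and C = C0 / gamma(beta); the exponential then becomes the
   stated power of gamma(beta). *)
have := error_energy hW lQ lP bQ' bP hPQ' uW hu hue' (ltW L32) C0g x01.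
move/le_trans; apply.
have x0 : 0 <= x by move: x01; rewrite in_itv/= => /andP[].
have -> : g `^ (7 * C1 * x / 3) = expR (7 / 3 * (C1 * ln g) * x).
  by rewrite /powR gt_eqF//; congr expR; ring.
rewrite ler_wpM2r ?expR_ge0//.
by apply: error_bound_weaken => //; exact: H1norm_ge0.
Qed.
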